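(* Consider, on the one-dimensional torus $\mathbb T$ and for either choice of sign, the half-wave equation $$i\partial_tu+|\nabla|u=\pm|u|^2u,\qquad u|_{t=0}=u_0 .$$ Let $u_0\in H^{3/4}(\mathbb T)$, let $T>0$ and let $u\in\mathcal C([0,T],H^{3/4}(\mathbb T))$ be the unique (mild) solution. For a step size $\tau>0$ let $u^0=u_0$ and $$u^{\ell+1}=e^{i\tau|\nabla|}\Big(u^\ell\mp i\tau\,(u^\ell)^2\,\varphi_1(-2i\tau|\nabla|)\overline{u^\ell}\Big),\qquad\ell\ge0 .$$ Then there exists $C_T>0$ (independent of $\tau$ and $n$) such that $$\|u(n\tau)-u^n\|_{L^2}\le C_T\,\tau,\qquad0\le n\tau\le T.$$
   Context: $|\nabla|$ is the Fourier multiplier with symbol $|k|$, $k\in\mathbb Z$; $\varphi_1(z)=(e^z-1)/z$, and $\varphi_1(-2i\tau|\nabla|)$, $e^{i\tau|\nabla|}$ are Fourier multipliers. Functions are complex valued. A mild solution is one satisfying $u(t)=e^{it|\nabla|}u_0\mp i\int_0^te^{i(t-\xi)|\nabla|}|u(\xi)|^2u(\xi)\,d\xi$. *)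

(* Defs.v *)
From HB Require Import structures.
From mathcomp Require Import all_boot all_order all_algebra.
From mathcomp Require Import complex.
From mathcomp Require Import all_classical all_reals all_analysis measurable_realfun.

Set Implicit Arguments.
Unset Strict Implicit.
Unset Printing Implicit Defensive.

Import Order.TTheory GRing.Theory Num.Theory.
Import numFieldNormedType.Exports.

Local Open Scope classical_set_scope.
Local Open Scope ring_scope.

Definition cabs (R : realType) (z : R[i]) : R := Normc.normc z.

Definition cexp (R : realType) (z : R[i]) : R[i] :=
  ((expR (complex.Re z))%:C * (cos (complex.Im z) +i* sin (complex.Im z)))%C.

(* The singularity of (e^z - 1) / z at the origin is removable. *)
Definition phi1 (R : realType) (z : R[i]) : R[i] :=
  if z == 0 then 1 else (cexp z - 1) / z.

(* The torus is R / 2 pi Z: functions on it are 2pi-periodic functions on R,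
   and integrals are taken over the fundamental domain [-pi, pi]. *)
Definition period_cell (R : realType) : set R := `[- pi, pi]%classic.

Definition L2norm (R : realType) (f : R -> R[i]) : \bar R :=
  ((\int[lebesgue_measure]_(x in @period_cell R) ((cabs (f x)) ^+ 2)%:E)
    `^ 2^-1)%E.

Definition inL2 (R : realType) (f : R -> R[i]) : Prop :=
  [/\ forall x, f (x + 2 * pi) = f x,
      measurable_fun setT (fun x => complex.Re (f x)),
      measurable_fun setT (fun x => complex.Im (f x)) &
      (L2norm f < +oo)%E].

Definition ae_eq_torus (R : realType) (f g : R -> R[i]) : Prop :=
  {ae lebesgue_measure, forall x : R, period_cell x -> f x = g x}.

Definition cint (R : realType) (f : R -> R[i]) : R[i] :=
  ((\int[lebesgue_measure]_(x in @period_cell R) complex.Re (f x)) +i*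
   (\int[lebesgue_measure]_(x in @period_cell R) complex.Im (f x)))%C.

Definition fourier_coef (R : realType) (f : R -> R[i]) (k : int) : R[i] :=
  (((2 * pi)^-1)%:C)%C *
  cint (fun x => f x * cexp (- 'i%C * ((k%:~R * x)%:C)%C)).

Definition Hnorm (R : realType) (s : R) (f : R -> R[i]) : \bar R :=
  ((\esum_(k in [set: int])
      ((1 + k%:~R ^+ 2) `^ s * (cabs (fourier_coef f k)) ^+ 2)%:E) `^ 2^-1)%E.

Definition inH (R : realType) (s : R) (f : R -> R[i]) : Prop :=
  inL2 f /\ (Hnorm s f < +oo)%E.

(* The L^2 function with Fourier coefficients m(k) * f^(k); it is unique up to
   a null set, and it exists whenever f is in L^2 and m is bounded.  The value
   of xget is an arbitrary representative of this class. *)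
Definition fourier_mult (R : realType) (m : int -> R[i]) (f : R -> R[i]) :
    R -> R[i] :=
  xget (fun=> 0)
    [set g | inL2 g /\ forall k, fourier_coef g k = m k * fourier_coef f k].

Definition half_wave_group (R : realType) (t : R) : (R -> R[i]) -> R -> R[i] :=
  fourier_mult (fun k : int => cexp ('i%C * ((t * `|k|%:~R)%:C)%C)).

Definition phi1_mult (R : realType) (tau : R) : (R -> R[i]) -> R -> R[i] :=
  fourier_mult (fun k : int => phi1 (- 2%:R * 'i%C * ((tau * `|k|%:~R)%:C)%C)).

(* Bochner integral over [a, b] of an L^2(T)-valued function. *)
Record L2simple (R : realType) := MkL2simple {
  sf_size : nat ;
  sf_set : 'I_sf_size -> set R ;
  sf_val : 'I_sf_size -> R -> R[i] ;
  sf_set_measurable : forall j, measurable (sf_set j) ;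
  sf_val_L2 : forall j, inL2 (sf_val j) }.

Definition sf_eval (R : realType) (s : L2simple R) (r : R) : R -> R[i] :=
  fun x => \sum_(j < sf_size s) ((\1_(sf_set j) r)%:C)%C * sf_val j x.

Definition sf_integral (R : realType) (a b : R) (s : L2simple R) : R -> R[i] :=
  fun x => \sum_(j < sf_size s)
    ((fine (lebesgue_measure (sf_set j `&` `[a, b])))%:C)%C * sf_val j x.

Definition is_bochner_integral (R : realType) (a b : R) (F : R -> R -> R[i])
    (G : R -> R[i]) : Prop :=
  inL2 G /\
  exists S : nat -> L2simple R,
    let err n r := L2norm (fun x => F r x - sf_eval (S n) r x) in
    [/\ forall n, measurable_fun (`[a, b] : set R) (fun r : R => err n r : \bar R),
        (\int[lebesgue_measure]_(r in `[a, b]) err n r)%E @[n --> \oo] --> 0%E &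
        L2norm (fun x => G x - sf_integral a b (S n) x) @[n --> \oo] --> 0%E].

Definition continuous_in_H (R : realType) (s T : R) (u : R -> R -> R[i]) :
    Prop :=
  forall t : R, t \in `[0, T] ->
    inH s (u t) /\
    Hnorm s (fun x => u r x - u t x) @[r --> within `[0, T] (nbhs t)] --> 0%E.

Definition cubic (R : realType) (v : R -> R[i]) : R -> R[i] :=
  fun x => ((cabs (v x) ^+ 2)%:C)%C * v x.

(* The sign (-1) ^+ b is the sign in front of |u|^2 u in
   i u_t + |D| u = +/- |u|^2 u. *)
Definition mild_solution (R : realType) (b : bool) (T : R) (u0 : R -> R[i])
    (u : R -> R -> R[i]) : Prop :=
  forall t : R, t \in `[0, T] ->
    exists2 G : R -> R[i],
      is_bochner_integral 0 t
        (fun xi => half_wave_group (t - xi) (cubic (u xi))) G &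
      ae_eq_torus (u t)
        (fun x => half_wave_group t u0 x - (-1) ^+ b * 'i%C * G x).

Definition scheme_step (R : realType) (b : bool) (tau : R) (v : R -> R[i]) :
    R -> R[i] :=
  half_wave_group tau (fun x =>
    v x - (-1) ^+ b * 'i%C * (tau%:C)%C * v x ^+ 2 *
          phi1_mult tau (fun y => (v y)^*%C) x).

Definition scheme (R : realType) (b : bool) (tau : R) (u0 : R -> R[i])
    (n : nat) : R -> R[i] :=
  iter n (scheme_step b tau) u0.

(* Main.v *)
Require Import Defs.
From HB Require Import structures.
From mathcomp Require Import all_boot all_order all_algebra.
From mathcomp Require Import complex.
From mathcomp Require Import all_classical all_reals all_analysis measurable_realfun.
From mathcomp Require Import finmap ring lra.

(** The proof takes place on the Fourier side.  In dimension one H^(3/4) embeds in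
    the Wiener algebra of functions with absolutely summable Fourier coefficients,
    and this algebra is stable under all operations of the equation and of the
    scheme: products become convolutions [wiener_mul], and Fourier multipliers
    with bounded symbols exist [wiener_coef_bounded].  Functions are recovered from
    their coefficients by uniqueness [fourier_coef_inj] and their L^2 norm by
    Parseval's inequality [parseval].  The mild formulation becomes Duhamel's
    formula for each coefficient [ucoef_duhamel], and the scheme becomes the
    iteration of a map of sequences [step].

    Local error.  In a step from the time t, the solution contains the integral
    over s of exp(-is|D|) applied to the nonlinearity at time t + s, the scheme
    that of u(t)^2 exp(-2is|D|) conj(u(t)): the filter function is the mean of the
    phase exp(-2is|k|) over the step [phi_symbol_mean].  The difference has two
    parts.  Replacing u(t + s) by the free flow exp(is|D|) u(t) costs O(s)
    [free_flow_error].  Keeping only the phase of the conjugate factor costs at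
    most s times |j| + |l| + |m| - |j + l + m| at the frequencies j, l, m, and by
    the triangle inequality this is controlled by the two smaller frequencies
    [resonance_le].  Hence the derivative that is lost can always be shared by two
    factors, half a derivative on each, and the bilinear estimate [bilinear_min]
    bounds the result by two norms of H^(3/4).  This is the origin of the exponent
    3/4, and the local error is O(tau^2) in L^2 [local_error_l2].

    Global error.  One step is Lipschitz in L^2 on bounded sets of the Wiener
    algebra [step_lip], so the iterates have to be bounded there.  In the norm of
    that algebra the local error is still o(tau) [local_error_l1]; for small steps
    an induction keeps the error below 1, hence the iterates bounded, and the
    discrete Gronwall inequality sums the local errors to O(tau).  Steps above a
    fixed threshold are bounded in number, and crude bounds are enough for them
    [approx_error]. *)

Import Order.TTheory GRing.Theory Num.Theory.
Import numFieldNormedType.Exports.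

Local Open Scope classical_set_scope.
Local Open Scope ring_scope.

Set Implicit Arguments.
Unset Strict Implicit.
Unset Printing Implicit Defensive.

(** * Complex numbers *)

Section ComplexNumbers.
Variable R : realType.
Implicit Types (z w : R[i]) (x y : R).
Local Notation Re := complex.Re.
Local Notation Im := complex.Im.

Lemma ReD z w : Re (z + w) = Re z + Re w. Proof. by case: z; case: w. Qed.
Lemma ImD z w : Im (z + w) = Im z + Im w. Proof. by case: z; case: w. Qed.
Lemma ReN z : Re (- z) = - Re z. Proof. by case: z. Qed.
Lemma ImN z : Im (- z) = - Im z. Proof. by case: z. Qed.
Lemma ReB z w : Re (z - w) = Re z - Re w. Proof. by case: z; case: w. Qed.
Lemma ImB z w : Im (z - w) = Im z - Im w. Proof. by case: z; case: w. Qed.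
Lemma ReM z w : Re (z * w) = Re z * Re w - Im z * Im w.
Proof. by case: z; case: w. Qed.
Lemma ImM z w : Im (z * w) = Re z * Im w + Im z * Re w.
Proof. by case: z => a b; case: w => c d /=; rewrite [b * c]mulrC. Qed.
Lemma ReJ z : Re (z^*)%C = Re z. Proof. by case: z. Qed.
Lemma ImJ z : Im (z^*)%C = - Im z. Proof. by case: z. Qed.
Lemma Re_real x : Re (x%:C)%C = x. Proof. by []. Qed.
Lemma Im_real x : Im (x%:C)%C = 0. Proof. by []. Qed.

Lemma complex_eqP z w : Re z = Re w -> Im z = Im w -> z = w.
Proof. by case: z => a b; case: w => c d /= -> ->. Qed.

Lemma Re_sum I (r : seq I) (P : pred I) (F : I -> R[i]) :
  Re (\sum_(i <- r | P i) F i) = \sum_(i <- r | P i) Re (F i).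
Proof. exact: (big_morph _ ReD). Qed.

Lemma Im_sum I (r : seq I) (P : pred I) (F : I -> R[i]) :
  Im (\sum_(i <- r | P i) F i) = \sum_(i <- r | P i) Im (F i).
Proof. exact: (big_morph _ ImD). Qed.

Lemma cabs_sqr z : cabs z ^+ 2 = Re z ^+ 2 + Im z ^+ 2.
Proof. by case: z => a b; rewrite /cabs /= sqr_sqrtr// addr_ge0// sqr_ge0. Qed.

Lemma cabs_ge0 z : 0 <= cabs z.
Proof. by case: z => a b; exact: sqrtr_ge0. Qed.

Lemma cabs0 : cabs (0 : R[i]) = 0. Proof. exact: Normc.normc0. Qed.
Lemma cabs1 : cabs (1 : R[i]) = 1. Proof. exact: Normc.normc1. Qed.

Lemma cabsM z w : cabs (z * w) = cabs z * cabs w.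
Proof. exact: Normc.normcM. Qed.

Lemma cabsN z : cabs (- z) = cabs z.
Proof. exact: (@normcN R z). Qed.

Lemma cabsD z w : cabs (z + w) <= cabs z + cabs w.
Proof. exact: (@le_normcD R z w). Qed.

Lemma cabsB z w : cabs (z - w) <= cabs z + cabs w.
Proof. by rewrite -(cabsN w) cabsD. Qed.

Lemma cabs_distC z w : cabs (z - w) = cabs (w - z).
Proof. by rewrite -cabsN opprB. Qed.

Lemma cabs_eq0 z : cabs z = 0 -> z = 0.
Proof. exact: Normc.eq0_normc. Qed.

Lemma cabsJ z : cabs (z^*)%C = cabs z.
Proof. by case: z => a b; rewrite /cabs /= sqrrN. Qed.

Lemma cabs_real x : cabs (x%:C)%C = `|x|.
Proof. by rewrite /cabs /= expr0n addr0 sqrtr_sqr. Qed.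

Lemma cabs_i : cabs ('i%C : R[i]) = 1.
Proof. by rewrite /cabs /= expr0n expr1n add0r sqrtr1. Qed.

Lemma cabs_sign (b : bool) : cabs ((-1) ^+ b : R[i]) = 1.
Proof. by case: b; rewrite ?expr1 ?expr0 ?cabsN cabs1. Qed.

Lemma sqr_normr x : `|x| ^+ 2 = x ^+ 2.
Proof. by rewrite real_normK// num_real. Qed.

Lemma normr_Re z : `|Re z| <= cabs z.
Proof.
by rewrite -(@ler_pXn2r _ 2) ?nnegrE ?cabs_ge0// cabs_sqr sqr_normr lerDl sqr_ge0.
Qed.

Lemma normr_Im z : `|Im z| <= cabs z.
Proof.
by rewrite -(@ler_pXn2r _ 2) ?nnegrE ?cabs_ge0// cabs_sqr sqr_normr lerDr sqr_ge0.
Qed.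

Lemma cabs_le_ReIm z : cabs z <= `|Re z| + `|Im z|.
Proof.
rewrite -(@ler_pXn2r _ 2) ?nnegrE ?cabs_ge0 ?addr_ge0// cabs_sqr.
by rewrite sqrrD !sqr_normr [leRHS]addrAC lerDl mulrn_wge0// mulr_ge0.
Qed.

Lemma cabs_sum I (r : seq I) (P : pred I) (F : I -> R[i]) :
  cabs (\sum_(i <- r | P i) F i) <= \sum_(i <- r | P i) cabs (F i).
Proof.
elim/big_rec2 : _ => [|i x z _ h]; first by rewrite cabs0.
by rewrite (le_trans (cabsD _ _))// lerD2l.
Qed.

Lemma cabs_sumB z w v : cabs (z - v) <= cabs (z - w) + cabs (w - v).
Proof. by rewrite -{1}(subrK w z) -addrA cabsD. Qed.

End ComplexNumbers.

Section UnimodularNumbers.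
Variable R : realType.
Local Notation Re := complex.Re.
Local Notation Im := complex.Im.

Definition cis (x : R) : R[i] := (cos x +i* sin x)%C.

Lemma cis0 : cis 0 = 1. Proof. by rewrite /cis cos0 sin0. Qed.

Lemma cisD x y : cis (x + y) = cis x * cis y.
Proof.
by apply: complex_eqP; rewrite ?ReM ?ImM /= ?cosD ?sinD// addrC [cos x * _]mulrC.
Qed.

Lemma cisN x : cis (- x) = ((cis x)^*)%C.
Proof. by apply: complex_eqP; rewrite ?ReJ ?ImJ /= ?cosN ?sinN. Qed.

Lemma cabs_cis x : cabs (cis x) = 1.
Proof. by rewrite /cabs /= cos2Dsin2 sqrtr1. Qed.

Lemma cexp_i x : cexp ('i%C * (x%:C)%C) = cis x.
Proof.
rewrite /cexp ReM ImM /= !mul0r !mul1r subr0 add0r expR0.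
by rewrite rmorph1 mul1r.
Qed.

Lemma cexp_Ni x : cexp (- 'i%C * (x%:C)%C) = cis (- x).
Proof. by rewrite mulNr -mulrN -rmorphN cexp_i. Qed.

(** The chord is shorter than the arc. *)
Lemma cabs_cisB x y : cabs (cis x - cis y) <= `|x - y|.
Proof.
have -> : cis x - cis y = cis y * (cis (x - y) - 1).
  by rewrite mulrBr mulr1 -cisD (addrC y) subrK.
rewrite cabsM cabs_cis mul1r; move: (x - y) => {x y} t.
rewrite -(@ler_pXn2r _ 2) ?nnegrE ?cabs_ge0// cabs_sqr ReB ImB /= subr0 sqr_normr.
have -> : (cos t - 1) ^+ 2 + sin t ^+ 2 = 2 * (1 - cos t).
  by rewrite sqrrB sin2cos2; ring.
have -> : t = t / 2 + t / 2 by rewrite -splitr.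
set s := t / 2.
have -> : 2 * (1 - cos (s + s)) = 4 * sin s ^+ 2.
  by rewrite cosD -!expr2 cos2sin2; ring.
have -> : (s + s) ^+ 2 = 4 * s ^+ 2 by ring.
rewrite ler_pM2l// -(sqr_normr (sin s)) -(sqr_normr s).
rewrite ler_pXn2r ?nnegrE//.
wlog s0 : s / 0 <= s => [h|].
  have [|/ltW s0] := leP 0 s; first exact: h.
  by rewrite -normrN -sinN -(normrN s); apply: h; rewrite oppr_ge0.
rewrite [leRHS]ger0_norm//.
have [s1|s1] := ltP s 1; last first.
  by rewrite (le_trans _ s1)// ler_norml sin_geN1 sin_le1.
have dsin : forall x : R, x \in `]0, s[%R -> is_derive x 1 (@sin R) (cos x).
  by move=> x _; exact: is_derive_sin.
have [->|sn0] := eqVneq s 0; first by rewrite sin0 normr0.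
have sp : 0 < s by rewrite lt_neqAle eq_sym sn0.
have [|c _] := @MVT R sin cos 0 s sp dsin.
  by apply: continuous_subspaceT => x; exact: continuous_sin.
rewrite sin0 !subr0 => ->; rewrite normrM (ger0_norm s0) ler_piMl//.
by rewrite ler_norml cos_geN1 cos_le1.
Qed.

End UnimodularNumbers.

(** * Nonnegative sums and sums over the integers *)

Local Notation "\esum_ k F" := (\esum_(k in [set: _]) F)
  (at level 41, k name, F at level 41, only parsing) : ereal_scope.

Section NonnegativeSums.
Variable R : realType.
Local Open Scope ereal_scope.

Lemma le_esum_term (T : choiceType) (f : T -> \bar R) i : f i <= \esum_ k (f k).
Proof.
apply: esum_ge; exists [set i]; last by rewrite fsbig_set1.
by split => //; exact: finite_set1.
Qed.

Lemma esum_le_fin (T : choiceType) (f : T -> \bar R) M :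
  (forall s : seq T, uniq s -> \sum_(k <- s) f k <= M) -> \esum_ k (f k) <= M.
Proof.
move=> h; apply: ge_ereal_sup => _ [X [finX _] <-].
by rewrite fsbig_finite//=; apply: h; exact: fset_uniq.
Qed.

Lemma le_sum_esum (T : choiceType) (f : T -> \bar R) (s : seq T) :
  uniq s -> \sum_(k <- s) f k <= \esum_ k (f k).
Proof.
move=> us; apply: esum_ge; exists [set` s]; last by rewrite fsbig_seq.
by split => //; exact: finite_seq.
Qed.

Lemma esumZl (T : choiceType) (c : \bar R) (f : T -> \bar R) :
  0 <= c -> (forall i, 0 <= f i) -> \esum_ k (c * f k) = c * \esum_ k (f k).
Proof.
move=> c0 f0; case: c c0 => [c| |]//; last first.
  move=> _; have [[i fi]|h] := pselect (exists i, 0 < f i).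
    rewrite gt0_mulye; last exact: lt_le_trans fi (le_esum_term _ _).
    have := le_esum_term (fun k => +oo * f k) i.
    by rewrite gt0_mulye// leye_eq => /eqP.
  have f00 i : f i = 0.
    apply/eqP; rewrite eq_le f0 andbT leNgt; apply/negP => fi.
    by apply: h; exists i.
  by rewrite !esum1 ?mule0// => i _; rewrite f00 mule0.
rewrite lee_fin => c0; rewrite /esum -ereal_supZl//; last first.
  by apply/set0P; exists 0; exists set0; [exact: fsets_set0|rewrite fsbig_set0].
congr ereal_sup; apply/seteqP; split => x.
  move=> [X FX <-]; exists (\sum_(k \in X) f k)%R; first by exists X.
  by rewrite ge0_mule_fsumr.
by move=> [_ [X FX <-] <-]; exists X => //; rewrite ge0_mule_fsumr.
Qed.

Lemma esumZr (T : choiceType) (c : \bar R) (f : T -> \bar R) :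
  0 <= c -> (forall i, 0 <= f i) -> \esum_ k (f k * c) = (\esum_ k (f k)) * c.
Proof.
move=> c0 f0; rewrite [RHS]muleC -esumZl//.
by apply: eq_esum => i _ /=; rewrite muleC.
Qed.

Lemma esum_bij (T T' : choiceType) (e : T -> T') (f : T' -> \bar R) :
  bijective e -> \esum_ k (f k) = \esum_ k (f (e k)).
Proof.
move=> be; apply: reindex_esum; split => //.
  by move=> x y _ _; exact: (bij_inj be).
by case: be => g eK gK y _; exists (g y).
Qed.

Lemma esum_shift (f : int -> \bar R) m : \esum_ k (f (k + m)%R) = \esum_ k (f k).
Proof.
by symmetry; apply: (esum_bij (e := fun k => (k + m)%R));
  exists (fun k => (k - m)%R) => k; rewrite ?addrK ?subrK.
Qed.

Lemma esum_opp (f : int -> \bar R) : \esum_ k (f (- k)%R) = \esum_ k (f k).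
Proof.
by symmetry; apply: (esum_bij (e := fun k : int => (- k)%R));
  exists (fun k => (- k)%R) => k; rewrite opprK.
Qed.

Lemma esum_pair (T1 T2 : choiceType) (a : T1 -> T2 -> \bar R) :
  (forall i j, 0 <= a i j) ->
  \esum_ i (\esum_ j (a i j)) = \esum_ p (a p.1 p.2).
Proof.
move=> a0; rewrite esum_esum//; congr esum.
by apply/seteqP; split.
Qed.

Lemma esum_swap (T1 T2 : choiceType) (a : T1 -> T2 -> \bar R) :
  (forall i j, 0 <= a i j) ->
  \esum_ i (\esum_ j (a i j)) = \esum_ j (\esum_ i (a i j)).
Proof.
move=> a0; rewrite !esum_pair//.
rewrite (esum_bij (e := fun p => (p.2, p.1)) (fun p => a p.1 p.2))//=.
by exists (fun p => (p.2, p.1)) => -[].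
Qed.

(** A weighted form of the elementary inequality x y <= (x^2 + y^2)/2, summed
    and optimised over the weight. *)
Lemma esum_CauchySchwarz (T : choiceType) (f g : T -> R) (M N : R) :
  (forall i, 0 <= f i)%R -> (forall i, 0 <= g i)%R -> (0 <= M)%R -> (0 <= N)%R ->
  \esum_ i ((f i ^+ 2)%:E) <= (M ^+ 2)%:E ->
  \esum_ i ((g i ^+ 2)%:E) <= (N ^+ 2)%:E ->
  \esum_ i ((f i * g i)%:E) <= (M * N)%:E.
Proof.
move=> f0 g0 M0 N0 fM gN.
have z0 (h : T -> R) : \esum_ i ((h i ^+ 2)%:E) <= 0 -> forall i, h i = 0%R.
  move=> h0 i; have := le_trans (le_esum_term (fun i => (h i ^+ 2)%:E) i) h0.
  by rewrite lee_fin -sqr_normr real_exprn_even_le0//= ?num_real// normr_eq0 => /eqP.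
have [M00|Mn0] := eqVneq M 0%R.
  rewrite M00 expr0n/= in fM.
  by rewrite M00 mul0r esum1// => i _; rewrite (z0 _ fM) mul0r.
have [N00|Nn0] := eqVneq N 0%R.
  rewrite N00 expr0n/= in gN.
  by rewrite N00 mulr0 esum1// => i _; rewrite (z0 _ gN) mulr0.
have Mp : (0 < M)%R by rewrite lt_neqAle eq_sym Mn0.
have Np : (0 < N)%R by rewrite lt_neqAle eq_sym Nn0.
apply: (@le_trans _ _ (\esum_ i ((N / (2 * M))%:E * (f i ^+ 2)%:E +
                                 (M / (2 * N))%:E * (g i ^+ 2)%:E))).
  apply: le_esum => i _; rewrite -!EFinM -EFinD lee_fin -subr_ge0.
  have -> : (N / (2 * M) * f i ^+ 2 + M / (2 * N) * g i ^+ 2 - f i * g i =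
             (N * f i - M * g i) ^+ 2 / (2 * M * N))%R.
    by field; rewrite Mn0 Nn0.
  by rewrite divr_ge0 ?sqr_ge0// !mulr_ge0.
have c1 : (0 <= N / (2 * M))%R by rewrite divr_ge0 ?mulr_ge0.
have c2 : (0 <= M / (2 * N))%R by rewrite divr_ge0 ?mulr_ge0.
rewrite esumD; [|move=> i _|move=> i _]; last 2 first.
- by rewrite -EFinM lee_fin mulr_ge0 ?sqr_ge0.
- by rewrite -EFinM lee_fin mulr_ge0 ?sqr_ge0.
rewrite !esumZl ?lee_fin//; try by move=> i; rewrite lee_fin sqr_ge0.
apply: (@le_trans _ _ ((N / (2 * M))%:E * (M ^+ 2)%:E +
                       (M / (2 * N))%:E * (N ^+ 2)%:E)).
  by apply: leeD; apply: lee_wpmul2l; rewrite ?lee_fin.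
rewrite -!EFinM -EFinD lee_fin le_eqVlt; apply/orP; left; apply/eqP.
by field; rewrite Mn0 Nn0.
Qed.

End NonnegativeSums.

Section SumsOverIntegers.
Variable R : realType.
Local Notation Re := complex.Re.
Local Notation Im := complex.Im.
Implicit Types (a b : int -> R[i]).

(** The interval is half-open so that sums over it split into two series indexed
    by the natural numbers, one for each constructor of the integers. *)
Definition window (N : nat) : seq int :=
  [seq Posz n | n <- iota 0 N] ++ [seq Negz n | n <- iota 0 N].

Lemma window_uniq N : uniq (window N).
Proof.
rewrite cat_uniq !map_inj_uniq ?iota_uniq//=; try by move=> ? ? [].
by rewrite andbT; apply/hasPn => _ /mapP[n _ ->]; apply/negP => /mapP[].
Qed.

Lemma mem_window N k :
  (k \in window N) = match k with Posz n => (n < N)%N | Negz n => (n < N)%N end.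
Proof.
rewrite mem_cat; case: k => n.
  rewrite mem_map ?mem_iota ?leq0n/=; last by move=> ? ? [].
  by case: ltnP => //= _; apply/negP => /mapP[].
rewrite orbC mem_map ?mem_iota ?leq0n/=; last by move=> ? ? [].
by case: ltnP => //= _; apply/negP => /mapP[].
Qed.

Lemma mem_window_le N N' k : (N <= N')%N -> k \in window N -> k \in window N'.
Proof. by move=> NN; rewrite !mem_window; case: k => n /leq_trans; apply. Qed.

Lemma sub_window (s : seq int) : exists N, forall k, k \in s -> k \in window N.
Proof.
elim: s => [|x s [N h]]; first by exists 0%N.
exists (maxn N (absz x).+1) => k; rewrite inE => /predU1P[->|/h]; last first.
  by apply: mem_window_le; exact: leq_maxl.
apply: (@mem_window_le (absz x).+1); first exact: leq_maxr.
by rewrite mem_window; case: x => n //=.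
Qed.

Lemma window_le (N : nat) k : k \in window N -> `|k|%:~R <= N%:R :> R.
Proof.
rewrite mem_window; case: k => n nN; first by rewrite ger0_norm// ler_nat ltnW.
by rewrite NegzE normrN ger0_norm// ler_nat.
Qed.

(** All exchanges of an infinite sum with another limit rest on this truncation. *)
Lemma esum_tail (f : int -> \bar R) (e : R) : (forall k, (0 <= f k)%E) ->
  (\esum_ k (f k) < +oo)%E -> 0 < e ->
  exists N, (\esum_ k (if k \in window N then 0 else f k) <= e%:E)%E.
Proof.
move=> f0 fy e0.
have Sfin : (\esum_ k (f k))%E \is a fin_num by rewrite ge0_fin_numE// esum_ge0.
have : ((\esum_ k (f k)) - e%:E < \esum_ k (f k))%E.
  by rewrite lteBlDr// lteDl// lte_fin.
move=> /ereal_sup_gt[_ [X [finX _] <-]].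
rewrite fsbig_finite//= => hX.
have [N hN] := sub_window (fset_set X).
exists N; set rest := (X in (X <= _)%E).
have split_f : (\esum_ k (f k) = \esum_ k (if k \in window N then f k else 0) + rest)%E.
  rewrite -esumD; try by move=> k _; case: ifP.
  by apply: eq_esum => k _; case: ifP => _; rewrite ?add0e ?adde0.
have le1 : (\sum_(k <- fset_set X) f k <=
   \esum_ k (if k \in window N then f k else 0))%E.
  rewrite (eq_big_seq (fun k => if k \in window N then f k else 0%E)).
    exact: (le_sum_esum (fun k => if k \in window N then f k else 0%E) (fset_uniq _)).
  by move=> k kX; rewrite hN.
have W0 : (0 <= \esum_ k (if k \in window N then f k else 0))%E.
  by apply: esum_ge0 => k _; case: ifP.
have R0 : (0 <= rest)%E by apply: esum_ge0 => k _; case: ifP.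
have Wfin : (\esum_ k (if k \in window N then f k else 0))%E \is a fin_num.
  rewrite ge0_fin_numE// (le_lt_trans _ fy)// split_f.
  by rewrite leeDl.
have Rfin : rest \is a fin_num.
  by rewrite ge0_fin_numE// (le_lt_trans _ fy)// split_f leeDr.
move: hX; rewrite EFinN lteBlDr// => hX.
have := le_lt_trans _ (lt_le_trans hX (leeD le1 (lexx _))).
move=> /(_ _ (lexx _)); rewrite split_f.
by rewrite -(fineK Wfin) -(fineK Rfin) -!EFinD lte_fin lee_fin ltrD2l => /ltW.
Qed.

Definition l1 a := (\esum_ k (cabs (a k))%:E < +oo)%E.

Lemma l1_le a b : (forall k, cabs (a k) <= cabs (b k)) -> l1 b -> l1 a.
Proof. by move=> h; apply: le_lt_trans; apply: le_esum => k _; rewrite lee_fin. Qed.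

Lemma l1D a b : l1 a -> l1 b -> l1 (fun k => a k + b k).
Proof.
rewrite /l1 => ha hb.
apply: (@le_lt_trans _ _ (\esum_ k ((cabs (a k))%:E + (cabs (b k))%:E))%E).
  by apply: le_esum => k _; rewrite -EFinD lee_fin cabsD.
by rewrite esumD ?lte_add_pinfty// => k _; rewrite lee_fin cabs_ge0.
Qed.

Lemma l1_bounded a (m : int -> R[i]) (M : R) : (forall k, cabs (m k) <= M) ->
  l1 a -> l1 (fun k => m k * a k).
Proof.
move=> hm ha; have M0 : 0 <= M := le_trans (cabs_ge0 _) (hm 0).
apply: (@le_lt_trans _ _ (\esum_ k (M%:E * (cabs (a k))%:E))%E).
  by apply: le_esum => k _; rewrite -EFinM lee_fin cabsM ler_wpM2r ?cabs_ge0.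
rewrite esumZl ?lee_fin//; last by move=> k; rewrite lee_fin cabs_ge0.
rewrite -(@fineK _ (esum _ _)) -?EFinM ?ltry// ge0_fin_numE//.
by apply: esum_ge0 => k _; rewrite lee_fin cabs_ge0.
Qed.

Definition psum N a := \sum_(k <- window N) a k.

(** Summation along the windows is defined for all families and additive on the
    absolutely summable ones. *)
Definition csum a : R[i] :=
  (limn (fun N => Re (psum N a)) +i* limn (fun N => Im (psum N a)))%C.

Lemma cabs_psum N a : ((cabs (psum N a))%:E <= \esum_ k (cabs (a k))%:E)%E.
Proof.
apply: (le_trans _ (le_sum_esum _ (window_uniq N))).
by rewrite sumEFin lee_fin cabs_sum.
Qed.

Lemma cvg_window (x : int -> R) : (\esum_ k `|x k|%:E < +oo)%E ->
  cvgn (fun N => \sum_(k <- window N) x k).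
Proof.
move=> hx.
have cvg_half (e : nat -> int) : injective e -> cvgn (series (x \o e)).
  move=> ie; apply: normed_cvg.
  set S := fine (\esum_ k `|x k|%:E)%E.
  have hS : (\esum_ k `|x k|%:E)%E = S%:E.
    by rewrite fineK// ge0_fin_numE//; apply: esum_ge0 => k _; rewrite lee_fin.
  apply: nondecreasing_is_cvgn.
    by apply/nondecreasing_seqP => n; rewrite -subr_ge0 seriesSB /=.
  exists S => _ [n _ <-]; rewrite -lee_fin -hS.
  apply: (le_trans _ (le_sum_esum (s := [seq e i | i <- iota 0 n]) _ _));
    last by rewrite (map_inj_uniq ie) iota_uniq.
  by rewrite big_map sumEFin -{2}(subn0 n) -/(index_iota 0 n).
have -> : (fun N => \sum_(k <- window N) x k) =
  (fun N => series (x \o Posz) N + series (x \o Negz) N).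
  by apply/funext => N; rewrite /window big_cat !big_map -{1 2}(subn0 N) -/(index_iota 0 N).
by apply: is_cvgD; apply: cvg_half => ? ? [].
Qed.

Lemma cvg_psum_Re a : l1 a -> Re (psum N a) @[N --> \oo] --> Re (csum a).
Proof.
move=> ha; rewrite /csum/=; apply/cvg_ex; apply/cvg_ex.
have -> : (fun N => Re (psum N a)) = (fun N => \sum_(k <- window N) Re (a k)).
  by apply/funext => N; rewrite /psum Re_sum.
apply: cvg_window; apply: le_lt_trans ha; apply: le_esum => k _.
by rewrite lee_fin normr_Re.
Qed.

Lemma cvg_psum_Im a : l1 a -> Im (psum N a) @[N --> \oo] --> Im (csum a).
Proof.
move=> ha; rewrite /csum/=; apply/cvg_ex; apply/cvg_ex.
have -> : (fun N => Im (psum N a)) = (fun N => \sum_(k <- window N) Im (a k)).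
  by apply/funext => N; rewrite /psum Im_sum.
apply: cvg_window; apply: le_lt_trans ha; apply: le_esum => k _.
by rewrite lee_fin normr_Im.
Qed.

End SumsOverIntegers.

(** * Absolutely convergent complex sums *)

Section ComplexSums.
Variable R : realType.
Local Notation Re := complex.Re.
Local Notation Im := complex.Im.
Implicit Types (a b : int -> R[i]).

Lemma csum_unique a z : Re (psum N a) @[N --> \oo] --> Re z ->
  Im (psum N a) @[N --> \oo] --> Im z -> csum a = z.
Proof. by move=> hr hi; apply: complex_eqP; rewrite /csum/=; apply/cvg_lim. Qed.

Lemma csumD a b : l1 a -> l1 b -> csum (fun k => a k + b k) = csum a + csum b.
Proof.
move=> ha hb; apply: csum_unique; rewrite ?ReD ?ImD.
- have -> : (fun N => Re (psum N (fun k => a k + b k))) =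
            (fun N => Re (psum N a) + Re (psum N b)).
    by apply/funext => N; rewrite /psum big_split ReD.
  by apply: cvgD; exact: cvg_psum_Re.
- have -> : (fun N => Im (psum N (fun k => a k + b k))) =
            (fun N => Im (psum N a) + Im (psum N b)).
    by apply/funext => N; rewrite /psum big_split ImD.
  by apply: cvgD; exact: cvg_psum_Im.
Qed.

Lemma csumZ (z : R[i]) a : l1 a -> csum (fun k => z * a k) = z * csum a.
Proof.
move=> ha; apply: csum_unique; rewrite ?ReM ?ImM.
- have -> : (fun N => Re (psum N (fun k => z * a k))) =
            (fun N => Re z * Re (psum N a) - Im z * Im (psum N a)).
    by apply/funext => N; rewrite /psum -mulr_sumr ReM.
  by apply: cvgB; apply: cvgMr; [exact: cvg_psum_Re|exact: cvg_psum_Im].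
- have -> : (fun N => Im (psum N (fun k => z * a k))) =
            (fun N => Re z * Im (psum N a) + Im z * Re (psum N a)).
    by apply/funext => N; rewrite /psum -mulr_sumr ImM.
  by apply: cvgD; apply: cvgMr; [exact: cvg_psum_Im|exact: cvg_psum_Re].
Qed.

Lemma l1Z (z : R[i]) a : l1 a -> l1 (fun k => z * a k).
Proof. exact: (@l1_bounded _ a (fun=> z) (cabs z)). Qed.

Lemma l1B a b : l1 a -> l1 b -> l1 (fun k => a k - b k).
Proof.
move=> ha hb; apply: l1D => //; apply: l1_le hb => k.
by rewrite cabsN.
Qed.

Lemma csumB a b : l1 a -> l1 b -> csum (fun k => a k - b k) = csum a - csum b.
Proof.
move=> ha hb; rewrite csumD//; last by apply: l1_le hb => k; rewrite cabsN.
congr (_ + _); rewrite -mulN1r -csumZ//; congr csum.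
by apply/funext => k; rewrite mulN1r.
Qed.

Lemma csum_finite (N : nat) a : (forall k, k \notin window N -> a k = 0) ->
  csum a = psum N a.
Proof.
move=> ha; have psumE N' : (N <= N')%N -> psum N' a = psum N a.
  move=> NN; rewrite /psum.
  rewrite (perm_big ([seq k <- window N' | k \in window N] ++
                     [seq k <- window N' | k \notin window N]))/=; last first.
    by rewrite perm_sym perm_filterC.
  rewrite big_cat/= [X in _ + X]big1_seq ?addr0; last first.
    by move=> k; rewrite mem_filter => /andP[_ /andP[/ha]].
  apply: perm_big; apply: uniq_perm; rewrite ?filter_uniq ?window_uniq//.
  move=> k; rewrite mem_filter; case: (boolP (k \in window N)) => //= kN.
  exact: mem_window_le kN.
apply: csum_unique; apply: (@cvg_near_cst _ _ _ _ _).
- by near=> N'; rewrite psumE//; near: N'; exists N.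
- by near=> N'; rewrite psumE//; near: N'; exists N.
Unshelve. all: by end_near. Qed.

Lemma cabs_csum a : ((cabs (csum a))%:E <= \esum_ k (cabs (a k))%:E)%E.
Proof.
have [ha|] := ltP (\esum_ k (cabs (a k))%:E)%E +oo%E; last first.
  by rewrite leye_eq => /eqP ->; rewrite leey.
set S := (\esum_ k _)%E in ha *.
have S0 : (0 <= S)%E by apply: esum_ge0 => k _; rewrite lee_fin cabs_ge0.
have SE : S = (fine S)%:E by rewrite fineK// ge0_fin_numE.
rewrite SE lee_fin -(@ler_pXn2r _ 2) ?nnegrE ?cabs_ge0 ?fine_ge0//.
rewrite cabs_sqr.
have cv : (Re (psum N a) ^+ 2 + Im (psum N a) ^+ 2) @[N --> \oo] -->
    Re (csum a) ^+ 2 + Im (csum a) ^+ 2.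
  apply: cvgD; rewrite !expr2; apply: cvgM.
  - exact: cvg_psum_Re.
  - exact: cvg_psum_Re.
  - exact: cvg_psum_Im.
  - exact: cvg_psum_Im.
rewrite -(cvg_lim (@norm_hausdorff _ R^o) cv).
apply: limr_le; first by apply/cvg_ex; eexists; exact: cv.
apply: nearW => N; rewrite -cabs_sqr ler_pXn2r ?nnegrE ?cabs_ge0 ?fine_ge0//.
by rewrite -lee_fin -SE cabs_psum.
Qed.

Lemma csum_tail N a : l1 a ->
  ((cabs (csum a - psum N a))%:E <=
    \esum_ k (if k \in window N then 0 else (cabs (a k))%:E))%E.
Proof.
move=> ha; pose aN k := if k \in window N then a k else 0.
have -> : psum N a = csum aN.
  rewrite (@csum_finite N); last by move=> k; rewrite /aN => /negbTE ->.
  by rewrite /psum; apply: eq_big_seq => k kN; rewrite /aN kN.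
rewrite -csumB//; last first.
  by apply: l1_le ha => k; rewrite /aN; case: ifP => // _; rewrite cabs0 cabs_ge0.
apply: (le_trans (cabs_csum _)); apply: le_esum => k _.
by rewrite /aN; case: ifP => _; rewrite ?subrr ?cabs0 ?subr0.
Qed.

(** A sum is determined by any null sequence of errors of its partial sums. *)
Lemma csum_eq_approx a z : l1 a ->
  (forall e : R, 0 < e -> exists N0, forall N, (N0 <= N)%N ->
     cabs (z - psum N a) <= e) -> z = csum a.
Proof.
move=> ha hz; apply/eqP; rewrite -subr_eq0; apply/eqP; apply: cabs_eq0.
apply/eqP; rewrite eq_le cabs_ge0 andbT; apply/ler_addgt0Pl => e e0; rewrite addr0.
have e2 : 0 < e / 2 by rewrite divr_gt0.
have [N0 hN0] := hz _ e2.
have a0 k : (0 <= (cabs (a k))%:E)%E by rewrite lee_fin cabs_ge0.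
have [N1 hN1] := esum_tail a0 ha e2.
have tailN N : (N1 <= N)%N -> cabs (csum a - psum N a) <= e / 2.
  move=> N1N; rewrite -lee_fin; apply: le_trans (csum_tail N ha) _.
  apply: le_trans hN1; apply: le_esum => k _.
  case: (boolP (k \in window N1)) => [/(mem_window_le N1N) ->//|_].
  by case: ifP => // _; rewrite lee_fin cabs_ge0.
rewrite (le_trans (cabs_sumB z (psum (maxn N0 N1) a) (csum a)))//.
rewrite (splitr e) lerD// ?hN0 ?leq_maxl//.
by rewrite cabs_distC tailN// leq_maxr.
Qed.

End ComplexSums.

(** * Trilinear sums and norms of sequences *)

Section TrilinearSums.
Variable R : realType.
Local Notation C := R[i].
Implicit Types (a b c : int -> C) (F G : int -> int -> int -> C) (M N P : R).
Local Open Scope ereal_scope.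

Definition esum3 (f : int -> int -> int -> \bar R) : \bar R :=
  \esum_ j (\esum_ l (\esum_ m (f j l m))).

Lemma le_esum3 f g : (forall j l m, f j l m <= g j l m) -> esum3 f <= esum3 g.
Proof. by move=> fg; do 3 (apply: le_esum => ? _). Qed.

Lemma eq_esum3 f g : (forall j l m, f j l m = g j l m) -> esum3 f = esum3 g.
Proof. by move=> fg; do 3 (apply: eq_esum => ? _). Qed.

Lemma esum3D f g : (forall j l m, 0 <= f j l m) -> (forall j l m, 0 <= g j l m) ->
  esum3 (fun j l m => f j l m + g j l m) = esum3 f + esum3 g.
Proof.
move=> f0 g0; rewrite /esum3 -esumD; last 2 first.
- by move=> j _; do 2 (apply: esum_ge0 => ? _).
- by move=> j _; do 2 (apply: esum_ge0 => ? _).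
apply: eq_esum => j _; rewrite -esumD; last 2 first.
- by move=> l _; apply: esum_ge0 => ? _.
- by move=> l _; apply: esum_ge0 => ? _.
by apply: eq_esum => l _; rewrite -esumD.
Qed.

Lemma esum3Z (x : R) f : (0 <= x)%R -> (forall j l m, 0 <= f j l m) ->
  esum3 (fun j l m => x%:E * f j l m) = x%:E * esum3 f.
Proof.
move=> x0 f0; rewrite /esum3 -esumZl ?lee_fin//; last first.
  by move=> j; do 2 (apply: esum_ge0 => ? _).
apply: eq_esum => j _; rewrite -esumZl ?lee_fin//; last first.
  by move=> l; apply: esum_ge0 => ? _.
by apply: eq_esum => l _; rewrite -esumZl ?lee_fin.
Qed.

Lemma esum3_rot f : (forall j l m, 0 <= f j l m) ->
  esum3 f = esum3 (fun l m j => f j l m).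
Proof.
move=> f0; rewrite /esum3 esum_swap; last by move=> j l; apply: esum_ge0.
by apply: eq_esum => l _; rewrite esum_swap.
Qed.

Lemma esum3_swap f : (forall j l m, 0 <= f j l m) ->
  esum3 f = esum3 (fun l j m => f j l m).
Proof. by move=> f0; rewrite /esum3 esum_swap// => j l; apply: esum_ge0. Qed.

Definition trisum F (k : int) : C :=
  csum (fun j => csum (fun l => F j l (k - j - l)%R)).

(** Summability over all triples dominates the sums over the planes j + l + m = k
    simultaneously, hence linearity of trisum needs no condition on k. *)
Definition t1 F := esum3 (fun j l m => (cabs (F j l m))%:E) < +oo.

Lemma t1_slice F k : t1 F ->
  \esum_ j (\esum_ l (cabs (F j l (k - j - l)%R))%:E) < +oo.
Proof.
apply: le_lt_trans; apply: le_esum => j _; apply: le_esum => l _.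
exact: (le_esum_term (fun m => (cabs (F j l m))%:E)).
Qed.

Lemma t1_inner F k j : t1 F -> l1 (fun l => F j l (k - j - l)%R).
Proof.
move=> /(t1_slice k); apply: le_lt_trans.
exact: (le_esum_term (fun j => \esum_ l (cabs (F j l (k - j - l)%R))%:E)).
Qed.

Lemma t1_outer F k : t1 F -> l1 (fun j => csum (fun l => F j l (k - j - l)%R)).
Proof.
move=> /(t1_slice k); apply: le_lt_trans; apply: le_esum => j _.
exact: cabs_csum.
Qed.

Lemma cabs_trisum F k :
  (cabs (trisum F k))%:E <= \esum_ j (\esum_ l (cabs (F j l (k - j - l)%R))%:E).
Proof.
apply: (le_trans (cabs_csum _)); apply: le_esum => j _.
exact: cabs_csum.
Qed.

Lemma trisumB F G k : t1 F -> t1 G ->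
  trisum (fun j l m => F j l m - G j l m)%R k = (trisum F k - trisum G k)%R.
Proof.
move=> hF hG; rewrite /trisum -csumB; [|exact: t1_outer..].
congr csum; apply/funext => j.
by rewrite -csumB//; exact: t1_inner.
Qed.

Lemma trisumZ F k z : t1 F ->
  trisum (fun j l m => z (j + l + m) * F j l m)%R k = (z k * trisum F k)%R.
Proof.
move=> hF; rewrite /trisum -csumZ; last exact: t1_outer.
congr csum; apply/funext => j; rewrite -csumZ; last exact: t1_inner.
congr csum; apply/funext => l; congr (z _ * _)%R.
by rewrite -addrA [(l + _)%R]addrC subrK addrC subrK.
Qed.

Definition conv a b (k : int) : C := csum (fun j => a j * b (k - j))%R.

Lemma conv_l1 a b k : l1 a -> l1 b -> l1 (fun j => a j * b (k - j))%R.
Proof.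
move=> ha hb.
have [M hM] : exists M : R, forall j, (cabs (b j) <= M)%R.
  exists (fine (\esum_ k (cabs (b k))%:E)) => j.
  rewrite -lee_fin fineK; first exact: (le_esum_term (fun k => (cabs (b k))%:E)).
  by rewrite ge0_fin_numE//; apply: esum_ge0 => i _; rewrite lee_fin cabs_ge0.
apply: (l1_le (b := fun j => b (k - j)%R * a j)%R).
  by move=> j; rewrite mulrC.
by apply: (@l1_bounded _ a _ M).
Qed.

Lemma trisum_conv a b c k : l1 b -> l1 c ->
  conv a (conv b c) k = trisum (fun j l m => a j * (b l * c m))%R k.
Proof.
move=> hb hc; congr csum; apply/funext => j.
by rewrite /conv -csumZ//; exact: conv_l1.
Qed.

(** Norms of sequences are introduced by duality: a bound by M means
    sum |a_k| h_k <= M for all h in a class of nonnegative test sequences.  The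
    class of all h <= 1 gives the norm of l^1, and the unit ball of l^2 gives the
    norm of l^2.  All estimates of sums and integrals of sequences are immediate
    in this form, and both norms are treated at once. *)
Definition norm_le (H : set (int -> R)) a M :=
  forall h, H h -> \esum_ k ((cabs (a k) * h k)%:E) <= M%:E.

Record test_class (H : set (int -> R)) : Prop := TestClass {
  test_ge0 : forall h, H h -> forall k, (0 <= h k)%R ;
  test_le1 : forall h, H h -> forall k, (h k <= 1)%R ;
  test_shift : forall h n, H h -> H (fun k => h (k + n)%R) ;
  test_opp : forall h, H h -> H (fun k => h (- k)%R) }.

Definition test_l1 : set (int -> R) :=
  [set h | forall k, (0 <= h k)%R /\ (h k <= 1)%R].

Definition test_l2 : set (int -> R) :=
  [set h | (forall k, (0 <= h k)%R) /\ \esum_ k ((h k ^+ 2)%:E) <= 1].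

Lemma test_class_l1 : test_class test_l1.
Proof.
split=> [h Hh k|h Hh k|h n Hh k|h Hh k] //=; first by have [] := Hh k.
by have [] := Hh k.
Qed.

Lemma test_class_l2 : test_class test_l2.
Proof.
split => h /=.
- by case.
- move=> [h0 h2] k; rewrite -(@expr_le1 _ 2)// -lee_fin.
  exact: le_trans (le_esum_term (fun k => (h k ^+ 2)%:E) k) h2.
- by move=> n [h0 h2]; split => //; rewrite (esum_shift (fun k => (h k ^+ 2)%:E)).
- by move=> [h0 h2]; split => //; rewrite (esum_opp (fun k => (h k ^+ 2)%:E)).
Qed.

Lemma norm_l1P a M : norm_le test_l1 a M <-> \esum_ k (cabs (a k))%:E <= M%:E.
Proof.
split=> [h|aM h hh].
  have := h (fun=> 1%R) (fun k => conj ler01 (lexx _)).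
  by under eq_esum do rewrite mulr1.
apply: le_trans aM; apply: le_esum => k _; have [h0 h1] := hh k.
by rewrite lee_fin ler_piMr// cabs_ge0.
Qed.

Lemma norm_l1_l1 a M : norm_le test_l1 a M -> l1 a.
Proof. by move=> /norm_l1P h; rewrite /l1 (le_lt_trans h)// ltry. Qed.

Lemma l1_norm a : l1 a -> exists2 M, (0 <= M)%R & norm_le test_l1 a M.
Proof.
move=> ha; have a0 : 0 <= \esum_ k (cabs (a k))%:E.
  by apply: esum_ge0 => k _; rewrite lee_fin cabs_ge0.
exists (fine (\esum_ k (cabs (a k))%:E)); first exact: fine_ge0.
by apply/norm_l1P; rewrite fineK// ge0_fin_numE.
Qed.

(** Duality is undone by testing against the sequence itself, cut off to a finite
    set and normalised. *)
Lemma norm_l2_sqr a M : (0 <= M)%R -> norm_le test_l2 a M ->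
  \esum_ k ((cabs (a k) ^+ 2)%:E) <= (M ^+ 2)%:E.
Proof.
move=> M0 hM; apply: esum_le_fin => s us; rewrite sumEFin lee_fin.
set S : R := (\sum_(k <- s) _)%R.
have S0 : (0 <= S)%R by apply: sumr_ge0 => k _; exact: sqr_ge0.
have [->|Sn0] := eqVneq S 0%R; first exact: sqr_ge0.
have Sp : (0 < S)%R by rewrite lt_neqAle eq_sym Sn0.
have qp : (0 < Num.sqrt S)%R by rewrite sqrtr_gt0.
have qS : (Num.sqrt S ^+ 2 = S)%R by rewrite sqr_sqrtr.
pose h k : R := if k \in s then (cabs (a k) / Num.sqrt S)%R else 0%R.
have h0 k : (0 <= h k)%R by rewrite /h; case: ifP => // _; rewrite divr_ge0 ?cabs_ge0 ?ltW.
have sum_s (f : int -> R) : (forall k, 0 <= f k)%R -> (forall k, k \notin s -> f k = 0%R) ->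
    \esum_ k ((f k)%:E) = (\sum_(k <- s) f k)%R%:E.
  move=> f0 fs; apply/eqP; rewrite eq_le -sumEFin le_sum_esum// andbT.
  apply: esum_le_fin => r ur; rewrite !sumEFin lee_fin.
  rewrite [leLHS](bigID (mem s))/= [X in (_ + X)%R]big1 ?addr0//.
  rewrite -big_filter [leRHS](bigID (mem r))/=.
  rewrite (perm_big [seq k <- s | k \in r]).
    by rewrite big_filter lerDl sumr_ge0.
  apply: uniq_perm; rewrite ?filter_uniq// => k.
  by rewrite !mem_filter andbC.
have hh : test_l2 h.
  split => //; rewrite (sum_s (fun k => h k ^+ 2)%R); last 2 first.
  - by move=> k; exact: sqr_ge0.
  - by move=> k /negbTE ks; rewrite /h ks expr0n.
  rewrite lee_fin (eq_big_seq (fun k => cabs (a k) ^+ 2 / S)%R).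
    by rewrite -mulr_suml -/S divff.
  by move=> k ks; rewrite /h ks expr_div_n qS.
have := hM _ hh; rewrite (sum_s (fun k => cabs (a k) * h k)%R); last 2 first.
- by move=> k; rewrite mulr_ge0 ?cabs_ge0.
- by move=> k /negbTE ks; rewrite /h ks mulr0.
rewrite (eq_big_seq (fun k => cabs (a k) ^+ 2 / Num.sqrt S)%R); last first.
  by move=> k ks; rewrite /h ks mulrA.
rewrite -mulr_suml -/S lee_fin -{1}qS expr2 mulfK ?gt_eqF// => h1.
by rewrite -qS ler_pXn2r ?nnegrE// ltW.
Qed.

Section TestClass.
Variables (H : set (int -> R)) (tH : test_class H).

Lemma norm_le_l1 a M : norm_le test_l1 a M -> norm_le H a M.
Proof.
move=> hM h Hh; apply: hM => k.
by split; [exact: test_ge0 Hh k|exact: test_le1 Hh k].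
Qed.

Lemma norm_le_dom a b M : (forall k, cabs (a k) <= cabs (b k))%R ->
  norm_le H b M -> norm_le H a M.
Proof.
move=> ab hb h Hh; apply: le_trans (hb h Hh); apply: le_esum => k _.
by rewrite lee_fin ler_wpM2r// (test_ge0 tH).
Qed.

Lemma norm_le_mono a M N : (M <= N)%R -> norm_le H a M -> norm_le H a N.
Proof. by move=> MN ha h Hh; apply: (le_trans (ha h Hh)); rewrite lee_fin. Qed.

Lemma norm_le0 : norm_le H (fun=> 0%R) 0.
Proof. by move=> h Hh; rewrite esum1// => k _; rewrite cabs0 mul0r. Qed.

Lemma norm_leD_dom a b c M N : (forall k, cabs (c k) <= cabs (a k) + cabs (b k))%R ->
  norm_le H a M -> norm_le H b N -> norm_le H c (M + N).
Proof.
move=> cab ha hb h Hh; rewrite EFinD; apply: le_trans (leeD (ha h Hh) (hb h Hh)).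
have h0 := test_ge0 tH Hh.
rewrite -esumD; last 2 first.
- by move=> k _; rewrite lee_fin mulr_ge0 ?cabs_ge0.
- by move=> k _; rewrite lee_fin mulr_ge0 ?cabs_ge0.
by apply: le_esum => k _; rewrite -EFinD lee_fin -mulrDl ler_wpM2r.
Qed.

Lemma norm_leB a b M N : norm_le H a M -> norm_le H b N ->
  norm_le H (fun k => a k - b k)%R (M + N).
Proof. by apply: norm_leD_dom => k; exact: cabsB. Qed.

Lemma norm_leZ a (z : C) M : norm_le H a M ->
  norm_le H (fun k => z * a k)%R (cabs z * M).
Proof.
move=> ha h Hh; have h0 := test_ge0 tH Hh.
under eq_esum do rewrite cabsM -mulrA EFinM.
rewrite esumZl ?lee_fin ?cabs_ge0//; last first.
  by move=> k; rewrite lee_fin mulr_ge0 ?cabs_ge0.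
by rewrite EFinM lee_wpmul2l ?lee_fin ?cabs_ge0//; exact: ha.
Qed.

Definition conj_refl a (k : int) : C := ((a (- k)%R)^*)%C.

Lemma norm_le_conj_refl a M : norm_le H a M -> norm_le H (conj_refl a) M.
Proof.
move=> ha h Hh; rewrite -esum_opp.
by under eq_esum do rewrite /conj_refl opprK cabsJ; exact: (ha _ (test_opp tH Hh)).
Qed.

(** Testing against h turns the sum over k and over j + l + m = k into a sum over
    all triples, in which the three factors play symmetric roles. *)
Lemma norm_le_trisum F M :
  (forall h, H h ->
    esum3 (fun j l m => (h (j + l + m)%R * cabs (F j l m))%:E) <= M%:E) ->
  norm_le H (trisum F) M.
Proof.
move=> hM h Hh; have h0 := test_ge0 tH Hh.
apply: le_trans (hM h Hh).
apply: (@le_trans _ _ (\esum_ k (\esum_ j (\esum_ l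
    ((h k * cabs (F j l (k - j - l)%R))%:E))))).
  apply: le_esum => k _; rewrite mulrC EFinM.
  apply: (le_trans (lee_wpmul2l _ (cabs_trisum F k))); first by rewrite lee_fin.
  rewrite -esumZl ?lee_fin//; last first.
    by move=> j; apply: esum_ge0 => l _; rewrite lee_fin cabs_ge0.
  apply: le_esum => j _; rewrite -esumZl ?lee_fin//.
  by move=> l; rewrite lee_fin cabs_ge0.
have pos k j l m : 0 <= (h k * cabs (F j l m))%:E by rewrite lee_fin mulr_ge0 ?cabs_ge0.
rewrite -/(esum3 (fun k j l => (h k * cabs (F j l (k - j - l)%R))%:E)) esum3_rot//.
apply: le_esum => j _; apply: le_esum => l _.
rewrite -(esum_shift _ (j + l)%R); apply: le_esum => m _.
rewrite [(m + _)%R]addrC.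
by have -> : (j + l + m - j - l = m)%R by rewrite -addrA -opprD addrC addKr.
Qed.

End TestClass.

(** Young's inequality: the test sequence is absorbed by the innermost factor,
    whose norm is that of the class; the others are summed. *)
Lemma young_inner (h A B D : int -> R) M N P :
  (forall k, 0 <= h k)%R ->
  (forall k, 0 <= A k)%R -> (forall k, 0 <= B k)%R -> (forall k, 0 <= D k)%R ->
  (0 <= M)%R -> (0 <= N)%R -> (0 <= P)%R ->
  \esum_ k ((A k)%:E) <= M%:E -> \esum_ k ((B k)%:E) <= N%:E ->
  (forall n, \esum_ k ((D k * h (k + n)%R)%:E) <= P%:E) ->
  esum3 (fun j l m => (h (j + l + m)%R * (A j * B l * D m))%:E) <= (M * N * P)%:E.
Proof.
move=> h0 A0 B0 D0 M0 N0 P0 hA hB hD.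
apply: (@le_trans _ _ (\esum_ j (\esum_ l ((A j)%:E * ((B l)%:E * P%:E))))).
  apply: le_esum => j _; apply: le_esum => l _.
  apply: (@le_trans _ _ (\esum_ m ((A j * B l)%:E * (D m * h (m + (j + l)))%R%:E))).
    apply: le_esum => m _; rewrite -EFinM lee_fin [(m + _)%R]addrC.
    by rewrite [leRHS]mulrA [leRHS]mulrC.
  rewrite esumZl ?lee_fin ?mulr_ge0//; last by move=> m; rewrite lee_fin mulr_ge0.
  by rewrite muleA -!EFinM [leRHS]EFinM lee_wpmul2l ?lee_fin ?mulr_ge0.
apply: (@le_trans _ _ (\esum_ j ((A j)%:E * (N * P)%:E))).
  apply: le_esum => j _; rewrite esumZl ?lee_fin//; last first.
    by move=> l; rewrite -EFinM lee_fin mulr_ge0.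
  rewrite lee_wpmul2l ?lee_fin// esumZr ?lee_fin// EFinM.
  by rewrite lee_wpmul2r ?lee_fin.
rewrite esumZr ?lee_fin ?mulr_ge0// -mulrA [leRHS]EFinM.
by rewrite lee_wpmul2r ?lee_fin ?mulr_ge0.
Qed.

End TrilinearSums.

Arguments test_l1 {R}.
Arguments test_l2 {R}.
Arguments test_class_l1 {R}.
Arguments test_class_l2 {R}.

(** * The cubic nonlinearity *)

Section CubicForm.
Variable R : realType.
Local Notation C := R[i].
Implicit Types (a b c : int -> C) (F G : int -> int -> int -> C) (M N P : R).

Definition esum_prod (h A B D : int -> R) : \bar R :=
  esum3 (fun j l m => (h (j + l + m) * (A j * B l * D m))%:E).

Definition absq a (k : int) : R := cabs (a k).

Lemma absq_ge0 a k : 0 <= absq a k. Proof. exact: cabs_ge0. Qed.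

Section Young.
Variables (H : set (int -> R)) (tH : test_class H) (h : int -> R) (Hh : H h).
Variables (a b c : int -> C) (M N P : R).
Hypotheses (M0 : 0 <= M) (N0 : 0 <= N) (P0 : 0 <= P).

Let h0 := test_ge0 tH Hh.

Let prod_ge0 j l m : (0 <= (h (j + l + m) * (absq a j * absq b l * absq c m))%:E)%E.
Proof. by rewrite lee_fin !mulr_ge0 ?absq_ge0. Qed.

Lemma young3 : norm_le test_l1 a M -> norm_le test_l1 b N -> norm_le H c P ->
  (esum_prod h (absq a) (absq b) (absq c) <= (M * N * P)%:E)%E.
Proof.
move=> /norm_l1P ha /norm_l1P hb hc.
apply: young_inner => //; try exact: absq_ge0.
by move=> n; exact: (hc _ (test_shift tH n Hh)).
Qed.

Lemma young2 : norm_le test_l1 a M -> norm_le H b N -> norm_le test_l1 c P ->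
  (esum_prod h (absq a) (absq b) (absq c) <= (M * N * P)%:E)%E.
Proof.
move=> /norm_l1P ha hb /norm_l1P hc; rewrite /esum_prod esum3_rot// esum3_rot//.
have -> : M * N * P = P * M * N by ring.
rewrite (@eq_esum3 _ _ (fun m j l => (h (m + j + l) * (absq c m * absq a j * absq b l))%:E)).
  apply: young_inner => //; try exact: absq_ge0.
  by move=> n; exact: (hb _ (test_shift tH n Hh)).
move=> m j l; congr ((h _ * _)%:E); first by ring.
by ring.
Qed.

Lemma young1 : norm_le H a M -> norm_le test_l1 b N -> norm_le test_l1 c P ->
  (esum_prod h (absq a) (absq b) (absq c) <= (M * N * P)%:E)%E.
Proof.
move=> ha /norm_l1P hb /norm_l1P hc; rewrite /esum_prod esum3_rot//.
have -> : M * N * P = N * P * M by ring.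
rewrite (@eq_esum3 _ _ (fun l m j => (h (l + m + j) * (absq b l * absq c m * absq a j))%:E)).
  apply: young_inner => //; try exact: absq_ge0.
  by move=> n; exact: (ha _ (test_shift tH n Hh)).
move=> l m j; congr ((h _ * _)%:E); last by ring.
by ring.
Qed.

End Young.

Lemma t1_prod F a b c :
  (forall j l m, cabs (F j l m) <= absq a j * absq b l * absq c m) ->
  l1 a -> l1 b -> l1 c -> t1 F.
Proof.
move=> hF /l1_norm[M M0 ha] /l1_norm[N N0 hb] /l1_norm[P P0 hc].
apply: (@le_lt_trans _ _ (esum_prod (fun=> 1) (absq a) (absq b) (absq c))).
  by apply: le_esum3 => j l m; rewrite lee_fin mul1r.
apply: le_lt_trans (young3 test_class_l1 _ M0 N0 P0 ha hb hc) (ltry _).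
by move=> k; rewrite ler01 lexx.
Qed.

(** The Fourier coefficients of u^2 (p(D) conj u), where u has coefficients a. *)
Definition cub (p a : int -> C) : int -> C :=
  trisum (fun j l m => a j * (a l * (p m * conj_refl a m))).

Lemma l1_conj_refl a : l1 a -> l1 (conj_refl a).
Proof.
by move=> /l1_norm[M M0 ha]; exact: norm_l1_l1 (norm_le_conj_refl test_class_l1 ha).
Qed.

Lemma cub_t1 p a : (forall k, cabs (p k) <= 1) -> l1 a ->
  t1 (fun j l m => a j * (a l * (p m * conj_refl a m))).
Proof.
move=> p1 ha; apply: (t1_prod (a := a) (b := a) (c := conj_refl a)) => //.
  move=> j l m; rewrite !cabsM -mulrA ler_wpM2l ?cabs_ge0//.
  by rewrite ler_wpM2l ?cabs_ge0// ler_piMl ?p1 ?cabs_ge0.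
exact: l1_conj_refl.
Qed.

Section CubicClass.
Variables (H : set (int -> R)) (tH : test_class H).

(** The increment of a product is the sum of three products, each with one
    factor replaced by an increment. *)
Lemma cub_lip p a b M d : (forall k, cabs (p k) <= 1) -> 0 <= M -> 0 <= d ->
  norm_le test_l1 a M -> norm_le test_l1 b M ->
  norm_le H (fun k => a k - b k) d ->
  norm_le H (fun k => cub p a k - cub p b k) (3 * M ^+ 2 * d).
Proof.
move=> p1 M0 d0 ha hb hab.
have la := norm_l1_l1 ha; have lb := norm_l1_l1 hb.
have ta := cub_t1 p1 la; have tb := cub_t1 p1 lb.
have -> : (fun k => cub p a k - cub p b k) =
  trisum (fun j l m => a j * (a l * (p m * conj_refl a m)) -
                       b j * (b l * (p m * conj_refl b m))).
  by apply/funext => k; rewrite trisumB.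
apply: (norm_le_trisum tH) => h Hh; have h0 := test_ge0 tH Hh.
set ab := fun k => a k - b k in hab *.
have -> : 3 * M ^+ 2 * d = d * M * M + (M * d * M + M * M * d) by ring.
have habJ := norm_le_conj_refl tH hab.
have haJ := norm_le_conj_refl test_class_l1 ha.
have hsum := leeD (young1 tH Hh d0 M0 M0 hab ha haJ)
  (leeD (young2 tH Hh M0 d0 M0 hb hab haJ) (young3 tH Hh M0 M0 d0 hb hb habJ)).
rewrite 2!EFinD; apply: le_trans hsum.
have pos (x y z : int -> C) j l m :
    (0 <= (h (j + l + m) * (absq x j * absq y l * absq z m))%:E)%E.
  by rewrite lee_fin !mulr_ge0 ?absq_ge0.
rewrite /esum_prod -esum3D; [|by move=> *; apply: pos..].
rewrite -esum3D; [|by move=> *; apply: pos|by move=> *; rewrite adde_ge0//; apply: pos].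
apply: le_esum3 => j l m; rewrite -!EFinD lee_fin -!mulrDr ler_wpM2l//.
have -> : a j * (a l * (p m * conj_refl a m)) - b j * (b l * (p m * conj_refl b m)) =
  p m * (ab j * (a l * conj_refl a m)) + (p m * (b j * (ab l * conj_refl a m)) +
  p m * (b j * (b l * conj_refl ab m))).
  rewrite /ab /conj_refl rmorphB; ring.
rewrite (le_trans (cabsD _ _))// lerD//.
  rewrite !cabsM -/(absq ab j) -/(absq a l) -/(absq _ m) -[leRHS]mulrA.
  by rewrite ler_piMl ?p1 ?mulr_ge0 ?absq_ge0.
rewrite (le_trans (cabsD _ _))// lerD//.
  rewrite !cabsM -/(absq b j) -/(absq ab l) -/(absq _ m) -[leRHS]mulrA.
  by rewrite ler_piMl ?p1 ?mulr_ge0 ?absq_ge0.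
rewrite !cabsM -/(absq b j) -/(absq b l) -/(absq _ m) -[leRHS]mulrA.
by rewrite ler_piMl ?p1 ?mulr_ge0 ?absq_ge0.
Qed.

End CubicClass.

Lemma cub_bound p a M : (forall k, cabs (p k) <= 1) -> 0 <= M ->
  norm_le test_l1 a M -> norm_le test_l1 (cub p a) (M ^+ 3).
Proof.
move=> p1 M0 ha; apply: (norm_le_trisum test_class_l1) => h Hh.
have h0 := test_ge0 test_class_l1 Hh.
have -> : M ^+ 3 = M * M * M by ring.
apply: le_trans (young3 test_class_l1 Hh M0 M0 M0 ha ha
  (norm_le_conj_refl test_class_l1 ha)).
apply: le_esum3 => j l m; rewrite lee_fin ler_wpM2l// !cabsM mulrA.
rewrite -/(absq a j) -/(absq a l) ler_wpM2l ?mulr_ge0 ?absq_ge0//.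
by rewrite ler_piMl ?p1 ?cabs_ge0.
Qed.

End CubicForm.

(** * The weight of H^(3/4) *)

Section SobolevWeight.
Variable R : realType.
Implicit Types (a : int -> R[i]) (k : int).

Definition bracket k : R := 1 + k%:~R ^+ 2.

(** (1 + k^2)^(1/4): the weight of H^(3/4) is its cube, and k^2 is at most its
    fourth power. *)
Definition root_bracket k : R := bracket k `^ (4%:R^-1).

Lemma bracket_ge1 k : 1 <= bracket k.
Proof. by rewrite lerDl sqr_ge0. Qed.

Lemma bracket_ge0 k : 0 <= bracket k.
Proof. exact: le_trans ler01 (bracket_ge1 k). Qed.

Lemma root_bracket_ge1 k : 1 <= root_bracket k.
Proof.
have -> : 1 = 1 `^ 4%:R^-1 :> R by rewrite powR1.
apply: ge0_ler_powR.
- by rewrite invr_ge0.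
- by rewrite nnegrE.
- by rewrite nnegrE bracket_ge0.
- exact: bracket_ge1.
Qed.

Lemma root_bracket_gt0 k : 0 < root_bracket k.
Proof. exact: lt_le_trans ltr01 (root_bracket_ge1 k). Qed.

Lemma root_bracket_ge0 k : 0 <= root_bracket k.
Proof. exact: ltW (root_bracket_gt0 k). Qed.

Lemma root_bracket4 k : root_bracket k ^+ 4 = bracket k.
Proof.
by rewrite -powR_mulrn ?root_bracket_ge0// -powRrM mulVf// powRr1// bracket_ge0.
Qed.

Lemma root_bracket3 k : root_bracket k ^+ 3 = bracket k `^ (3%:R / 4%:R).
Proof.
by rewrite -powR_mulrn ?root_bracket_ge0// -powRrM mulrC.
Qed.

Lemma root_bracket_mono j k : `|j%:~R : R| <= `|k%:~R| -> root_bracket j <= root_bracket k.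
Proof.
move=> jk; apply: ge0_ler_powR; rewrite ?nnegrE ?bracket_ge0 ?invr_ge0//.
by rewrite lerD2l -sqr_normr -[leRHS]sqr_normr ler_pXn2r ?nnegrE.
Qed.

Lemma abs_le_root_bracket2 k : `|k%:~R : R| <= root_bracket k ^+ 2.
Proof.
rewrite -(@ler_pXn2r _ 2) ?nnegrE ?exprn_ge0 ?root_bracket_ge0//.
by rewrite -exprM root_bracket4 sqr_normr lerDr.
Qed.

Definition inv_weight k : R := (root_bracket k ^+ 3)^-1.

Lemma inv_weight_ge0 k : 0 <= inv_weight k.
Proof. by rewrite invr_ge0 exprn_ge0 ?root_bracket_ge0. Qed.

(* The comparison is with the telescoping series of 2/sqrt n. *)
Lemma inv_weight_telescope (n : nat) k : `|k%:~R : R| = n.+2%:R ->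
  inv_weight k <= 2 / Num.sqrt n.+1%:R - 2 / Num.sqrt n.+2%:R.
Proof.
move=> kn; set x := Num.sqrt _; set y := Num.sqrt _.
have x0 : 0 < x by rewrite sqrtr_gt0 ltr0n.
have y0 : 0 < y by rewrite sqrtr_gt0 ltr0n.
have x2 : x ^+ 2 = n.+1%:R by rewrite sqr_sqrtr.
have y2 : y ^+ 2 = n.+2%:R by rewrite sqr_sqrtr.
have yx : y ^+ 2 = x ^+ 2 + 1 by rewrite x2 y2 -natr1.
have yq : y <= root_bracket k.
  rewrite -(@ler_pXn2r _ 2) ?nnegrE ?root_bracket_ge0 ?(ltW y0)//.
  by rewrite y2 -kn abs_le_root_bracket2.
have xy : x <= y.
  by rewrite -(@ler_pXn2r _ 2) ?nnegrE ?(ltW x0) ?(ltW y0)// yx lerDl.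
apply: (@le_trans _ _ (y ^+ 3)^-1).
  rewrite lef_pV2 ?posrE ?exprn_gt0 ?root_bracket_gt0//.
  by rewrite ler_pXn2r ?nnegrE ?root_bracket_ge0 ?(ltW y0).
have -> : 2 / x - 2 / y = 2 / (x * y * (x + y)).
  apply/eqP; rewrite -subr_eq0; apply/eqP.
  have xyn : x + y != 0 by rewrite gt_eqF// addr_gt0.
  transitivity (2 * ((y ^+ 2 - x ^+ 2) - 1) / (x * y * (x + y))).
    by field; rewrite xyn !gt_eqF.
  rewrite yx [x ^+ 2 + 1]addrC addrK.
  by rewrite subrr mulr0 mul0r.
rewrite ler_pdivlMr ?mulr_gt0 ?addr_gt0//.
rewrite -ler_pdivlMl ?invr_gt0 ?exprn_gt0// invrK.
have -> : y ^+ 3 * 2 = y * y * (y + y) by ring.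
have [x0' y0'] := (ltW x0, ltW y0).
by apply: ler_pM; rewrite ?mulr_ge0 ?addr_ge0 ?lerD2r// ler_wpM2r.
Qed.

Lemma inv_weight_le1 k : inv_weight k <= 1.
Proof. by rewrite invf_le1 ?exprn_gt0 ?root_bracket_gt0// exprn_ege1// root_bracket_ge1. Qed.

(** Meant for the two halves of a window, on which |e n| is n or n + 1. *)
Lemma inv_weight_half (e : nat -> int) (d : nat) :
  (forall n, `|(e n)%:~R : R| = (n + d)%:R) -> forall N, \sum_(n < N) inv_weight (e n) <= 4.
Proof.
move=> he.
have step N : (1 < N)%N -> \sum_(n < N) inv_weight (e n) <= 4 - 2 / Num.sqrt (N.-1)%:R.
  elim: N => // N IH; rewrite ltnS leq_eqVlt => /predU1P[<-|N1].
    rewrite big_ord_recr big_ord1/= sqrtr1 divr1.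
    by have := inv_weight_le1 (e 0%N); have := inv_weight_le1 (e 1%N); lra.
  rewrite big_ord_recr/= (le_trans (lerD (IH N1) (lexx _)))//.
  case: N N1 {IH} => [//|[//|N]] _ /=.
  have : inv_weight (e N.+2) <= 2 / Num.sqrt N.+1%:R - 2 / Num.sqrt N.+2%:R.
    have mono : inv_weight (e N.+2) <= inv_weight (Posz N.+2).
      rewrite lef_pV2 ?posrE ?exprn_gt0 ?root_bracket_gt0//.
      rewrite ler_pXn2r ?nnegrE ?root_bracket_ge0//; apply: root_bracket_mono.
      by rewrite he ger0_norm// ler_nat leq_addr.
    by apply: le_trans mono (inv_weight_telescope _); rewrite ger0_norm.
  lra.
case=> [|[|N]]; first by rewrite big_ord0.
  by rewrite big_ord1 (le_trans (inv_weight_le1 _))// ler1n.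
apply: le_trans (step _ _) _ => //.
by rewrite lerBlDr lerDl divr_ge0 ?sqrtr_ge0.
Qed.

Lemma inv_weight_summable : (\esum_ k ((inv_weight k)%:E) <= 8%:E)%E.
Proof.
apply: esum_le_fin => s us; rewrite sumEFin lee_fin.
have [N hN] := sub_window s.
apply: (@le_trans _ _ (\sum_(k <- window N) inv_weight k)).
  rewrite [leRHS](bigID (mem s))/=.
  have -> : \sum_(k <- s) inv_weight k = \sum_(k <- window N | k \in s) inv_weight k.
    rewrite -[RHS]big_filter; apply: perm_big.
    apply: uniq_perm; rewrite ?filter_uniq ?window_uniq// => k.
    by rewrite mem_filter; case: (boolP (k \in s)) => //= /hN.
  by rewrite lerDl sumr_ge0// => k _; exact: inv_weight_ge0.
rewrite /window big_cat !big_map/=.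
have -> : 8 = 4 + 4 :> R by ring.
apply: lerD; rewrite -{1}(subn0 N) -/(index_iota 0 N) big_mkord.
  by apply: (@inv_weight_half Posz 0%N) => n; rewrite addn0 ger0_norm.
apply: (@inv_weight_half Negz 1%N) => n.
by rewrite NegzE rmorphN normrN ger0_norm// addn1.
Qed.

Definition Hbound a (K : R) :=
  (\esum_ k ((root_bracket k ^+ 3 * cabs (a k) ^+ 2)%:E) <= (K ^+ 2)%:E)%E.

Lemma inv_weight_sqrt k : Num.sqrt (inv_weight k) * Num.sqrt (root_bracket k ^+ 3) = 1.
Proof.
by rewrite -sqrtrM ?inv_weight_ge0// mulVf ?sqrtr1// gt_eqF// exprn_gt0// root_bracket_gt0.
Qed.

(** Cauchy-Schwarz against the weight.  All frequencies together give the embedding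
    into l^1; for high frequencies e is small. *)
Lemma Hbound_l1 a K (E : pred int) e : 0 <= K -> 0 <= e -> Hbound a K ->
  (\esum_ k ((if E k then inv_weight k else 0)%:E) <= (e ^+ 2)%:E)%E ->
  (\esum_ k ((if E k then cabs (a k) else 0)%:E) <= (e * K)%:E)%E.
Proof.
move=> K0 e0 ha he.
pose f k : R := if E k then Num.sqrt (inv_weight k) else 0.
pose g k : R := Num.sqrt (root_bracket k ^+ 3) * cabs (a k).
have f0 k : 0 <= f k by rewrite /f; case: ifP; rewrite ?sqrtr_ge0.
have g0 k : 0 <= g k by rewrite mulr_ge0 ?sqrtr_ge0 ?cabs_ge0.
rewrite (@eq_esum _ _ _ _ (fun k => (f k * g k)%:E)); last first.
  move=> k _; congr (_%:E); rewrite /f /g; case: ifP => _; last by rewrite mul0r.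
  by rewrite mulrA inv_weight_sqrt mul1r.
apply: esum_CauchySchwarz => //.
  apply: le_trans he; apply: le_esum => k _; rewrite lee_fin /f.
  by case: ifP => _; rewrite ?sqr_sqrtr ?inv_weight_ge0 ?expr0n.
apply: le_trans ha; apply: le_esum => k _; rewrite lee_fin /g exprMn.
by rewrite sqr_sqrtr ?exprn_ge0 ?root_bracket_ge0.
Qed.

Lemma Hbound_norm_l1 a K : 0 <= K -> Hbound a K -> norm_le test_l1 a (3 * K).
Proof.
move=> K0 ha; apply/norm_l1P.
apply: le_trans (Hbound_l1 (E := xpredT) K0 _ ha _) => //.
apply: (le_trans inv_weight_summable); rewrite lee_fin; lra.
Qed.

End SobolevWeight.

(** * The bilinear estimate *)

Section BilinearEstimate.
Variable R : realType.
Implicit Types (a b c : int -> R[i]) (k : int).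

Definition freq k : R := `|k|%:~R.

Lemma freqE k : freq k = `|k%:~R|. Proof. by rewrite /freq intr_norm. Qed.
Lemma freq_ge0 k : 0 <= freq k. Proof. by rewrite freqE. Qed.
Lemma freqN k : freq (- k) = freq k. Proof. by rewrite /freq normrN. Qed.
Lemma freqD j l : freq (j + l) <= freq j + freq l.
Proof. by rewrite !freqE rmorphD ler_normD. Qed.

Lemma root_bracketN k : root_bracket R (- k) = root_bracket R k.
Proof. by rewrite /root_bracket /bracket rmorphN sqrrN. Qed.

(** There are 2|j| + 1 such frequencies; the constant 4 leaves room for the
    half-open window that contains them. *)
Lemma esum_low_freq (j : int) (x : R) : 0 <= x ->
  (\esum_ l ((if (freq l <= freq j)%R then x else 0)%:E)
     <= (4 * root_bracket R j ^+ 2 * x)%:E)%E.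
Proof.
move=> x0; apply: esum_le_fin => s us; rewrite sumEFin lee_fin.
rewrite -big_mkcond/= -big_filter big_const_seq count_predT iter_addr_0 -[leLHS]mulr_natl.
rewrite ler_wpM2r//.
apply: (@le_trans _ _ ((size (window (absz j).+1))%:R)).
  rewrite ler_nat uniq_leq_size ?filter_uniq// => l; rewrite mem_filter => /andP[+ _].
  rewrite /freq ler_int -!abszE lez_nat => lj; rewrite mem_window.
  by case: l lj => n /=; rewrite ?ltnS// => /ltnW.
rewrite size_cat !size_map size_iota natrD.
have j1 : (absz j)%:R <= root_bracket R j ^+ 2.
  apply: le_trans (abs_le_root_bracket2 R j).
  by rewrite -intr_norm -abszE.
have q1 : 1 <= root_bracket R j ^+ 2 by rewrite exprn_ege1// root_bracket_ge1.
by rewrite -natr1; lra.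
Qed.

Section HalfSpace.
Variables (h : int -> R) (a b : int -> R[i]) (K : R).
Hypotheses (h0 : forall k, 0 <= h k) (h2 : (\esum_ k ((h k ^+ 2)%:E) <= 1)%E).
Hypotheses (K0 : 0 <= K) (ha : Hbound a K) (hb : Hbound b K).

Let w k : R := root_bracket R k ^+ 3.
Let w0 k : 0 <= w k. Proof. by rewrite exprn_ge0 ?root_bracket_ge0. Qed.
Let low (j l : int) : R := if freq l <= freq j then freq l else 0.
Let low0 j l : 0 <= low j l. Proof. by rewrite /low; case: ifP => // _; exact: freq_ge0. Qed.

(* Since |l| <= |j|, the weight that l lacks is taken from j; what remains is the
   inverse of the number of such l, up to a constant. *)
Let low_weight j l : low j l ^+ 2 * (inv_weight R j * inv_weight R l) <=
  if freq l <= freq j then (root_bracket R j ^+ 2)^-1 else 0.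
Proof.
rewrite /low; case: ifP => lj; last by rewrite expr0n mul0r.
have qj := root_bracket_gt0 R j; have ql := root_bracket_gt0 R l.
have ljq : root_bracket R l <= root_bracket R j.
  by apply: root_bracket_mono; rewrite -!freqE.
have hl : freq l ^+ 2 <= root_bracket R l ^+ 4.
  by rewrite root_bracket4 /bracket freqE sqr_normr lerDr.
apply: (@le_trans _ _ (root_bracket R l ^+ 4 * (inv_weight R j * inv_weight R l))).
  by rewrite ler_wpM2r// mulr_ge0 ?inv_weight_ge0.
have -> : root_bracket R l ^+ 4 * (inv_weight R j * inv_weight R l) =
   root_bracket R l / root_bracket R j * (root_bracket R j ^+ 2)^-1.
  by rewrite /inv_weight; field; rewrite !gt_eqF.
by rewrite ler_piMl ?invr_ge0 ?exprn_ge0 ?root_bracket_ge0// ler_pdivrMr// mul1r.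
Qed.

(* Cauchy-Schwarz with all of the weight on the larger frequency j: for fixed j
   the sum over |l| <= |j| is bounded, and h carries the remaining sum over j. *)
Lemma bilinear_low (n : int) :
  (\esum_ j (\esum_ l ((low j l * (absq a j * absq b l) * h (j + l + n))%:E))
     <= (2 * K ^+ 2)%:E)%E.
Proof.
have A0 := absq_ge0 a; have B0 := absq_ge0 b.
rewrite esum_pair; last by move=> j l; rewrite lee_fin !mulr_ge0.
pose f (p : int * int) : R := Num.sqrt (w p.1) * absq a p.1 *
  (low p.1 p.2 * (Num.sqrt (inv_weight R p.1) * Num.sqrt (inv_weight R p.2))).
pose g (p : int * int) : R := Num.sqrt (w p.2) * absq b p.2 * h (p.1 + p.2 + n).
have f0 p : 0 <= f p by rewrite !mulr_ge0 ?sqrtr_ge0.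
have g0 p : 0 <= g p by rewrite !mulr_ge0 ?sqrtr_ge0.
rewrite (@eq_esum _ _ _ _ (fun p => (f p * g p)%:E)); last first.
  move=> [j l] _ /=; congr (_%:E); rewrite /f /g/=.
  have := inv_weight_sqrt R j; have := inv_weight_sqrt R l.
  rewrite -/(w j) -/(w l).
  set x := Num.sqrt _; set x' := Num.sqrt _; set y := Num.sqrt _; set y' := Num.sqrt _.
  move=> e1 e2.
  transitivity ((x * x') * (y * y') * (low j l * (absq a j * absq b l) * h (j + l + n))).
    by rewrite e1 e2 !mul1r.
  by ring.
have -> : 2 * K ^+ 2 = 2 * K * K by ring.
apply: esum_CauchySchwarz; rewrite ?mulr_ge0//.
  rewrite -(esum_pair (a := fun j l => (f (j, l) ^+ 2)%:E)); last first.
    by move=> j l; rewrite lee_fin sqr_ge0.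
  apply: (@le_trans _ _ (\esum_ j ((w j * absq a j ^+ 2)%:E * 4%:E))%E).
    apply: le_esum => j _.
    have wa0 : 0 <= w j * absq a j ^+ 2 by rewrite mulr_ge0 ?w0 ?sqr_ge0.
    apply: (@le_trans _ _ (\esum_ l ((w j * absq a j ^+ 2)%:E *
      (if (freq l <= freq j)%R then (root_bracket R j ^+ 2)^-1 else 0)%:E))%E).
      apply: le_esum => l _; rewrite -EFinM lee_fin /f/= !exprMn.
      rewrite !sqr_sqrtr ?inv_weight_ge0 ?w0//.
      by rewrite ler_wpM2l// low_weight.
    rewrite esumZl ?lee_fin//; last first.
      by move=> l; case: ifP => // _; rewrite lee_fin invr_ge0 exprn_ge0 ?root_bracket_ge0.
    rewrite lee_wpmul2l ?lee_fin//.
    apply: le_trans (esum_low_freq _ _) _.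
      by rewrite invr_ge0 exprn_ge0 ?root_bracket_ge0.
    by rewrite lee_fin mulfK// expf_neq0// gt_eqF// root_bracket_gt0.
  rewrite esumZr ?lee_fin//; last by move=> j; rewrite lee_fin mulr_ge0 ?w0 ?sqr_ge0.
  have -> : (2 * K) ^+ 2 = K ^+ 2 * 4 by ring.
  by rewrite [leRHS]EFinM lee_wpmul2r ?lee_fin.
rewrite -(esum_pair (a := fun j l => (g (j, l) ^+ 2)%:E)); last first.
  by move=> j l; rewrite lee_fin sqr_ge0.
rewrite esum_swap; last by move=> j l; rewrite lee_fin sqr_ge0.
apply: le_trans hb; apply: le_esum => l _.
have wb0 : 0 <= w l * absq b l ^+ 2 by rewrite mulr_ge0 ?w0 ?sqr_ge0.
apply: (@le_trans _ _ (\esum_ j ((w l * absq b l ^+ 2)%:E * (h (j + (l + n)) ^+ 2)%:E))%E).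
  apply: le_esum => j _; rewrite -EFinM lee_fin /g/= !exprMn sqr_sqrtr ?w0//.
  by rewrite addrA.
rewrite esumZl ?lee_fin//; last by move=> j; rewrite lee_fin sqr_ge0.
rewrite (esum_shift (fun k => (h k ^+ 2)%:E)) -[leRHS]mule1.
by rewrite lee_wpmul2l ?lee_fin.
Qed.

End HalfSpace.

Lemma Hbound_conj_refl a K : Hbound a K -> Hbound (conj_refl a) K.
Proof.
rewrite /Hbound => ha; rewrite -esum_opp; apply: le_trans ha.
by apply: le_esum => k _; rewrite /conj_refl opprK cabsJ root_bracketN.
Qed.

(** Half a derivative on each of two factors of H^(3/4) leaves their product in
    L^2.  This is the Fourier side of the embedding of H^(1/4) into L^4, proved by
    splitting the sum at |j| = |l|. *)
Lemma bilinear_min (h : int -> R) a b K n : (forall k, 0 <= h k) ->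
  (\esum_ k ((h k ^+ 2)%:E) <= 1)%E -> 0 <= K -> Hbound a K -> Hbound b K ->
  (\esum_ j (\esum_ l ((Num.min (freq j) (freq l) * (absq a j * absq b l) *
     h (j + l + n))%:E)) <= (4 * K ^+ 2)%:E)%E.
Proof.
move=> h0 h2 K0 ha hb.
have -> : 4 * K ^+ 2 = 2 * K ^+ 2 + 2 * K ^+ 2 by ring.
rewrite EFinD; apply: (le_trans _ (leeD (bilinear_low h0 h2 K0 ha hb n)
                                        (bilinear_low h0 h2 K0 hb ha n))).
have A0 := absq_ge0 a; have B0 := absq_ge0 b.
have low0 j l : 0 <= (if freq l <= freq j then freq l else 0).
  by case: ifP => // _; exact: freq_ge0.
rewrite [X in (_ + X)%E]esum_swap; last by move=> j l; rewrite lee_fin !mulr_ge0.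
rewrite -esumD; last 2 first.
- by move=> j _; apply: esum_ge0 => l _; rewrite lee_fin !mulr_ge0.
- by move=> j _; apply: esum_ge0 => l _; rewrite lee_fin !mulr_ge0.
apply: le_esum => j _; rewrite -esumD; last 2 first.
- by move=> l _; rewrite lee_fin !mulr_ge0.
- by move=> l _; rewrite lee_fin !mulr_ge0.
apply: le_esum => l _; rewrite -EFinD lee_fin.
rewrite (addrC l j) (mulrC (absq b l)) -!mulrDl.
rewrite ler_wpM2r// ler_wpM2r ?mulr_ge0//.
case: (leP (freq j) (freq l)) => jl; last by rewrite (ltW jl) addr0.
by rewrite lerDr.
Qed.

End BilinearEstimate.

(** * Freezing the phases *)

Section PhaseDefect.
Variable R : realType.
Local Notation C := R[i].
Implicit Types (a b c : int -> C) (k : int).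

Definition phase (t : R) k : C := cis (t * freq R k).

Definition twist t a k : C := phase t k * a k.

Lemma cabs_phase t k : cabs (phase t k) = 1.
Proof. exact: cabs_cis. Qed.

Lemma phaseD s t k : phase (s + t) k = phase s k * phase t k.
Proof. by rewrite /phase mulrDl cisD. Qed.

Lemma phase0 k : phase 0 k = 1. Proof. by rewrite /phase mul0r cis0. Qed.

Lemma conj_refl_twist s a k :
  conj_refl (twist s a) k = phase (- s) k * conj_refl a k.
Proof.
rewrite /conj_refl /twist /phase freqN mulNr cisN.
by apply: complex_eqP; rewrite ?(ReM, ImM, ReJ, ImJ); ring.
Qed.

Lemma norm_le_twist H (tH : test_class H) t a (M : R) :
  norm_le H a M -> norm_le H (twist t a) M.
Proof.
by apply: norm_le_dom => // k; rewrite /twist cabsM cabs_phase mul1r.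
Qed.

Lemma l1_twist t a : l1 a -> l1 (twist t a).
Proof. by apply: l1_le => k; rewrite /twist cabsM cabs_phase mul1r. Qed.

Definition cst1 (k : int) : C := 1.

Lemma cabs_cst1 k : cabs (cst1 k) <= 1. Proof. by rewrite cabs1. Qed.

Lemma cabs_phase_le1 t k : cabs (phase t k) <= 1. Proof. by rewrite cabs_phase. Qed.

(** The error made in freezing the nonlinearity along the free flow: only the
    phase exp (-2 i s |m|) of the conjugate factor is kept. *)
Definition phase_defect s a k : C :=
  twist (- s) (cub cst1 (twist s a)) k - cub (phase (- (2 * s))) a k.

Definition phase_gap s (j l m : int) : C :=
  phase (- s) (j + l + m) * (phase s j * (phase s l * phase (- s) m)) -
  phase (- (2 * s)) m.

Lemma phase_defectE s a : l1 a ->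
  phase_defect s a = trisum (fun j l m =>
    phase_gap s j l m * (a j * (a l * conj_refl a m))).
Proof.
move=> ha; apply/funext => k; rewrite /phase_defect {1}/twist /cub.
have t1s := cub_t1 cabs_cst1 (l1_twist s ha).
have t2s := cub_t1 (cabs_phase_le1 (- (2 * s))) ha.
rewrite -(trisumZ k (phase (- s)) t1s).
rewrite -(trisumB (F := fun j l m => phase (- s) (j + l + m) * _)); last 2 first.
- apply: le_lt_trans t1s; apply: le_esum3 => j l m.
  by rewrite lee_fin cabsM cabs_phase mul1r.
- exact: t2s.
congr (trisum _ k); apply/funext => j; apply/funext => l; apply/funext => m.
by rewrite /phase_gap conj_refl_twist /twist /cst1; ring.
Qed.

Definition resonance (j l m : int) : R :=
  freq R j + freq R l + freq R m - freq R (j + l + m).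

Lemma resonance_ge0 j l m : 0 <= resonance j l m.
Proof.
rewrite subr_ge0 (le_trans (freqD _ _ _))// lerD2r; exact: freqD.
Qed.

Lemma cabs_phase_gap s j l m : 0 <= s ->
  cabs (phase_gap s j l m) <= s * resonance j l m.
Proof.
move=> s0; rewrite /phase_gap /phase -!cisD (le_trans (cabs_cisB _ _))//.
set x := (X in `|X|).
have -> : x = s * resonance j l m by rewrite /x /resonance; ring.
by rewrite ger0_norm// mulr_ge0// resonance_ge0.
Qed.

Lemma cabs_phase_gap2 s j l m : cabs (phase_gap s j l m) <= 2.
Proof.
rewrite (le_trans (cabsB _ _))// !cabsM !cabs_phase !mul1r.
by rewrite -[2]/(1 + 1).
Qed.

(** Since |j + l + m| is at least the largest frequency minus the two others, the
    resonance function is at most twice the sum of the two smaller frequencies: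
    it costs one derivative, but never on the largest frequency alone. *)
Lemma resonance_le j l m : resonance j l m <=
  2 * (Num.min (freq R j) (freq R l) + Num.min (freq R l) (freq R m) +
       Num.min (freq R j) (freq R m)).
Proof.
rewrite /resonance.
have hj : freq R j <= freq R (j + l + m) + freq R l + freq R m.
  have {1}-> : j = (j + l + m) + - l + - m by ring.
  apply: (le_trans (freqD _ _ _)); rewrite freqN lerD2r.
  by apply: (le_trans (freqD _ _ _)); rewrite freqN.
have hl : freq R l <= freq R (j + l + m) + freq R j + freq R m.
  have {1}-> : l = (j + l + m) + - j + - m by ring.
  apply: (le_trans (freqD _ _ _)); rewrite freqN lerD2r.
  by apply: (le_trans (freqD _ _ _)); rewrite freqN.
have hm : freq R m <= freq R (j + l + m) + freq R j + freq R l.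
  have {1}-> : m = (j + l + m) + - j + - l by ring.
  apply: (le_trans (freqD _ _ _)); rewrite freqN lerD2r.
  by apply: (le_trans (freqD _ _ _)); rewrite freqN.
have := freq_ge0 R j; have := freq_ge0 R l; have := freq_ge0 R m.
move: (freq R j) (freq R l) (freq R m) (freq R (j + l + m)) hj hl hm => x y z k.
by case: (leP x y); case: (leP y z); case: (leP x z); lra.
Qed.

(** The third factor is summed in l^1 outside the bilinear estimate, for a test
    sequence shifted by its frequency. *)
Lemma esum3_min_outer (h : int -> R) a b c (K M : R) :
  (forall k, 0 <= h k) -> (\esum_ k ((h k ^+ 2)%:E) <= 1)%E -> 0 <= K -> 0 <= M ->
  Hbound a K -> Hbound b K -> norm_le test_l1 c M ->
  (esum3 (fun x y z => (h (y + z + x) * (Num.min (freq R y) (freq R z) *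
     (absq a y * absq b z) * absq c x))%:E) <= (4 * K ^+ 2 * M)%:E)%E.
Proof.
move=> h0 h2 K0 M0 ha hb /norm_l1P hc.
have A0 := absq_ge0 a; have B0 := absq_ge0 b; have D0 := absq_ge0 c.
have min0 y z : 0 <= Num.min (freq R y) (freq R z) by rewrite le_min !freq_ge0.
apply: (@le_trans _ _ (\esum_ x ((absq c x)%:E * (4 * K ^+ 2)%:E))%E).
  apply: le_esum => x _.
  apply: (@le_trans _ _ (\esum_ y ((absq c x)%:E * \esum_ z
    ((Num.min (freq R y) (freq R z) * (absq a y * absq b z) * h (y + z + x))%:E)))%E).
    apply: le_esum => y _; rewrite -esumZl ?lee_fin//; last first.
      by move=> z; rewrite lee_fin !mulr_ge0.
    apply: le_esum => z _; rewrite -EFinM lee_fin.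
    by rewrite le_eqVlt; apply/orP; left; apply/eqP; ring.
  rewrite esumZl ?lee_fin//; last first.
    by move=> y; apply: esum_ge0 => z _; rewrite lee_fin !mulr_ge0.
  by rewrite lee_wpmul2l ?lee_fin//; exact: bilinear_min.
rewrite esumZr ?lee_fin ?mulr_ge0 ?exprn_ge0//.
by rewrite [(_ * M)%R]mulrC [leRHS]EFinM lee_wpmul2r ?lee_fin ?mulr_ge0 ?exprn_ge0.
Qed.

Lemma phase_defect_l2 s a (K M : R) : 0 <= s -> 0 <= K -> 0 <= M ->
  Hbound a K -> norm_le test_l1 a M ->
  norm_le test_l2 (phase_defect s a) (24 * K ^+ 2 * M * s).
Proof.
move=> s0 K0 M0 haK ha; rewrite phase_defectE; last exact: norm_l1_l1 ha.
apply: (norm_le_trisum test_class_l2) => h Hh; have [h0 h2] := Hh.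
have A0 := absq_ge0 a; have D0 := absq_ge0 (conj_refl a).
have hcK := Hbound_conj_refl haK.
have hc := norm_le_conj_refl test_class_l1 ha.
have min0 y z : 0 <= Num.min (freq R y) (freq R z) by rewrite le_min !freq_ge0.
pose t (mn : int -> int -> int -> R) := esum3 (fun j l m =>
  (h (j + l + m) * (mn j l m * (absq a j * absq a l * absq (conj_refl a) m)))%:E).
have T1 : (t (fun j l m => Num.min (freq R j) (freq R l)) <= (4 * K ^+ 2 * M)%:E)%E.
  rewrite /t esum3_rot; last by move=> *; rewrite lee_fin !mulr_ge0.
  rewrite esum3_rot; last by move=> *; rewrite lee_fin !mulr_ge0.
  apply: le_trans (esum3_min_outer h0 h2 K0 M0 haK haK hc).
  by apply: le_esum3 => x y z; rewrite lee_fin !mulrA.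
have T2 : (t (fun j l m => Num.min (freq R l) (freq R m)) <= (4 * K ^+ 2 * M)%:E)%E.
  apply: le_trans (esum3_min_outer h0 h2 K0 M0 haK hcK ha).
  apply: le_esum3 => x y z; rewrite lee_fin [(y + z + x)%R]addrC addrA.
  by rewrite le_eqVlt; apply/orP; left; apply/eqP; ring.
have T3 : (t (fun j l m => Num.min (freq R j) (freq R m)) <= (4 * K ^+ 2 * M)%:E)%E.
  rewrite /t esum3_swap; last by move=> *; rewrite lee_fin !mulr_ge0.
  apply: le_trans (esum3_min_outer h0 h2 K0 M0 haK hcK ha).
  apply: le_esum3 => x y z; rewrite lee_fin [(y + z + x)%R]addrAC.
  by rewrite le_eqVlt; apply/orP; left; apply/eqP; ring.
have sum3 := leeD T1 (leeD T2 T3).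
rewrite /t -esum3D in sum3; last 2 first.
- by move=> *; rewrite lee_fin !mulr_ge0.
- by move=> *; rewrite lee_fin !mulr_ge0.
rewrite -esum3D in sum3; last 2 first.
- by move=> *; rewrite lee_fin !mulr_ge0.
- by move=> *; rewrite -EFinD lee_fin addr_ge0 ?mulr_ge0.
have -> : 24 * K ^+ 2 * M * s =
    2 * s * (4 * K ^+ 2 * M + (4 * K ^+ 2 * M + 4 * K ^+ 2 * M)) by ring.
rewrite EFinM; apply: le_trans (lee_wpmul2l _ sum3); last by rewrite lee_fin mulr_ge0.
rewrite -esum3Z ?mulr_ge0//; last first.
  by move=> j l m; rewrite -!EFinD lee_fin !addr_ge0 ?mulr_ge0.
apply: le_esum3 => j l m; rewrite -!EFinD -EFinM lee_fin -!mulrDr -!mulrDl.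
rewrite !cabsM -/(absq a j) -/(absq a l) -/(absq (conj_refl a) m) [leRHS]mulrCA ler_wpM2l//.
rewrite -[(absq a j * _ * _)%R]mulrA [leRHS]mulrA ler_wpM2r ?mulr_ge0//.
apply: le_trans (cabs_phase_gap _ _ _ s0) _.
rewrite [2 * s]mulrC -mulrA ler_wpM2l// addrA; exact: resonance_le.
Qed.

(** In l^1 the half derivatives are not available.  Low frequencies give a factor
    s, and the contribution of the high ones is small with the tail e of the sum of
    the inverse weights. *)
Lemma phase_defect_l1 s a (K M e : R) (N : nat) : 0 <= s -> 0 <= K -> 0 <= M ->
  0 <= e -> Hbound a K -> norm_le test_l1 a M ->
  (\esum_ k ((if k \in window N then 0 else inv_weight R k)%:E) <= (e ^+ 2)%:E)%E ->
  norm_le test_l1 (phase_defect s a) (3 * s * N%:R * M ^+ 3 + 6 * M ^+ 2 * (e * K)).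
Proof.
move=> s0 K0 M0 e0 haK ha he; rewrite phase_defectE; last exact: norm_l1_l1 ha.
apply: (norm_le_trisum test_class_l1) => h Hh; have h0 := test_ge0 test_class_l1 Hh.
pose ahi k : C := if k \in window N then 0 else a k.
have hhi : norm_le test_l1 ahi (e * K).
  apply/norm_l1P; apply: (le_trans _ (Hbound_l1 (E := fun k => k \notin window N) K0 e0 haK _)).
    by apply: le_esum => k _; rewrite lee_fin /ahi; case: (k \in _); rewrite ?cabs0.
  by apply: le_trans he; apply: le_esum => k _; case: (k \in window N).
have hc := norm_le_conj_refl test_class_l1 ha.
have hchi := norm_le_conj_refl test_class_l1 hhi.
have eK0 : 0 <= e * K by rewrite mulr_ge0.
have tH := @test_class_l1 R.
have S0 := young3 tH Hh M0 M0 M0 ha ha hc.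
have S1 := leeD (young1 tH Hh eK0 M0 M0 hhi ha hc)
  (leeD (young2 tH Hh M0 eK0 M0 ha hhi hc) (young3 tH Hh M0 M0 eK0 ha ha hchi)).
have pos (x y z : int -> C) j l m :
    (0 <= (h (j + l + m) * (absq x j * absq y l * absq z m))%:E)%E.
  by rewrite lee_fin !mulr_ge0 ?absq_ge0.
have pos2 (x y z x' y' z' : int -> C) j l m :
    (0 <= (h (j + l + m) * (absq x j * absq y l * absq z m))%:E +
     (h (j + l + m) * (absq x' j * absq y' l * absq z' m))%:E)%E.
  by rewrite adde_ge0//; apply: pos.
have pos3 (x y z x' y' z' x2 y2 z2 : int -> C) j l m :
    (0 <= (h (j + l + m) * (absq x j * absq y l * absq z m))%:E +
     ((h (j + l + m) * (absq x' j * absq y' l * absq z' m))%:E +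
      (h (j + l + m) * (absq x2 j * absq y2 l * absq z2 m))%:E))%E.
  by rewrite adde_ge0.
rewrite /esum_prod -esum3D in S1; last 2 first.
- by move=> *; apply: pos.
- by move=> *; apply: pos.
rewrite -esum3D in S1; last 2 first.
- by move=> *; apply: pos.
- by move=> *; apply: pos2.
have c0 : 0 <= 3 * s * N%:R by rewrite !mulr_ge0.
have S := leeD (lee_wpmul2l (_ : (0 <= (3 * s * N%:R)%:E)%E) S0)
               (lee_wpmul2l (_ : (0 <= 2%:E)%E) S1).
have {S} := S c0 (ler0n _ _).
rewrite /esum_prod -!esum3Z//.
rewrite -esum3D; [|by move=> *; rewrite mule_ge0 ?lee_fin//; apply: pos
                  |by move=> *; rewrite mule_ge0 ?lee_fin//; apply: pos3].
move=> S.
have -> : 3 * s * N%:R * M ^+ 3 + 6 * M ^+ 2 * (e * K) =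
  3 * s * N%:R * (M * M * M) + 2 * (e * K * M * M + (M * (e * K) * M + M * M * (e * K))).
  by ring.
apply: le_trans S.
apply: le_esum3 => j l m; rewrite -!EFinD lee_fin.
rewrite !cabsM -/(absq a j) -/(absq a l) -/(absq (conj_refl a) m).
set p := cabs (phase_gap _ _ _ _).
have A0 := absq_ge0 a; have D0 := absq_ge0 (conj_refl a).
have I0 := absq_ge0 ahi; have J0 := absq_ge0 (conj_refl ahi).
rewrite -!mulrDr [3 * s * N%:R * _]mulrCA [2 * _]mulrCA -mulrDr ler_wpM2l//.
have low k : k \in window N -> freq R k <= N%:R by move=> kN; exact: (window_le R kN).
have p2 : p <= 2 by exact: cabs_phase_gap2.
have tri0 : 0 <= absq a j * absq a l * absq (conj_refl a) m by rewrite !mulr_ge0.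
have r1 : 0 <= absq ahi j * absq a l * absq (conj_refl a) m by rewrite !mulr_ge0.
have r2 : 0 <= absq a j * absq ahi l * absq (conj_refl a) m by rewrite !mulr_ge0.
have r3 : 0 <= absq a j * absq a l * absq (conj_refl ahi) m by rewrite !mulr_ge0.
have one x : absq a j * absq a l * absq (conj_refl a) m <= x ->
    0 <= x -> p * (absq a j * (absq a l * absq (conj_refl a) m)) <=
    3 * s * N%:R * (absq a j * absq a l * absq (conj_refl a) m) + 2 * x.
  move=> hx x0; rewrite [absq a j * (_ * _)]mulrA.
  apply: ler_wpDl; first by rewrite mulr_ge0.
  by apply: ler_pM => //; exact: cabs_ge0.
case: (boolP (j \in window N)) => [jN|/negbTE jN]; last first.
  apply: one; last by rewrite !addr_ge0.
  have -> : absq ahi j = absq a j by rewrite /absq /ahi jN.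
  by rewrite lerDl addr_ge0.
case: (boolP (l \in window N)) => [lN|/negbTE lN]; last first.
  apply: one; last by rewrite !addr_ge0.
  have -> : absq ahi l = absq a l by rewrite /absq /ahi lN.
  by rewrite addrCA lerDl addr_ge0.
(* The third factor is a reflected sequence, so its cutoff is at - m. *)
case: (boolP (- m \in window N)) => [mN|/negbTE mN]; last first.
  apply: one; last by rewrite !addr_ge0.
  have -> : absq (conj_refl ahi) m = absq (conj_refl a) m.
    by rewrite /absq /conj_refl /ahi mN.
  by rewrite addrA lerDr addr_ge0.
apply: ler_wpDr; first by rewrite mulr_ge0 ?addr_ge0.
rewrite [absq a j * (_ * _)]mulrA ler_wpM2r//.
apply: le_trans (cabs_phase_gap _ _ _ s0) _.
rewrite [3 * s]mulrC -mulrA ler_wpM2l//.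
have := low _ jN; have := low _ lN; have := low _ mN.
have := freq_ge0 R (j + l + m); rewrite freqN /resonance; lra.
Qed.

End PhaseDefect.

(** * Integrals of complex functions *)

Section ComplexIntegral.
Variable R : realType.
Local Notation C := R[i].
Local Notation Re := complex.Re.
Local Notation Im := complex.Im.
Local Notation mu := (@lebesgue_measure R).
Implicit Types (D : set R) (f g : R -> C).

Definition cmeasurable D f :=
  measurable_fun D (fun x => Re (f x)) /\ measurable_fun D (fun x => Im (f x)).

Lemma cmeasurable_cst D z : cmeasurable D (fun=> z).
Proof. by split; exact: measurable_cst. Qed.

Lemma cmeasurableD D f g : cmeasurable D f -> cmeasurable D g ->
  cmeasurable D (fun x => f x + g x).
Proof.
move=> [fr fi] [gr gi]; split.
  by under eq_fun do rewrite ReD; exact: measurable_funD.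
by under eq_fun do rewrite ImD; exact: measurable_funD.
Qed.

Lemma cmeasurableM D f g : cmeasurable D f -> cmeasurable D g ->
  cmeasurable D (fun x => f x * g x).
Proof.
move=> [fr fi] [gr gi]; split.
  by under eq_fun do rewrite ReM; apply: measurable_funB; exact: measurable_funM.
by under eq_fun do rewrite ImM; apply: measurable_funD; exact: measurable_funM.
Qed.

Lemma cmeasurableZ D z f : cmeasurable D f -> cmeasurable D (fun x => z * f x).
Proof. exact: cmeasurableM (cmeasurable_cst D z). Qed.

Lemma cmeasurable_sum D (I : Type) (s : seq I) (F : I -> R -> C) :
  (forall i, cmeasurable D (F i)) -> cmeasurable D (fun x => \sum_(i <- s) F i x).
Proof.
move=> hF; elim: s => [|i s IH].
  by under eq_fun do rewrite big_nil; exact: cmeasurable_cst.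
by under eq_fun do rewrite big_cons; exact: cmeasurableD.
Qed.

Lemma cmeasurableS D E f : measurable E -> D `<=` E ->
  cmeasurable E f -> cmeasurable D f.
Proof. by move=> mE DE [fr fi]; split; apply: measurable_funS; eassumption. Qed.

Lemma measurable_cabs D f : cmeasurable D f -> measurable_fun D (fun x => cabs (f x)).
Proof.
move=> [fr fi].
have -> : (fun x => cabs (f x)) = (fun x => Num.sqrt (Re (f x) ^+ 2 + Im (f x) ^+ 2)).
  by apply/funext => x; rewrite -cabs_sqr sqrtr_sqr ger0_norm ?cabs_ge0.
apply: (@measurableT_comp _ _ _ _ _ _ (@Num.sqrt R)).
  by apply: continuous_measurable_fun; exact: sqrt_continuous.
by apply: measurable_funD; apply: measurable_funX.
Qed.

Lemma cmeasurable_csum D (F : int -> R -> C) : measurable D ->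
  (forall k, cmeasurable D (F k)) -> (forall x, D x -> l1 (F ^~ x)) ->
  cmeasurable D (fun x => csum (F ^~ x)).
Proof.
move=> mD mF hF.
have ms N : cmeasurable D (fun x => psum N (F ^~ x)).
  by apply: cmeasurable_sum.
split.
  apply: (@measurable_fun_cvg _ _ _ D (fun N x => Re (psum N (F ^~ x)))).
    by move=> N; have [] := ms N.
  by move=> x Dx; apply: cvg_psum_Re; exact: hF.
apply: (@measurable_fun_cvg _ _ _ D (fun N x => Im (psum N (F ^~ x)))).
  by move=> N; have [] := ms N.
by move=> x Dx; apply: cvg_psum_Im; exact: hF.
Qed.

Definition cintegrable D f :=
  mu.-integrable D (EFin \o (fun x => Re (f x))) /\
  mu.-integrable D (EFin \o (fun x => Im (f x))).

Definition cintegral D f : C :=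
  ((\int[mu]_(x in D) Re (f x)) +i* (\int[mu]_(x in D) Im (f x)))%C.

Lemma cintegrable_cmeasurable D f : cintegrable D f -> cmeasurable D f.
Proof.
by move=> [/measurable_int hr /measurable_int hi]; split; apply/measurable_EFinP.
Qed.

Lemma le_cintegrable D f (g : R -> R) : measurable D -> cmeasurable D f ->
  mu.-integrable D (EFin \o g) -> (forall x, D x -> cabs (f x) <= g x) ->
  cintegrable D f.
Proof.
move=> mD [fr fi] ig fg; split; apply: le_integrable ig => //.
- exact/measurable_EFinP.
- move=> x Dx /=; rewrite lee_fin (le_trans (normr_Re _))// (le_trans (fg x Dx))//.
  exact: ler_norm.
- exact/measurable_EFinP.
- move=> x Dx /=; rewrite lee_fin (le_trans (normr_Im _))// (le_trans (fg x Dx))//.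
  exact: ler_norm.
Qed.

Lemma integrable_cabs D f : measurable D -> cintegrable D f ->
  mu.-integrable D (EFin \o (fun x => cabs (f x))).
Proof.
move=> mD fi; have [ir ii] := fi; have mf := cintegrable_cmeasurable fi.
apply: (@le_integrable _ _ _ mu D mD _
  (fun x => ((`|Re (f x)| + `|Im (f x)|)%R)%:E)).
- by apply/measurable_EFinP; exact: measurable_cabs.
- move=> x Dx /=; rewrite lee_fin ger0_norm ?cabs_ge0// ger0_norm ?addr_ge0//.
  exact: cabs_le_ReIm.
- have := @integrableD _ _ _ mu _ mD _ _ (integrable_abse ir) (integrable_abse ii).
  by apply: eq_integrable => // x _.
Qed.

Lemma integrable_cst_finite D (M : R) : measurable D -> (mu D < +oo)%E ->
  mu.-integrable D (EFin \o (fun=> M)).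
Proof.
move=> mD Dfin; apply: measurable_bounded_integrable => //.
by exists `|M|; split; [exact: num_real|move=> x Mx y _ /=; exact: ltW].
Qed.

Lemma bounded_cintegrable D f (M : R) : measurable D -> (mu D < +oo)%E ->
  cmeasurable D f -> (forall x, D x -> cabs (f x) <= M) -> cintegrable D f.
Proof.
move=> mD Dfin mf fM; apply: (le_cintegrable (g := fun=> M)) => //.
exact: integrable_cst_finite.
Qed.

Lemma eq_cintegral D f g : (forall x, D x -> f x = g x) ->
  cintegral D f = cintegral D g.
Proof.
move=> fg; apply: complex_eqP => /=.
- by apply: eq_Rintegral => x xD; rewrite fg//; exact: set_mem.
- by apply: eq_Rintegral => x xD; rewrite fg//; exact: set_mem.
Qed.

Lemma eq_cintegrable D f g : measurable D -> (forall x, D x -> f x = g x) ->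
  cintegrable D f -> cintegrable D g.
Proof.
move=> mD fg [fr fi]; split; [apply: eq_integrable fr|apply: eq_integrable fi] => //.
- by move=> x xD /=; rewrite fg//; exact: set_mem.
- by move=> x xD /=; rewrite fg//; exact: set_mem.
Qed.

Section MeasurableDomain.
Variables (D : set R) (mD : measurable D).

Lemma cintegrableD f g : cintegrable D f -> cintegrable D g ->
  cintegrable D (fun x => f x + g x).
Proof.
move=> [fr fi] [gr gi]; split.
  have := @integrableD _ _ _ mu _ mD _ _ fr gr; apply: eq_integrable => // x _ /=.
  by rewrite ReD EFinD.
have := @integrableD _ _ _ mu _ mD _ _ fi gi; apply: eq_integrable => // x _ /=.
by rewrite ImD EFinD.
Qed.

Lemma cintegralD f g : cintegrable D f -> cintegrable D g ->
  cintegral D (fun x => f x + g x) = cintegral D f + cintegral D g.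
Proof.
move=> [fr fi] [gr gi]; apply: complex_eqP; rewrite /cintegral/=.
  by under eq_Rintegral do rewrite ReD; exact: RintegralD.
by under eq_Rintegral do rewrite ImD; exact: RintegralD.
Qed.

Lemma cintegrableZ z f : cintegrable D f -> cintegrable D (fun x => z * f x).
Proof.
move=> fi; have mf := cintegrable_cmeasurable fi.
apply: (le_cintegrable (g := fun x => cabs z * cabs (f x))) => //.
- exact: cmeasurableZ.
- have := @integrableZl _ _ _ mu _ mD (cabs z) _ (integrable_cabs mD fi).
  by apply: eq_integrable.
- by move=> x _; rewrite cabsM.
Qed.

Lemma cintegralZ z f : cintegrable D f ->
  cintegral D (fun x => z * f x) = z * cintegral D f.
Proof.
move=> [fr fi]; have zr w (g : R -> R) : mu.-integrable D (EFin \o g) ->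
    mu.-integrable D (EFin \o (fun x => w * g x)).
  by move=> ig; have := @integrableZl _ _ _ mu _ mD w _ ig; apply: eq_integrable.
apply: complex_eqP; rewrite /cintegral ?ReM ?ImM/=.
  under eq_Rintegral do rewrite ReM.
  by rewrite RintegralB ?zr// !RintegralZl.
under eq_Rintegral do rewrite ImM.
by rewrite RintegralD ?zr// !RintegralZl.
Qed.

Lemma cintegrableB f g : cintegrable D f -> cintegrable D g ->
  cintegrable D (fun x => f x - g x).
Proof.
move=> hf hg; have := cintegrableD hf (cintegrableZ (-1) hg).
by apply: eq_cintegrable => // x _; rewrite mulN1r.
Qed.

Lemma cintegralB f g : cintegrable D f -> cintegrable D g ->
  cintegral D (fun x => f x - g x) = cintegral D f - cintegral D g.
Proof.
move=> hf hg; rewrite -[X in _ + X]mulN1r -cintegralZ// -cintegralD//.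
  by apply: eq_cintegral => x _; rewrite mulN1r.
exact: cintegrableZ.
Qed.

Lemma cintegral0 : cintegral D (fun=> 0) = 0.
Proof.
by apply: complex_eqP; rewrite /cintegral/= Rintegral_cst// mul0r.
Qed.

Lemma cintegrable_sum (I : Type) (s : seq I) (F : I -> R -> C) :
  (forall i, cintegrable D (F i)) -> cintegrable D (fun x => \sum_(i <- s) F i x).
Proof.
move=> hF; elim: s => [|i s IH].
  under eq_fun do rewrite big_nil.
  by split; have := integrable0 mu D; apply: eq_integrable.
by under eq_fun do rewrite big_cons; exact: cintegrableD.
Qed.

Lemma cintegral_sum (I : Type) (s : seq I) (F : I -> R -> C) :
  (forall i, cintegrable D (F i)) ->
  cintegral D (fun x => \sum_(i <- s) F i x) = \sum_(i <- s) cintegral D (F i).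
Proof.
move=> hF; elim: s => [|i s IH].
  by under eq_fun do rewrite big_nil; rewrite cintegral0 big_nil.
under eq_fun do rewrite big_cons.
by rewrite cintegralD ?IH ?big_cons//; exact: cintegrable_sum.
Qed.

(** Rotating the integral to the positive half axis reduces the triangle
    inequality to a real one. *)
Lemma cabs_cintegral f : cintegrable D f ->
  cabs (cintegral D f) <= \int[mu]_(x in D) cabs (f x).
Proof.
move=> fi; set z := cintegral D f.
have I0 : 0 <= \int[mu]_(x in D) cabs (f x) by apply: Rintegral_ge0 => x _; exact: cabs_ge0.
have [z0|zn0] := eqVneq (cabs z) 0; first by rewrite z0.
have zp : 0 < cabs z by rewrite lt_neqAle eq_sym zn0 cabs_ge0.
rewrite -(ler_pM2l zp) -expr2.
have -> : cabs z ^+ 2 = \int[mu]_(x in D) Re ((z^*)%C * f x).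
  transitivity (Re ((z^*)%C * cintegral D f)); last by rewrite -cintegralZ.
  by rewrite cabs_sqr ReM ReJ ImJ -/z; ring.
clearbody z; rewrite -RintegralZl//; last exact: integrable_cabs.
apply: le_Rintegral => //.
- by have [] := cintegrableZ (z^*)%C fi.
- have := @integrableZl _ _ _ mu _ mD (cabs z) _ (integrable_cabs mD fi).
  by apply: eq_integrable.
- move=> x Dx; rewrite (le_trans (ler_norm _))// (le_trans (normr_Re _))//.
  by rewrite cabsM cabsJ.
Qed.

Lemma cabs_cintegral_le f (M : R) : (mu D < +oo)%E -> cintegrable D f ->
  (forall x, D x -> cabs (f x) <= M) -> cabs (cintegral D f) <= M * fine (mu D).
Proof.
move=> Dfin fi fM; rewrite (le_trans (cabs_cintegral fi))// -Rintegral_cst//.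
apply: le_Rintegral => //; first exact: integrable_cabs.
exact: integrable_cst_finite.
Qed.

(** Minkowski's inequality.  By duality only finite sums have to be exchanged with
    the integral. *)
Lemma norm_le_cintegral H (E : R -> int -> C) (M : R) : test_class H ->
  (mu D < +oo)%E -> (forall k, cintegrable D (E ^~ k)) ->
  (forall x, D x -> norm_le H (E x) M) ->
  norm_le H (fun k => cintegral D (E ^~ k)) (M * fine (mu D)).
Proof.
move=> tH Dfin iE hE h Hh; have h0 := test_ge0 tH Hh.
apply: esum_le_fin => s us; rewrite sumEFin lee_fin.
have iEh k : mu.-integrable D (EFin \o (fun x => cabs (E x k) * h k)).
  have := @integrableZr _ _ _ mu _ mD (h k) _ (integrable_cabs mD (iE k)).
  by apply: eq_integrable.
apply: (@le_trans _ _ (\sum_(k <- s) \int[mu]_(x in D) (cabs (E x k) * h k))).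
  apply: ler_sum => k _; rewrite RintegralZr//; last exact: integrable_cabs.
  by rewrite ler_wpM2r// cabs_cintegral.
have [isum sumE] : mu.-integrable D (EFin \o (fun x => \sum_(k <- s) (cabs (E x k) * h k)))
   /\ \sum_(k <- s) \int[mu]_(x in D) (cabs (E x k) * h k) =
      \int[mu]_(x in D) (\sum_(k <- s) (cabs (E x k) * h k)).
  elim: s {us} => [|k s [i1 e1]].
    rewrite big_nil; split; last first.
      by under eq_Rintegral do rewrite big_nil; rewrite Rintegral_cst// mul0r.
    by have := integrable0 mu D; apply: eq_integrable => // x _ /=; rewrite big_nil.
  split.
    have := @integrableD _ _ _ mu _ mD _ _ (iEh k) i1.
    by apply: eq_integrable => // x _ /=; rewrite big_cons EFinD.
  rewrite big_cons e1 -RintegralD//.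
  by apply: eq_Rintegral => x _; rewrite big_cons.
rewrite sumE -Rintegral_cst//; apply: le_Rintegral => //.
  exact: integrable_cst_finite.
move=> x Dx; rewrite -lee_fin -sumEFin.
by apply: (le_trans (le_sum_esum _ us)); exact: hE.
Qed.

(** Domination by a fixed summable sequence makes the tails uniformly small, so
    that only finite sums are exchanged with the integral. *)
Lemma cintegral_csum (F : int -> R -> C) (d : int -> C) : (mu D < +oo)%E ->
  (forall k, cmeasurable D (F k)) -> l1 d ->
  (forall k x, D x -> cabs (F k x) <= cabs (d k)) ->
  cintegral D (fun x => csum (F ^~ x)) = csum (fun k => cintegral D (F k)).
Proof.
move=> Dfin mF ld hF.
have iF k : cintegrable D (F k) by apply: bounded_cintegrable (hF k).
have lF x : D x -> l1 (F ^~ x) by move=> Dx; apply: l1_le ld => k; exact: hF.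
have [M M0 hM] := l1_norm ld.
have d0 k : (0 <= (cabs (d k))%:E)%E by rewrite lee_fin cabs_ge0.
have iS : cintegrable D (fun x => csum (F ^~ x)).
  apply: (@bounded_cintegrable _ _ M) => //; first exact: cmeasurable_csum.
  move=> x Dx; rewrite -lee_fin; apply: (le_trans (cabs_csum _)).
  have /norm_l1P := hM; apply: le_trans; apply: le_esum => k _.
  by rewrite lee_fin hF.
have D0 : 0 <= fine (mu D) by rewrite fine_ge0.
apply: csum_eq_approx.
  have ldM : l1 (fun k => (fine (mu D))%:C%C * d k) by exact: l1Z.
  apply: l1_le ldM => k; rewrite cabsM cabs_real ger0_norm// mulrC.
  by apply: cabs_cintegral_le => // x Dx; exact: hF.
move=> e e0; have e1 : 0 < e / (fine (mu D) + 1) by rewrite divr_gt0// ltr_wpDl.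
have [N0 hN0] := esum_tail d0 ld e1.
exists N0 => N NN; rewrite /psum -cintegral_sum// -cintegralB//; last exact: cintegrable_sum.
apply: (@le_trans _ _ (e / (fine (mu D) + 1) * fine (mu D))); last first.
  by rewrite mulrAC ler_pdivrMr ?ltr_wpDl// ler_wpM2l ?(ltW e0)// lerDl.
apply: cabs_cintegral_le => //.
  by apply: cintegrableB => //; exact: cintegrable_sum.
move=> x Dx; rewrite -lee_fin; apply: (le_trans (csum_tail N (lF x Dx))).
apply: le_trans hN0; apply: le_esum => k _.
case: (boolP (k \in window N0)) => [/(mem_window_le NN) ->//|_].
by case: ifP => // _; rewrite lee_fin hF.
Qed.

End MeasurableDomain.

Lemma Rintegral_derive (a b : R) (f F : R -> R) : a < b -> continuous f ->
  (forall x : R, is_derive x (1 : R) F (f x)) ->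
  \int[mu]_(x in `[a, b]) f x = F b - F a.
Proof.
move=> ab cf dF; rewrite /Rintegral.
have cF x : {for x, continuous F}.
  by apply/differentiable_continuous/derivable1_diffP; have [] := dF x.
rewrite (@continuous_FTC2 R f F)//.
- exact: continuous_subspaceT.
- split; first by move=> x _; have [] := dF x.
    by apply: cvg_at_right_filter; exact: cF.
  by apply: cvg_at_left_filter; exact: cF.
- by move=> x _; rewrite derive1E; have [_] := dF x.
Qed.

End ComplexIntegral.

(** * Uniqueness of Fourier coefficients *)

Section Circle.
Variable R : realType.
Local Notation C := R[i].
Local Notation Re := complex.Re.
Local Notation Im := complex.Im.
Local Notation mu := (@lebesgue_measure R).
Local Notation T := (@period_cell R).

Lemma measurable_cell : measurable T.
Proof. exact: measurable_itv. Qed.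

Lemma cell_measure : mu T = (2 * pi)%:E.
Proof.
rewrite /period_cell lebesgue_measure_itv/= lte_fin.
have pi0 := pi_gt0 R; rewrite ifT; last lra.
by rewrite opprK -EFinD -mulr2n mulr_natl.
Qed.

Lemma cell_finite : (mu T < +oo)%E.
Proof. by rewrite cell_measure ltry. Qed.

Definition mode (k : int) (x : R) : C := cis (k%:~R * x).

Lemma cabs_mode k x : cabs (mode k x) = 1. Proof. exact: cabs_cis. Qed.

Lemma modeD j k x : mode (j + k) x = mode j x * mode k x.
Proof. by rewrite /mode rmorphD mulrDl cisD. Qed.

Lemma mode0 x : mode 0 x = 1. Proof. by rewrite /mode mul0r cis0. Qed.

Lemma modeN k x : mode (- k) x = ((mode k x)^*)%C.
Proof. by rewrite /mode rmorphN mulNr cisN. Qed.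

Lemma mode_per k x : mode k (x + 2 * pi) = mode k x.
Proof.
have m1 : mode 1 (2 * pi : R) = 1.
  by rewrite /mode mul1r mulr_natl /cis cos2pi sin2pi.
rewrite /mode mulrDr cisD -/(mode k x) -/(mode k (2 * pi)).
suff -> : mode k (2 * pi : R) = 1 by rewrite mulr1.
have mn (n : nat) : mode n (2 * pi : R) = 1.
  elim: n => [|n IH]; first by rewrite mode0.
  by rewrite -addn1 PoszD modeD IH m1 mulr1.
case: k => n; first exact: mn.
by rewrite NegzE modeN mn; apply: complex_eqP; rewrite ?ReJ ?ImJ//= oppr0.
Qed.

Lemma continuous_cosM (c : R) : continuous (fun x => cos (c * x)).
Proof.
move=> x; apply: (@continuous_comp _ _ _ ( *%R c) (@cos R)).
  exact: mulrl_continuous.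
exact: continuous_cos.
Qed.

Lemma continuous_sinM (c : R) : continuous (fun x => sin (c * x)).
Proof.
move=> x; apply: (@continuous_comp _ _ _ ( *%R c) (@sin R)).
  exact: mulrl_continuous.
exact: continuous_sin.
Qed.

Lemma cmeasurable_mode D k : cmeasurable D (mode k).
Proof.
apply: (@cmeasurableS _ _ setT) => //; split; apply: continuous_measurable_fun.
  exact: continuous_cosM.
exact: continuous_sinM.
Qed.

Lemma cintegrable_mulmode f k : cintegrable T f ->
  cintegrable T (fun x => f x * mode k x).
Proof.
move=> fi; apply: (le_cintegrable (g := fun x => cabs (f x))).
- exact: measurable_cell.
- by apply: cmeasurableM; [exact: cintegrable_cmeasurable|exact: cmeasurable_mode].
- exact: integrable_cabs measurable_cell fi.
- by move=> x _; rewrite cabsM cabs_mode mulr1.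
Qed.

Lemma cintegral_mode k : cintegral T (mode k) = if k == 0 then (2 * pi)%:C%C else 0.
Proof.
case: eqP => [->|/eqP k0].
  have -> : mode 0 = (fun=> 1) by apply/funext => x; rewrite mode0.
  have mT := measurable_cell.
  apply: complex_eqP; rewrite /cintegral/= Rintegral_cst// ?mul0r// mul1r.
  exact: (congr1 fine cell_measure).
have kR : (k%:~R : R) != 0 by rewrite intr_eq0.
have per : cis (k%:~R * pi) = cis (k%:~R * - pi : R).
  by rewrite -[RHS]/(mode k (- pi)) -[RHS]mode_per /mode; congr cis; ring.
have perc : cos (k%:~R * pi) = cos (k%:~R * - pi : R).
  by have := congr1 (@complex.Re R) per.
have pers : sin (k%:~R * pi) = sin (k%:~R * - pi : R).
  by have := congr1 (@complex.Im R) per.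
have ltNpi : - pi < pi :> R by have := pi_gt0 R; lra.
have dsin (x : R) : is_derive x (1 : R) (fun x => (k%:~R)^-1 * sin (k%:~R * x))
    (cos (k%:~R * x)).
  apply: is_derive_eq.
  by rewrite /GRing.scale/= mulr1 mulrCA mulVf// mulr1.
have dcos (x : R) : is_derive x (1 : R) (fun x => - ((k%:~R)^-1 * cos (k%:~R * x)))
    (sin (k%:~R * x)).
  apply: is_derive_eq.
  by rewrite /GRing.scale/= mulr1 mulNr mulrN opprK mulrCA mulVf// mulr1.
apply: complex_eqP; rewrite /cintegral/=.
  by rewrite (Rintegral_derive ltNpi (@continuous_cosM _) dsin) pers subrr.
by rewrite (Rintegral_derive ltNpi (@continuous_sinM _) dcos) perc subrr.
Qed.

Section Uniqueness.

Lemma ae_neq (c : R) : {ae mu, forall x, x != c}.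
Proof.
exists [set c]; split; [exact: measurable_set1|exact: lebesgue_measure_set1|].
by move=> x /= /negP; rewrite negbK => /eqP.
Qed.

Definition zero_coefs (f : R -> C) :=
  cintegrable T f /\ forall k, cintegral T (fun x => f x * mode k x) = 0.

Lemma zero_coefs_mode f k : zero_coefs f -> zero_coefs (fun x => mode k x * f x).
Proof.
move=> [fi f0]; split.
  by under eq_fun do rewrite mulrC; exact: cintegrable_mulmode.
move=> j; rewrite -[RHS](f0 (k + j)); apply: eq_cintegral => x _.
by rewrite modeD mulrA [mode k x * _]mulrC.
Qed.

Lemma zero_coefsD f g : zero_coefs f -> zero_coefs g ->
  zero_coefs (fun x => f x + g x).
Proof.
move=> [fi f0] [gi g0]; split; first exact: cintegrableD measurable_cell _ _ fi gi.
move=> k; rewrite (eq_cintegral (g := fun x => f x * mode k x + g x * mode k x)).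
  by rewrite cintegralD ?f0 ?g0 ?addr0//;
    [exact: measurable_cell|exact: cintegrable_mulmode..].
by move=> x _; rewrite mulrDl.
Qed.

Lemma zero_coefsZ z f : zero_coefs f -> zero_coefs (fun x => z * f x).
Proof.
move=> [fi f0]; split; first exact: cintegrableZ measurable_cell _ _ fi.
move=> k; rewrite (eq_cintegral (g := fun x => z * (f x * mode k x))).
  rewrite cintegralZ ?f0 ?mulr0//; first exact: measurable_cell.
  exact: cintegrable_mulmode.
by move=> x _; rewrite mulrA.
Qed.

(** Multipliers that preserve the vanishing of all coefficients; they form an
    algebra which contains the trigonometric polynomials. *)
Definition multiplier (p : R -> C) :=
  forall f, zero_coefs f -> zero_coefs (fun x => p x * f x).

Lemma multiplier_cst z : multiplier (fun=> z).
Proof. by move=> f; exact: zero_coefsZ. Qed.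

Lemma multiplier_mode k : multiplier (mode k).
Proof. by move=> f; exact: zero_coefs_mode. Qed.

Lemma multiplierD p q : multiplier p -> multiplier q ->
  multiplier (fun x => p x + q x).
Proof.
move=> hp hq f hf; have := zero_coefsD (hp _ hf) (hq _ hf).
by under eq_fun do rewrite -mulrDl.
Qed.

Lemma multiplierM p q : multiplier p -> multiplier q ->
  multiplier (fun x => p x * q x).
Proof.
move=> hp hq f hf; have := hp _ (hq _ hf).
by under eq_fun do rewrite mulrA.
Qed.

Lemma multiplierX p n : multiplier p -> multiplier (fun x => p x ^+ n).
Proof.
move=> hp; elim: n => [|n IH].
  by under eq_fun do rewrite expr0; exact: multiplier_cst.
by under eq_fun do rewrite exprS; exact: multiplierM.
Qed.

(* On the period cell it exceeds 1/2 exactly on the left of b. *)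
Let bump (b x : R) : R := 2^-1 + (cos (x - (b - pi) / 2) - cos ((b + pi) / 2)) / 4.

Let multiplier_bump b : multiplier (fun x => ((bump b x)%:C)%C).
Proof.
set x0 := (b - pi) / 2; set g := cos ((b + pi) / 2).
have -> : (fun x => ((bump b x)%:C)%C) = (fun x =>
    (((2^-1 - g / 4)%:C)%C + ((8%:R^-1)%:C)%C * cis (- x0) * mode 1 x) +
    ((8%:R^-1)%:C)%C * cis x0 * mode (- 1) x).
  apply/funext => x; rewrite modeN cisN /bump -/x0 -/g.
  rewrite cosB; by apply: complex_eqP; rewrite !(ReD, ImD, ReM, ImM, ReJ, ImJ)/=;
  rewrite mul1r; field.
exact: (multiplierD (multiplierD (multiplier_cst _)
  (multiplierM (multiplier_cst _) (multiplier_mode 1)))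
  (multiplierM (multiplier_cst _) (multiplier_mode (- 1)))).
Qed.

(* The product form shows the sign of bump - 1/2 on the period cell. *)
Let bumpE b x : bump b x = 2^-1 + (sin ((x + pi) / 2) * sin ((b - x) / 2)) / 2.
Proof.
rewrite /bump; set s := (x + pi) / 2; set t := (b - x) / 2.
have -> : x - (b - pi) / 2 = s - t by rewrite /s /t; field.
have -> : (b + pi) / 2 = s + t by rewrite /s /t; field.
by rewrite cosB cosD; field.
Qed.

Let bump_itv b x : 0 <= bump b x <= 1.
Proof.
rewrite /bump; have := cos_geN1 (x - (b - pi) / 2); have := cos_le1 (x - (b - pi) / 2).
have := cos_geN1 ((b + pi) / 2); have := cos_le1 ((b + pi) / 2).
by move=> *; apply/andP; split; lra.
Qed.

Let bump_left b x : - pi < x -> x < b -> b <= pi -> 2^-1 < bump b x.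
Proof.
move=> x1 xb bp; rewrite bumpE ltrDl divr_gt0// mulr_gt0//.
  by apply: sin_gt0_pi; apply/andP; split; lra.
by apply: sin_gt0_pi; apply/andP; split; lra.
Qed.

Let bump_right b x : - pi <= b -> b < x -> x < pi -> bump b x < 2^-1.
Proof.
move=> bp bx x1; rewrite bumpE gtrDl pmulr_llt0 ?invr_gt0// pmulr_rlt0.
  have -> : (b - x) / 2 = - ((x - b) / 2) by field.
  rewrite sinN oppr_lt0; apply: sin_gt0_pi; apply/andP; split; lra.
by apply: sin_gt0_pi; apply/andP; split; lra.
Qed.

(* The polynomials (1 - y^n)^(2^n) have values in [0, 1] for y in [0, 1]; they
   tend to 1 for y < 1/2 and to 0 for y > 1/2. *)
Let cutoff (y : R) (n : nat) : R := (1 - y ^+ n) ^+ (2 ^ n).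

Let bernoulli_sub (z : R) m : 0 <= z <= 1 -> 1 - m%:R * z <= (1 - z) ^+ m.
Proof.
move=> /andP[z0 z1]; elim: m => [|m IH]; first by rewrite mul0r subr0 expr0.
rewrite exprSr; apply: (@le_trans _ _ ((1 - m%:R * z) * (1 - z))).
  rewrite -natr1; have : 0 <= m%:R * z * z by rewrite !mulr_ge0.
  set w := m%:R * z; have -> : (m%:R + 1) * z = w + z by rewrite mulrDl mul1r.
  by rewrite mulrBl mul1r mulrBr mulr1; lra.
by rewrite ler_wpM2r// subr_ge0.
Qed.

Let bernoulli_add (z : R) m : 0 <= z -> 1 + m%:R * z <= (1 + z) ^+ m.
Proof.
move=> z0; elim: m => [|m IH]; first by rewrite mul0r addr0 expr0.
rewrite exprSr; apply: (@le_trans _ _ ((1 + m%:R * z) * (1 + z))).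
  rewrite -natr1; have : 0 <= m%:R * z * z by rewrite !mulr_ge0.
  set w := m%:R * z; have -> : (m%:R + 1) * z = w + z by rewrite mulrDl mul1r.
  by rewrite mulrDl mul1r mulrDr mulr1; lra.
by rewrite ler_wpM2r// addr_ge0.
Qed.

Let cutoff_itv y n : 0 <= y <= 1 -> 0 <= cutoff y n <= 1.
Proof.
move=> /andP[y0 y1]; have yn0 : 0 <= y ^+ n by rewrite exprn_ge0.
have yn1 : y ^+ n <= 1 by rewrite exprn_ile1.
by rewrite /cutoff exprn_ge0 ?subr_ge0// exprn_ile1 ?subr_ge0// lerBlDr lerDl.
Qed.

Let cutoff_low y : 0 <= y -> y < 2^-1 -> cutoff y n @[n --> \oo] --> (1 : R).
Proof.
move=> y0 y1; have y01 : 0 <= y <= 1 by apply/andP; split; lra.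
apply: (@squeeze_cvgr _ _ _ _ (fun n => 1 - (2 * y) ^+ n) (fun=> 1)).
- apply: nearW => n; have /andP[_ ->] := cutoff_itv n y01; rewrite andbT.
  rewrite exprMn -natrX; apply: bernoulli_sub.
  by rewrite exprn_ge0// exprn_ile1//; lra.
- rewrite -[X in _ --> X](subr0 1); apply: cvgB; first exact: cvg_cst.
  by apply: cvg_expr; rewrite ger0_norm; lra.
- exact: cvg_cst.
Qed.

Let cutoff_high y : 2^-1 < y -> y <= 1 -> cutoff y n @[n --> \oo] --> (0 : R).
Proof.
move=> y0 y1; have y01 : 0 <= y <= 1 by apply/andP; split; lra.
have y2 : 0 < 2 * y by lra.
apply: (@squeeze_cvgr _ _ _ _ (fun=> 0) (fun n => ((2 * y)^-1) ^+ n)).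
- apply: nearW => n; have /andP[-> _] := cutoff_itv n y01; rewrite andTb.
  have z0 : 0 <= y ^+ n by rewrite exprn_ge0//; lra.
  have z1 : y ^+ n <= 1 by rewrite exprn_ile1//; lra.
  rewrite exprVn -[leRHS]mul1r ler_pdivlMr ?exprn_gt0//.
  apply: (@le_trans _ _ ((1 - y ^+ n) ^+ (2 ^ n) * (1 + y ^+ n) ^+ (2 ^ n))).
    rewrite ler_wpM2l ?exprn_ge0 ?subr_ge0//.
    apply: le_trans (bernoulli_add _ z0).
    by rewrite exprMn -natrX lerDr.
  rewrite -exprMn exprn_ile1//.
    by rewrite mulr_ge0 ?subr_ge0 ?addr_ge0.
  by rewrite -subr_sqr expr1n lerBlDr lerDl sqr_ge0.
- exact: cvg_cst.
- by apply: cvg_expr; rewrite ger0_norm ?invr_ge0 ?(ltW y2)// invf_lt1//; lra.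
Qed.

Let left_primitive (g : R -> R) : mu.-integrable T (EFin \o g) ->
  (forall b n, \int[mu]_(x in T) ((1 - cutoff (bump b x) n) * g x) = 0) ->
  forall b, - pi <= b -> b <= pi -> \int[mu]_(x in `[- pi, b]) g x = 0.
Proof.
move=> ig hg b b1 b2; have mT := measurable_cell.
have mg : measurable_fun T g by apply/measurable_EFinP; exact: measurable_int ig.
have mbump : measurable_fun setT (bump b).
  apply: measurable_funD => //; apply: measurable_funM => //.
  apply: measurable_funB => //.
  apply: (@measurableT_comp _ _ _ _ _ _ (@cos R)).
    by apply: continuous_measurable_fun; exact: continuous_cos.
  by apply: measurable_funB; [exact: measurable_id|exact: measurable_cst].
have mcut n : measurable_fun T (fun x => (1 - cutoff (bump b x) n) * g x).
  apply: measurable_funM => //; apply: (measurable_funS measurableT) => //.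
  apply: measurable_funB; first exact: measurable_cst.
  apply: measurable_funX; apply: measurable_funB; first exact: measurable_cst.
  exact: measurable_funX.
have cut_itv x n : 0 <= 1 - cutoff (bump b x) n <= 1.
  have /andP[h0 h1] := cutoff_itv n (bump_itv b x).
  by apply/andP; split; lra.
have sub : `[- pi, b]%classic `<=` T.
  by move=> x /=; rewrite /period_cell/= !in_itv/= => /andP[-> /le_trans ->].
have -> : \int[mu]_(x in `[- pi, b]) g x = \int[mu]_(x in T) (g \_ `[- pi, b]) x.
  by rewrite -Rintegral_mkcondr setIidr.
have -> : \int[mu]_(x in T) (g \_ `[- pi, b]) x =
    fine (\int[mu]_(x in T) ((g \_ `[- pi, b]) x)%:E)%E by [].
have lim_ae : {ae mu, forall x, T x ->
    ((1 - cutoff (bump b x) n) * g x)%:E @[n --> \oo] --> ((g \_ `[- pi, b]) x)%:E}.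
  move: (ae_neq (- pi)) (ae_neq b) (ae_neq pi); apply: (@filterS3 _ _ (ae_filter_ringOfSetsType mu)) => x.
  move=> xp xb xq Tx; apply: cvg_EFin; first exact: nearW.
  move: (Tx); rewrite /period_cell/= in_itv/= => /andP[x1 x2].
  have [u0 u1] := andP (bump_itv b x).
  rewrite [X in _ --> X](_ : _ = (1 - (b < x)%R%:R) * g x); last first.
    rewrite patchE mem_setE in_itv/= x1/=.
    by case: ltgtP xb => //= bx _; rewrite ?subr0 ?subrr ?mul1r ?mul0r.
  apply: cvgM; last exact: cvg_cst.
  apply: cvgB; first exact: cvg_cst.
  case: ltgtP xb => //= bx _.
    apply: cutoff_low => //; apply: bump_right => //.
    by rewrite lt_neqAle xq.
  apply: cutoff_high => //; apply: bump_left => //.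
  by rewrite lt_neqAle eq_sym xp.
have [] := @dominated_convergence _ _ R mu T mT
  (fun n x => ((1 - cutoff (bump b x) n) * g x)%:E)
  (fun x => ((g \_ `[- pi, b]) x)%:E) (fun x => `|(g x)%:E|%E).
- by move=> n; apply/measurable_EFinP; exact: mcut.
- apply/measurable_EFinP; apply/(measurable_restrict _ (measurable_itv _) mT).
  exact: measurable_funS mg.
- exact: lim_ae.
- exact: integrable_abse.
- apply: aeW => x n _; rewrite !abse_EFin lee_fin normrM ler_piMl//.
  by have /andP[h0 h1] := cut_itv x n; rewrite ger0_norm.
- move=> _ _ lim.
  have lim0 : (fun n => \int[mu]_(x in T) ((1 - cutoff (bump b x) n) * g x)%:E)%E @ \oo --> 0%E.
    rewrite (_ : (fun n => _) = fun=> 0%E); first exact: cvg_cst.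
    apply/funext => n; rewrite -[LHS]fineK.
      by congr (_%:E); exact: hg.
    apply: integrable_fin_num => //.
    apply: (le_integrable _ _ _ ig) => //; first by apply/measurable_EFinP; exact: mcut.
    move=> x Tx /=; rewrite lee_fin normrM ler_piMl//.
    by have /andP[h0 h1] := cut_itv x n; rewrite ger0_norm.
  by rewrite (cvg_unique _ lim lim0).
Qed.

Let primitive_ae0 (g : R -> R) : mu.-integrable T (EFin \o g) ->
  (forall b, - pi <= b -> b <= pi -> \int[mu]_(x in `[- pi, b]) g x = 0) ->
  {ae mu, forall x, T x -> g x = 0}.
Proof.
move=> ig hg; have mT := measurable_cell; have pi0 := pi_gt0 R.
have F0 y : \int[mu]_(t in [set` Interval (BLeft (- pi)) (BRight y)]) (g \_ T) t = 0.
  rewrite -Rintegral_mkcondr.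
  have [y1|y1] := ltP y (- pi).
    rewrite (_ : _ `&` _ = set0) ?Rintegral_set0//.
    apply/seteqP; split => // x [/=]; rewrite in_itv/= => /andP[h1 h2] _.
    by have := le_lt_trans (le_trans h1 h2) y1; rewrite ltxx.
  rewrite (_ : _ `&` _ = `[- pi, Num.min y pi]%classic).
    by apply: hg; rewrite ?le_min ?y1 ?ge_min ?lexx ?orbT//=; lra.
  apply/seteqP; split => x /=; rewrite /period_cell/= !in_itv/= le_min.
    by move=> [/andP[-> ->] /andP[_ ->]].
  by move=> /andP[-> /andP[-> ->]].
have igT y : mu.-integrable [set` Interval (BLeft (- pi)) (BRight y)] (EFin \o (g \_ T)).
  have h : mu.-integrable setT (EFin \o (g \_ T)).
    by have := iffLR (@integrable_mkcond _ _ _ mu T (EFin \o g) mT) ig; rewrite restrict_EFin.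
  by apply: integrableS h.
move: (FTC1 igT (integrable_locally_restrict mT ig)) (ae_neq (- pi)).
apply: (@filterS2 _ _ (ae_filter_ringOfSetsType mu)) => x hx xp Tx.
move: (Tx); rewrite /period_cell/= in_itv/= => /andP[x1 x2].
have ax : ((BLeft (- pi)%R : itv_bound R) < (BRight x : itv_bound R))%E by rewrite lte_fin lt_neqAle eq_sym xp.
have [_] := hx ax.
rewrite patchE mem_set// => <-.
rewrite (_ : (fun y => _) = fun=> 0); first by rewrite derive1_cst.
by apply/funext => y; exact: F0.
Qed.

(** All integrals of f against trigonometric polynomials vanish.  Polynomials in
    the bump stay in [0, 1] and converge to the indicator function of [-pi, b], so
    that the primitive of f vanishes, and so does f by Lebesgue's differentiation
    theorem. *)
Theorem zero_coefs_ae f : zero_coefs f -> {ae mu, forall x, T x -> f x = 0}.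
Proof.
move=> hf; have mT := measurable_cell.
have hq b n : zero_coefs (fun x => ((1 - cutoff (bump b x) n)%:C)%C * f x).
  have -> : (fun x => ((1 - cutoff (bump b x) n)%:C)%C * f x) = (fun x =>
      (1 + (-1) * (1 + (-1) * ((bump b x)%:C)%C ^+ n) ^+ (2 ^ n)) * f x).
    by apply/funext => x; rewrite /cutoff !mulN1r rmorphB rmorphXn rmorphB rmorphXn rmorph1.
  have mb := multiplier_bump b.
  have m1 : multiplier (fun x => 1 + (-1) * ((bump b x)%:C)%C ^+ n).
    exact: (multiplierD (multiplier_cst _) (multiplierM (multiplier_cst _) (multiplierX n mb))).
  exact: (multiplierD (multiplier_cst _)
    (multiplierM (multiplier_cst _) (multiplierX (2 ^ n) m1))).
have int0 b n : cintegral T (fun x => ((1 - cutoff (bump b x) n)%:C)%C * f x) = 0.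
  have [_ /(_ 0) h] := hq b n; rewrite -[RHS]h.
  by apply: eq_cintegral => x _; rewrite mode0 mulr1.
have [[ifr ifi] _] := hf.
have re1 b n : \int[mu]_(x in T) ((1 - cutoff (bump b x) n) * Re (f x)) = 0.
  transitivity (Re (cintegral T (fun x => ((1 - cutoff (bump b x) n)%:C)%C * f x))).
    by apply: eq_Rintegral => x _; rewrite ReM Re_real Im_real mul0r subr0.
  by rewrite int0.
have im1 b n : \int[mu]_(x in T) ((1 - cutoff (bump b x) n) * Im (f x)) = 0.
  transitivity (Im (cintegral T (fun x => ((1 - cutoff (bump b x) n)%:C)%C * f x))).
    by apply: eq_Rintegral => x _; rewrite ImM Re_real Im_real mul0r addr0.
  by rewrite int0.
move: (primitive_ae0 ifr (left_primitive ifr re1))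
  (primitive_ae0 ifi (left_primitive ifi im1)).
apply: (@filterS2 _ _ (ae_filter_ringOfSetsType mu)) => x r i Tx.
by apply: complex_eqP; [exact: r|exact: i].
Qed.

End Uniqueness.

End Circle.

(** * Fourier coefficients of square integrable functions *)

Section FourierCoefficients.
Variable R : realType.
Local Notation C := R[i].
Local Notation Re := complex.Re.
Local Notation Im := complex.Im.
Local Notation mu := (@lebesgue_measure R).
Local Notation T := (@period_cell R).
Implicit Types (f g : R -> C) (a b : int -> C).

Let mT : measurable T := @measurable_cell R.
Let pi0 : 0 < pi :> R := pi_gt0 R.
Let pi2_neq0 : (2 * pi : R) != 0. Proof. by rewrite gt_eqF// mulr_gt0. Qed.

Lemma fourier_coefE f k : fourier_coef f k =
  (((2 * pi)^-1)%:C)%C * cintegral T (fun x => f x * mode (- k) x).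
Proof.
rewrite /fourier_coef; congr (_ * _); apply: eq_cintegral => x _.
by rewrite cexp_Ni /mode rmorphN mulNr.
Qed.

Lemma cell_volume : fine (mu T) = 2 * pi.
Proof. by rewrite cell_measure. Qed.

Definition sqr_int f : \bar R := (\int[mu]_(x in T) ((cabs (f x)) ^+ 2)%:E)%E.

Lemma sqr_int_ge0 f : (0 <= sqr_int f)%E.
Proof. by apply: integral_ge0 => x _; rewrite lee_fin sqr_ge0. Qed.

Lemma L2norm_fin f : (L2norm f < +oo)%E -> (sqr_int f < +oo)%E.
Proof.
by apply: lty_poweRy; rewrite invr_eq0 pnatr_eq0.
Qed.

Lemma L2normE f (r : R) : 0 <= r -> sqr_int f = (r ^+ 2)%:E -> L2norm f = r%:E.
Proof.
move=> r0 hr; rewrite /L2norm -/(sqr_int f) hr poweR_EFin.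
by rewrite -powR_mulrn// -powRrM mulfV ?pnatr_eq0// powRr1.
Qed.

Lemma L2norm_le f (r : R) : 0 <= r -> (sqr_int f <= (r ^+ 2)%:E)%E -> (L2norm f <= r%:E)%E.
Proof.
move=> r0 hr; have h0 := sqr_int_ge0 f.
have fin : sqr_int f \is a fin_num.
  by rewrite ge0_fin_numE// (le_lt_trans hr)// ltry.
have s0 : 0 <= fine (sqr_int f) by exact: fine_ge0.
rewrite (@L2normE _ (Num.sqrt (fine (sqr_int f)))) ?sqrtr_ge0//; last first.
  by rewrite sqr_sqrtr// fineK.
rewrite lee_fin -(@ler_pXn2r _ 2) ?nnegrE ?sqrtr_ge0// sqr_sqrtr//.
by rewrite -lee_fin fineK.
Qed.

Lemma inL2_cmeasurable f : inL2 f -> cmeasurable T f.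
Proof.
by move=> [_ mr mi _]; apply: (@cmeasurableS _ _ setT).
Qed.

Lemma inL2_sqr_integrable f : inL2 f ->
  mu.-integrable T (EFin \o (fun x => cabs (f x) ^+ 2)).
Proof.
move=> hf; have mf := inL2_cmeasurable hf; have [_ _ _ /L2norm_fin h] := hf.
apply/integrableP; split.
  by apply/measurable_EFinP; apply: measurable_funX; exact: measurable_cabs.
under eq_integral do rewrite /= ger0_norm ?sqr_ge0//.
exact: h.
Qed.

Lemma inL2_cintegrable f : inL2 f -> cintegrable T f.
Proof.
move=> hf; apply: (le_cintegrable (g := fun x => 1 + cabs (f x) ^+ 2)) => //.
- exact: inL2_cmeasurable.
- have := @integrableD _ _ _ mu _ mT _ _ (integrable_cst_finite 1 mT (cell_finite R))
    (inL2_sqr_integrable hf).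
  by apply: eq_integrable.
- move=> x _; have := sqr_ge0 (cabs (f x) - 2^-1); have := cabs_ge0 (f x).
  by rewrite sqrrB; lra.
Qed.

Lemma fourier_coefD f g k : cintegrable T f -> cintegrable T g ->
  fourier_coef (fun x => f x + g x) k = fourier_coef f k + fourier_coef g k.
Proof.
move=> hf hg; rewrite !fourier_coefE -mulrDr; congr (_ * _).
rewrite -cintegralD; [|exact: mT|exact: cintegrable_mulmode..].
by apply: eq_cintegral => x _; rewrite mulrDl.
Qed.

Lemma fourier_coefZ z f k : cintegrable T f ->
  fourier_coef (fun x => z * f x) k = z * fourier_coef f k.
Proof.
move=> hf; rewrite !fourier_coefE mulrCA; congr (_ * _).
rewrite -cintegralZ; [|exact: mT|exact: cintegrable_mulmode].
by apply: eq_cintegral => x _; rewrite mulrA.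
Qed.

Lemma fourier_coefB f g k : cintegrable T f -> cintegrable T g ->
  fourier_coef (fun x => f x - g x) k = fourier_coef f k - fourier_coef g k.
Proof.
move=> hf hg; have := fourier_coefD k hf (cintegrableZ mT (-1) hg).
rewrite fourier_coefZ// mulN1r => <-.
by congr (fourier_coef _ k); apply/funext => x; rewrite mulN1r.
Qed.

Lemma ae_eq_cintegral f g : cmeasurable T f -> cmeasurable T g ->
  {ae mu, forall x, T x -> f x = g x} -> cintegral T f = cintegral T g.
Proof.
move=> [fr fi] [gr gi] fg; apply: complex_eqP; congr fine.
  apply: ae_eq_integral => //; try exact/measurable_EFinP.
  by move: fg; apply: (@filterS _ _ (ae_filter_ringOfSetsType mu)) => x h Tx; rewrite h.
apply: ae_eq_integral => //; try exact/measurable_EFinP.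
by move: fg; apply: (@filterS _ _ (ae_filter_ringOfSetsType mu)) => x h Tx; rewrite h.
Qed.

Lemma ae_eq_fourier_coef f g k : cmeasurable T f -> cmeasurable T g ->
  ae_eq_torus f g -> fourier_coef f k = fourier_coef g k.
Proof.
move=> mf mg fg; rewrite !fourier_coefE; congr (_ * _); apply: ae_eq_cintegral.
- by apply: cmeasurableM => //; exact: cmeasurable_mode.
- by apply: cmeasurableM => //; exact: cmeasurable_mode.
- by move: fg; apply: (@filterS _ _ (ae_filter_ringOfSetsType mu)) => x h Tx; rewrite h.
Qed.

Lemma ae_eq_sqr_int f g : cmeasurable T f -> cmeasurable T g ->
  ae_eq_torus f g -> sqr_int f = sqr_int g.
Proof.
move=> mf mg fg; apply: ae_eq_integral => //.
- by apply/measurable_EFinP; apply: measurable_funX; exact: measurable_cabs.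
- by apply/measurable_EFinP; apply: measurable_funX; exact: measurable_cabs.
- by move: fg; apply: (@filterS _ _ (ae_filter_ringOfSetsType mu)) => x h Tx; rewrite h.
Qed.

Theorem fourier_coef_inj f g : inL2 f -> inL2 g ->
  (forall k, fourier_coef f k = fourier_coef g k) -> ae_eq_torus f g.
Proof.
move=> hf hg fg; have fi := inL2_cintegrable hf; have gi := inL2_cintegrable hg.
have : zero_coefs (fun x => f x - g x).
  split; first exact: cintegrableB.
  move=> k; have := fourier_coefB (- k) fi gi; rewrite fg subrr fourier_coefE opprK.
  move=> /eqP; rewrite mulf_eq0 => /orP[|/eqP //].
  by rewrite eq_complex/= invr_eq0 (negbTE pi2_neq0).
move=> /zero_coefs_ae; apply: (@filterS _ _ (ae_filter_ringOfSetsType mu)) => x h Tx.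
by apply/eqP; rewrite -subr_eq0 h.
Qed.

(** Cauchy-Schwarz against a mode, from x <= t / 2 + x^2 / (2 t) with t optimised
    after integration. *)
Lemma fourier_coef_L2 f k : inL2 f -> ((cabs (fourier_coef f k))%:E <= L2norm f)%E.
Proof.
move=> hf; have fi := inL2_cintegrable hf.
have [_ _ _ /L2norm_fin fin] := hf; have h0 := sqr_int_ge0 f.
have finn : sqr_int f \is a fin_num by rewrite ge0_fin_numE.
set S := fine (sqr_int f); have S0 : 0 <= S by exact: fine_ge0.
have SE : \int[mu]_(x in T) (cabs (f x) ^+ 2) = S by [].
have -> : L2norm f = (Num.sqrt S)%:E.
  by apply: L2normE; rewrite ?sqrtr_ge0// sqr_sqrtr// fineK.
rewrite lee_fin fourier_coefE cabsM cabs_real ger0_norm ?invr_ge0 ?mulr_ge0 ?(ltW pi0)//.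
have bound t : 0 < t -> cabs (cintegral T (fun x => f x * mode (- k) x)) <=
    t / 2 * (2 * pi) + (2 * t)^-1 * S.
  move=> t0; apply: (le_trans (cabs_cintegral mT (cintegrable_mulmode (- k) fi))).
  have i1 : mu.-integrable T (EFin \o (fun=> t / 2)).
    exact: integrable_cst_finite (cell_finite R).
  have i2 : mu.-integrable T (EFin \o (fun x => (2 * t)^-1 * cabs (f x) ^+ 2)).
    have := @integrableZl _ _ _ mu _ mT (2 * t)^-1 _ (inL2_sqr_integrable hf).
    by apply: eq_integrable.
  apply: (@le_trans _ _ (\int[mu]_(x in T) (t / 2 + (2 * t)^-1 * cabs (f x) ^+ 2))).
    apply: le_Rintegral => //.
    - exact: integrable_cabs mT (cintegrable_mulmode (- k) fi).
    - have := @integrableD _ _ _ mu _ mT _ _ i1 i2; by apply: eq_integrable.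
    - move=> x _; rewrite cabsM cabs_mode mulr1 -subr_ge0.
      have -> : t / 2 + (2 * t)^-1 * cabs (f x) ^+ 2 - cabs (f x) =
        (cabs (f x) - t) ^+ 2 / (2 * t) by (field; rewrite gt_eqF).
      by rewrite divr_ge0 ?sqr_ge0// mulr_ge0// ltW.
  rewrite RintegralD// Rintegral_cst// RintegralZl//; last exact: inL2_sqr_integrable.
  by rewrite SE cell_volume.
set z := cabs _ in bound *; rewrite mulrC ler_pdivrMr ?mulr_gt0//.
have pi_ge2 := pi_ge2 R.
have [S00|Sn0] := eqVneq S 0.
  rewrite S00 sqrtr0 mul0r; apply/ler_addgt0Pr => e e0; rewrite add0r.
  have := bound (e / pi) (divr_gt0 e0 pi0); rewrite S00 mulr0 addr0.
  have pin : pi != 0 :> R by rewrite gt_eqF.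
  by rewrite mulrA divfK ?pnatr_eq0// divfK.
have Sp : 0 < S by rewrite lt_neqAle eq_sym Sn0.
have qp : 0 < Num.sqrt S by rewrite sqrtr_gt0.
have := bound _ qp; have {3}<- : Num.sqrt S ^+ 2 = S by rewrite sqr_sqrtr.
move: (Num.sqrt S) qp => q qp.
have -> : (2 * q)^-1 * q ^+ 2 = q / 2.
  have qn : q != 0 by rewrite gt_eqF.
  by field.
have : q <= q * pi by rewrite ler_peMr ?(ltW qp)//; lra.
by move=> h1 h2; apply: (le_trans h2); lra.
Qed.

End FourierCoefficients.

(** * The Wiener algebra *)

Section WienerAlgebra.
Variable R : realType.
Local Notation C := R[i].
Local Notation Re := complex.Re.
Local Notation Im := complex.Im.
Local Notation mu := (@lebesgue_measure R).
Local Notation T := (@period_cell R).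
Implicit Types (f g : R -> C) (a b : int -> C).

Let mT : measurable T := @measurable_cell R.

Definition synth a (x : R) : C := csum (fun k => a k * mode k x).

Lemma synth_l1 a x : l1 a -> l1 (fun k => a k * mode k x).
Proof. by apply: l1_le => k; rewrite cabsM cabs_mode mulr1. Qed.

Lemma cmeasurable_synth D a : measurable D -> l1 a -> cmeasurable D (synth a).
Proof.
move=> mD la; apply: cmeasurable_csum => //.
  by move=> k; apply: cmeasurableZ; exact: cmeasurable_mode.
by move=> x _; exact: synth_l1.
Qed.

Lemma cabs_synth a M x : norm_le test_l1 a M -> cabs (synth a x) <= M.
Proof.
move=> /norm_l1P h; rewrite -lee_fin; apply: (le_trans (cabs_csum _)).
apply: le_trans h; apply: le_esum => k _.
by rewrite cabsM cabs_mode mulr1.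
Qed.

Lemma fourier_coef_synth a k : l1 a -> fourier_coef (synth a) k = a k.
Proof.
move=> la; rewrite fourier_coefE.
have -> : cintegral T (fun x => synth a x * mode (- k) x) =
    cintegral T (fun x => csum (fun j => a j * mode (j - k) x)).
  apply: eq_cintegral => x _; rewrite /synth mulrC -csumZ; last exact: synth_l1.
  by congr csum; apply/funext => j; rewrite modeD; ring.
rewrite (@cintegral_csum _ T mT (fun j x => a j * mode (j - k) x) a)//; last 3 first.
- exact: cell_finite.
- by move=> j; apply: cmeasurableZ; exact: cmeasurable_mode.
- by move=> j x _; rewrite cabsM cabs_mode mulr1.
have cE j : cintegral T (fun x => a j * mode (j - k) x) =
    a j * (if j == k then ((2 * pi)%:C)%C else 0).
  rewrite cintegralZ//; last first.
    apply: (@bounded_cintegrable _ T _ 1) => //; first exact: cell_finite.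
      exact: cmeasurable_mode.
    by move=> x _; rewrite cabs_mode.
  by rewrite cintegral_mode subr_eq0.
have [N hN] := sub_window [:: k].
rewrite (@csum_finite _ N); last first.
  move=> j jN; rewrite cE; case: eqP => [jk|_]; last by rewrite mulr0.
  by move: jN; rewrite jk hN// mem_head.
rewrite /psum (bigD1_seq k) ?window_uniq ?hN ?mem_head//= big1 => [|j jk].
  rewrite addr0 cE eqxx mulrCA -rmorphM mulVf ?rmorph1 ?mulr1//.
  by rewrite gt_eqF// mulr_gt0// pi_gt0.
by rewrite cE (negbTE jk) mulr0.
Qed.

Lemma inL2_bounded f h (M : R) : (forall x, f (x + 2 * pi) = f x) ->
  cmeasurable setT f -> cmeasurable T h -> ae_eq_torus f h ->
  (forall x, cabs (h x) <= M) -> inL2 f.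
Proof.
move=> fper mf mh fh hM; have [mr mi] := mf; split => //.
have mfT : cmeasurable T f by apply: cmeasurableS mf.
have M0 : 0 <= M := le_trans (cabs_ge0 _) (hM 0).
apply: (@le_lt_trans _ _ (Num.sqrt (M ^+ 2 * (2 * pi)))%:E); last exact: ltry.
apply: L2norm_le; first exact: sqrtr_ge0.
rewrite sqr_sqrtr ?mulr_ge0 ?sqr_ge0 ?pi_ge0//.
rewrite (ae_eq_sqr_int mfT mh fh) EFinM -cell_measure -integral_cst//.
apply: ge0_le_integral => //.
- by move=> x _; rewrite lee_fin sqr_ge0.
- by apply/measurable_EFinP; apply: measurable_funX; exact: measurable_cabs.
- by move=> x _; rewrite lee_fin ler_pXn2r ?nnegrE ?cabs_ge0.
Qed.

Lemma inL2_synth a : l1 a -> inL2 (synth a).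
Proof.
move=> la; have [M _ hM] := l1_norm la.
apply: (@inL2_bounded _ (synth a) M) => //.
- by move=> x; rewrite /synth; congr csum; apply/funext => k; rewrite mode_per.
- exact: cmeasurable_synth.
- exact: cmeasurable_synth.
- by apply: aeW.
- by move=> x; exact: cabs_synth.
Qed.

(** Membership in the Wiener algebra up to null sets, with the coefficients as a
    parameter. *)
Definition wiener f a := [/\ inL2 f, l1 a & forall k, fourier_coef f k = a k].

Lemma wiener_synth a : l1 a -> wiener (synth a) a.
Proof. by move=> la; split => //; [exact: inL2_synth|move=> k; exact: fourier_coef_synth]. Qed.

Lemma wiener_ae f a : wiener f a -> ae_eq_torus f (synth a).
Proof.
move=> [hf la fa]; apply: fourier_coef_inj => //; first exact: inL2_synth.
by move=> k; rewrite fourier_coef_synth.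
Qed.

Lemma wiener_inL2 f a : wiener f a -> inL2 f. Proof. by case. Qed.
Lemma wiener_l1 f a : wiener f a -> l1 a. Proof. by case. Qed.
Lemma wiener_cintegrable f a : wiener f a -> cintegrable T f.
Proof. by case=> /inL2_cintegrable. Qed.

Lemma inL2_cmeasurableT f : inL2 f -> cmeasurable setT f.
Proof. by case. Qed.

Lemma l1_conv a b : l1 a -> l1 b -> l1 (conv a b).
Proof.
move=> la /l1_norm[M M0 /norm_l1P hb].
apply: (@le_lt_trans _ _ (\esum_ k (\esum_ j ((cabs (a j))%:E * (cabs (b (k - j)))%:E)))%E).
  apply: le_esum => k _; apply: (le_trans (cabs_csum _)).
  by apply: le_esum => j _; rewrite cabsM EFinM.
rewrite esum_swap; last by move=> k j; rewrite -EFinM lee_fin mulr_ge0 ?cabs_ge0.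
apply: (@le_lt_trans _ _ (\esum_ j ((cabs (a j))%:E * M%:E))%E).
  apply: le_esum => j _; rewrite esumZl ?lee_fin ?cabs_ge0//; last first.
    by move=> k; rewrite lee_fin cabs_ge0.
  by rewrite (esum_shift (fun k => (cabs (b k))%:E)) lee_wpmul2l ?lee_fin ?cabs_ge0.
rewrite esumZr ?lee_fin//; last by move=> j; rewrite lee_fin cabs_ge0.
have h0 : (0 <= \esum_ j ((cabs (a j))%:E))%E.
  by apply: esum_ge0 => j _; rewrite lee_fin cabs_ge0.
by rewrite -(@fineK _ (esum _ _)) ?ge0_fin_numE// -EFinM ltry.
Qed.

(** Both factors may be replaced by their absolutely convergent Fourier series,
    and that of f is integrated term by term. *)
Lemma wiener_mul f g a b : wiener f a -> wiener g b ->
  wiener (fun x => f x * g x) (conv a b).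
Proof.
move=> wf wg; have [hf la fa] := wf; have [hg lb gb] := wg.
have [M M0 hM] := l1_norm la; have [N N0 hN] := l1_norm lb.
have fgae : ae_eq_torus (fun x => f x * g x) (fun x => synth a x * synth b x).
  move: (wiener_ae wf) (wiener_ae wg).
  apply: (@filterS2 _ _ (ae_filter_ringOfSetsType mu)) => x h1 h2 Tx.
  by rewrite h1// h2.
have ms : cmeasurable T (fun x => synth a x * synth b x).
  by apply: cmeasurableM; exact: cmeasurable_synth.
have mfg : cmeasurable setT (fun x => f x * g x).
  by apply: cmeasurableM; exact: inL2_cmeasurableT.
split; [|exact: l1_conv|move=> k].
  apply: (@inL2_bounded _ (fun x => synth a x * synth b x) (M * N)) => //.
    by move=> x; have [-> _ _ _] := hf; have [-> _ _ _] := hg.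
  by move=> x; rewrite cabsM ler_pM ?cabs_ge0// cabs_synth.
have mfgT : cmeasurable T (fun x => f x * g x) by apply: cmeasurableS mfg.
rewrite (ae_eq_fourier_coef k mfgT ms fgae) fourier_coefE.
have bi : cintegrable T (synth b) := inL2_cintegrable (inL2_synth lb).
have -> : cintegral T (fun x => synth a x * synth b x * mode (- k) x) =
    cintegral T (fun x => csum (fun j => a j * (synth b x * mode (j - k) x))).
  apply: eq_cintegral => x _; rewrite -mulrA mulrC /(synth a) -csumZ; last exact: synth_l1.
  by congr csum; apply/funext => j; rewrite modeD; ring.
rewrite (@cintegral_csum _ T mT (fun j x => a j * (synth b x * mode (j - k) x))
  (fun j => (M%:C)%C * 0 + ((N%:C)%C * a j)))//; last 4 first.
- exact: cell_finite.
- move=> j; apply: cmeasurableZ; apply: cmeasurableM; last exact: cmeasurable_mode.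
  exact: cmeasurable_synth.
- by under eq_fun do rewrite mulr0 add0r; exact: l1Z.
- move=> j x _; rewrite mulr0 add0r !cabsM cabs_mode mulr1 mulrC cabs_real ger0_norm//.
  by rewrite ler_wpM2r ?cabs_ge0// cabs_synth.
rewrite -csumZ.
  congr csum; apply/funext => j; rewrite cintegralZ//; last exact: cintegrable_mulmode.
  rewrite mulrCA; congr (_ * _); have [_ _ <-] := wiener_synth lb.
  by rewrite fourier_coefE opprB.
have lN : l1 (fun j => ((N * (2 * pi))%:C)%C * a j) by exact: l1Z.
apply: l1_le lN => j; rewrite cintegralZ//; last exact: cintegrable_mulmode.
rewrite cabsM [leRHS]cabsM mulrC ler_wpM2r ?cabs_ge0// cabs_real.
apply: le_trans (ler_norm _); rewrite -(cell_volume R).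
apply: (@cabs_cintegral_le _ T mT) => //; first exact: cell_finite.
  exact: cintegrable_mulmode.
by move=> x _; rewrite cabsM cabs_mode mulr1 cabs_synth.
Qed.

Lemma wiener_conj f a : wiener f a -> wiener (fun x => ((f x)^*)%C) (conj_refl a).
Proof.
move=> [hf la fa]; have [fper mr mi fin] := hf; have fi := inL2_cintegrable hf.
split; [|exact: l1_conj_refl|].
  split; first by move=> x; rewrite fper.
  - by under eq_fun do rewrite ReJ.
  - by under eq_fun do rewrite ImJ; exact: measurableT_comp.
  - rewrite (_ : L2norm _ = L2norm f)//; rewrite /L2norm; congr (_ `^ _)%E.
    by apply: eq_integral => x _; rewrite cabsJ.
move=> k; rewrite /conj_refl -fa !fourier_coefE opprK.
have [ir ii] := cintegrable_mulmode k fi.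
have -> : cintegral T (fun x => (f x)^*%C * mode (- k) x) =
    ((cintegral T (fun x => f x * mode k x))^*)%C.
  apply: complex_eqP; rewrite ?ReJ ?ImJ /cintegral/=.
    by apply: eq_Rintegral => x _; rewrite modeN !ReM !ReJ !ImJ; ring.
  rewrite -[RHS]mulN1r -RintegralZl//.
  by apply: eq_Rintegral => x _; rewrite modeN !ImM !ReJ !ImJ; ring.
by apply: complex_eqP; rewrite !(ReM, ImM, ReJ, ImJ) !Re_real !Im_real; ring.
Qed.

(** The series with the multiplied coefficients converges absolutely, so that the
    class from which fourier_mult chooses is not empty. *)
Lemma wiener_coef_bounded f a (m : int -> C) M : (forall k, cabs (m k) <= M) ->
  wiener f a -> wiener (fourier_mult m f) (fun k => m k * a k).
Proof.
move=> hm [hf la fa]; have lma := l1_bounded hm la.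
have [hg gE] : inL2 (fourier_mult m f) /\
    forall k, fourier_coef (fourier_mult m f) k = m k * fourier_coef f k.
  apply: (@xgetPex _ (fun=> 0) [set g | inL2 g /\
    forall k, fourier_coef g k = m k * fourier_coef f k]).
  exists (synth (fun k => m k * a k)); split; first exact: inL2_synth.
  by move=> k; rewrite fourier_coef_synth// fa.
by split => // k; rewrite gE fa.
Qed.

Lemma inL2D f g : inL2 f -> inL2 g -> inL2 (fun x => f x + g x).
Proof.
move=> hf hg; have [fper _ _ _] := hf; have [gper _ _ _] := hg.
have mfg := cmeasurableD (inL2_cmeasurableT hf) (inL2_cmeasurableT hg).
have [mr mi] := mfg.
split => //; first by move=> x; rewrite fper gper.
have i1 := @integrableD _ _ _ mu _ mT _ _ (inL2_sqr_integrable hf) (inL2_sqr_integrable hg).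
have i2 := @integrableZl _ _ _ mu _ mT 2 _ i1.
apply: (@poweR_lty R _ 2^-1).
apply: le_lt_trans (@integrable_lty _ _ _ mu _ mT _ i2); apply: ge0_le_integral => //.
- by move=> x _; rewrite lee_fin sqr_ge0.
- apply/measurable_EFinP; apply: measurable_funX; apply: measurable_cabs.
  exact: cmeasurableS mfg.
- exact: measurable_int i2.
- move=> x _ /=; rewrite -EFinD -EFinM lee_fin.
  have := cabsD (f x) (g x); have := cabs_ge0 (f x + g x).
  have := cabs_ge0 (f x); have := cabs_ge0 (g x).
  have := sqr_ge0 (cabs (f x) - cabs (g x)).
  move: (cabs (f x)) (cabs (g x)) (cabs (f x + g x)) => p q r; nra.
Qed.

Lemma inL2Z z f : inL2 f -> inL2 (fun x => z * f x).
Proof.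
move=> hf; have [fper _ _ _] := hf.
have mf := cmeasurableZ z (inL2_cmeasurableT hf); have [mr mi] := mf.
split => //; first by move=> x; rewrite fper.
have i2 := @integrableZl _ _ _ mu _ mT (cabs z ^+ 2) _ (inL2_sqr_integrable hf).
apply: (@poweR_lty R _ 2^-1).
apply: le_lt_trans (@integrable_lty _ _ _ mu _ mT _ i2); apply: ge0_le_integral => //.
- by move=> x _; rewrite lee_fin sqr_ge0.
- apply/measurable_EFinP; apply: measurable_funX; apply: measurable_cabs.
  exact: cmeasurableS mf.
- exact: measurable_int i2.
- by move=> x _ /=; rewrite -EFinM lee_fin cabsM exprMn.
Qed.

Lemma inL2B f g : inL2 f -> inL2 g -> inL2 (fun x => f x - g x).
Proof.
move=> hf hg; have := inL2D hf (inL2Z (-1) hg).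
by under eq_fun do rewrite mulN1r.
Qed.

Lemma wienerB f g a b : wiener f a -> wiener g b ->
  wiener (fun x => f x - g x) (fun k => a k - b k).
Proof.
move=> [hf la fa] [hg lb gb]; split; [exact: inL2B|exact: l1B|move=> k].
by rewrite fourier_coefB ?fa ?gb//; exact: inL2_cintegrable.
Qed.

Lemma wienerZ z f a : wiener f a -> wiener (fun x => z * f x) (fun k => z * a k).
Proof.
move=> [hf la fa]; split; [exact: inL2Z|exact: l1Z|move=> k].
by rewrite fourier_coefZ ?fa//; exact: inL2_cintegrable.
Qed.

(** Parseval's inequality: the zeroth coefficient of f times its conjugate. *)
Lemma parseval f a M : wiener f a -> 0 <= M -> norm_le test_l2 a M ->
  (L2norm f <= (Num.sqrt (2 * pi) * M)%:E)%E.
Proof.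
move=> wf M0 hM; have [hf la fa] := wf; have pi0 := pi_gt0 R.
have [_ _ /(_ 0) w0] := wiener_mul wf (wiener_conj wf).
apply: L2norm_le; first by rewrite mulr_ge0 ?sqrtr_ge0.
have finn : sqr_int f \is a fin_num.
  by rewrite ge0_fin_numE ?sqr_int_ge0//; have [_ _ _ /L2norm_fin] := hf.
rewrite -(fineK finn) lee_fin exprMn sqr_sqrtr ?mulr_ge0 ?(ltW pi0)//.
have -> : fine (sqr_int f) = 2 * pi * Re (conv a (conj_refl a) 0).
  rewrite -w0 fourier_coefE ReM Re_real Im_real mul0r subr0 mulVKf ?gt_eqF ?mulr_gt0//.
  apply: eq_Rintegral => x _; rewrite oppr0 mode0 mulr1 ReM ReJ ImJ cabs_sqr; ring.
rewrite ler_wpM2l ?mulr_ge0 ?(ltW pi0)//.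
apply: (le_trans (ler_norm _)); apply: (le_trans (normr_Re _)).
rewrite -lee_fin; apply: (le_trans (cabs_csum _)).
apply: le_trans (norm_l2_sqr M0 hM); apply: le_esum => k _.
by rewrite lee_fin cabsM /conj_refl sub0r opprK cabsJ expr2.
Qed.

End WienerAlgebra.

(** * Bochner integrals and the free flow *)

Section Evolution.
Variable R : realType.
Local Notation C := R[i].
Local Notation Re := complex.Re.
Local Notation Im := complex.Im.
Local Notation mu := (@lebesgue_measure R).
Implicit Types (f g : R -> C) (a : int -> C).

Lemma cvge0_le (I : Type) (F : set_system I) (f : I -> \bar R) (e : R) :
  Filter F -> f @ F --> 0%E -> 0 < e -> \forall x \near F, (f x <= e%:E)%E.
Proof.
move=> FF /fine_cvgP[fin lim] e0.
move/cvgrPdist_le: lim => /(_ _ e0).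
move: fin; apply: filterS2 => x fx; rewrite /= sub0r normrN => h.
by rewrite -(fineK fx) lee_fin (le_trans (ler_norm _)).
Qed.

Lemma inL2_sum (I : Type) (s : seq I) (F : I -> R -> C) :
  (forall i, inL2 (F i)) -> inL2 (fun x => \sum_(i <- s) F i x).
Proof.
move=> hF; elim: s => [|i s IH].
  have l10 : l1 (fun=> 0 : C) by rewrite /l1 esum1 ?ltry// => k _; rewrite cabs0.
  have := inL2_synth l10; rewrite (_ : synth _ = fun x => \sum_(i <- [::]) F i x)//.
  apply/funext => x; rewrite big_nil /synth (@csum_finite _ 0).
    by rewrite /psum big_nil.
  by move=> k _; rewrite mul0r.
by under eq_fun do rewrite big_cons; exact: inL2D.
Qed.

Lemma fourier_coef_sum (I : Type) (s : seq I) (F : I -> R -> C) k :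
  (forall i, inL2 (F i)) ->
  fourier_coef (fun x => \sum_(i <- s) F i x) k = \sum_(i <- s) fourier_coef (F i) k.
Proof.
move=> hF; rewrite fourier_coefE.
under eq_cintegral do rewrite mulr_suml.
rewrite cintegral_sum; last 2 first.
- exact: measurable_cell.
- by move=> i; apply: cintegrable_mulmode; exact: inL2_cintegrable.
by rewrite mulr_sumr; apply: eq_bigr => i _; rewrite fourier_coefE.
Qed.

(** A coefficient is a bounded linear functional on L^2, hence commutes with the
    integral. *)
Lemma fourier_coef_bochner (a b : R) F G k M :
  is_bochner_integral a b F G -> (forall r, r \in `[a, b] -> inL2 (F r)) ->
  cmeasurable `[a, b] (fun r => fourier_coef (F r) k) ->
  (forall r, r \in `[a, b] -> cabs (fourier_coef (F r) k) <= M) ->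
  fourier_coef G k = cintegral `[a, b] (fun r => fourier_coef (F r) k).
Proof.
move=> [hG [S [merr cverr cvG]]] hF mF bF.
set D : set R := `[a, b]%classic; have mD : measurable D := measurable_itv _.
have Dfin : (mu D < +oo)%E.
  by rewrite /D lebesgue_measure_itv/=; case: ifP => _; rewrite -?EFinD ltry.
have iF : cintegrable D (fun r => fourier_coef (F r) k).
  exact: bounded_cintegrable bF.
pose c n j := fourier_coef (sf_val (l := S n) j) k.
pose E n r := \sum_(j < sf_size (S n)) ((\1_(sf_set (l := S n) j) r)%:C)%C * c n j.
have L2E n r : inL2 (sf_eval (S n) r).
  by apply: inL2_sum => j; apply: inL2Z; exact: sf_val_L2.
have coefE n r : fourier_coef (sf_eval (S n) r) k = E n r.
  rewrite /sf_eval fourier_coef_sum; last by move=> j; apply: inL2Z; exact: sf_val_L2.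
  by apply: eq_bigr => j _; rewrite fourier_coefZ//; apply: inL2_cintegrable; exact: sf_val_L2.
have m1 n j : measurable_fun D (\1_(sf_set (l := S n) j) : R -> R).
  by apply: measurable_indic; exact: sf_set_measurable.
have iEj n j : cintegrable D (fun r => ((\1_(sf_set (l := S n) j) r)%:C)%C * c n j).
  apply: (@bounded_cintegrable _ D _ (cabs (c n j))) => //.
    apply: cmeasurableM; last exact: cmeasurable_cst.
    by split; [exact: m1|exact: measurable_cst].
  move=> r _; rewrite cabsM cabs_real ler_piMl ?cabs_ge0// indicE.
  by case: (_ \in _); rewrite ?normr1 ?normr0.
have iE n : cintegrable D (E n) by apply: cintegrable_sum.
have intE n : cintegral D (E n) = fourier_coef (sf_integral a b (S n)) k.
  rewrite /sf_integral fourier_coef_sum; last by move=> j; apply: inL2Z; exact: sf_val_L2.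
  rewrite cintegral_sum//; apply: eq_bigr => j _.
  rewrite fourier_coefZ; last by apply: inL2_cintegrable; exact: sf_val_L2.
  rewrite (eq_cintegral (g := fun r => c n j * ((\1_(sf_set (l := S n) j) r)%:C)%C)); last first.
    by move=> r _; rewrite mulrC.
  rewrite cintegralZ//; last first.
    apply: (@bounded_cintegrable _ D _ 1) => //.
      by split; [exact: m1|exact: measurable_cst].
    by move=> r _; rewrite cabs_real indicE; case: (_ \in _); rewrite ?normr1 ?normr0.
  rewrite mulrC; congr (_ * _); apply: complex_eqP; rewrite /cintegral/=.
    by rewrite /Rintegral integral_indic//; exact: sf_set_measurable.
  by rewrite Rintegral_cst// mul0r.
have L2I n : inL2 (sf_integral a b (S n)).
  by apply: inL2_sum => j; apply: inL2Z; exact: sf_val_L2.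
apply/eqP; rewrite -subr_eq0; apply/eqP; apply: cabs_eq0; apply/eqP.
rewrite eq_le cabs_ge0 andbT; apply/ler_addgt0Pr => e e0; rewrite add0r.
have e2 : 0 < e / 2 by rewrite divr_gt0.
have near1 := cvge0_le _ cverr e2; have near2 := cvge0_le _ cvG e2.
have [n [h1 h2]] : exists n, (\int[mu]_(r in D) L2norm (fun x => F r x - sf_eval (S n) r x)%R
      <= (e / 2)%:E)%E /\
    (L2norm (fun x => G x - sf_integral a b (S n) x)%R <= (e / 2)%:E)%E.
  near \oo => n; exists n; split; near: n; [exact: near1|exact: near2].
rewrite (splitr e).
apply: (le_trans (cabs_sumB _ (fourier_coef (sf_integral a b (S n)) k) _)); apply: lerD.
  rewrite -lee_fin; apply: le_trans h2.
  rewrite -fourier_coefB; [|exact: inL2_cintegrable..].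
  by apply: fourier_coef_L2; exact: inL2B.
rewrite -intE -cintegralB//.
apply: (le_trans (cabs_cintegral mD (cintegrableB mD (iE n) iF))).
have iB := integrable_cabs mD (cintegrableB mD (iE n) iF).
rewrite -lee_fin; apply: le_trans h1.
rewrite /Rintegral fineK; last exact: integrable_fin_num iB.
apply: ge0_le_integral => //.
- by move=> r _; rewrite lee_fin cabs_ge0.
- exact: measurable_int iB.
- exact: merr.
- move=> r Dr; rewrite cabs_distC -coefE -fourier_coefB.
  + by apply: fourier_coef_L2; apply: inL2B => //; exact: hF.
  + by apply: inL2_cintegrable; exact: hF.
  + exact: inL2_cintegrable.
Unshelve. all: by end_near. Qed.

Lemma cub_conv (p : int -> C) a : (forall k, cabs (p k) <= 1) -> l1 a ->
  cub p a = conv a (conv a (fun m => p m * conj_refl a m)).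
Proof.
move=> p1 la; apply/funext => k; rewrite trisum_conv//.
by apply: l1_bounded p1 _; exact: l1_conj_refl.
Qed.

Lemma wiener_cubic f a : wiener f a -> wiener (cubic f) (cub (@cst1 R) a).
Proof.
move=> wf; have la := wiener_l1 wf.
rewrite cub_conv//; last exact: cabs_cst1.
have -> : (fun m => cst1 R m * conj_refl a m) = conj_refl a.
  by apply/funext => m; rewrite /cst1 mul1r.
have := wiener_mul wf (wiener_mul wf (wiener_conj wf)).
congr wiener; apply/funext => x; rewrite /cubic mulrCA mulrC; congr (_ * _).
apply: complex_eqP; rewrite ?ReM ?ImM ?ReJ ?ImJ ?Re_real ?Im_real ?cabs_sqr; ring.
Qed.

Lemma half_wave_symbol (t : R) : (fun k : int => cexp ('i%C * ((t * `|k|%:~R)%:C)%C)) = phase t.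
Proof. by apply/funext => k; rewrite cexp_i. Qed.

Lemma wiener_half_wave t f a : wiener f a -> wiener (half_wave_group t f) (twist t a).
Proof.
move=> wf; rewrite /half_wave_group half_wave_symbol.
exact: wiener_coef_bounded (cabs_phase_le1 t) wf.
Qed.

Lemma Hnorm_Hbound f (r : R) : 0 <= r -> (Hnorm (3%:R / 4%:R) f <= r%:E)%E ->
  Hbound (fourier_coef f) r.
Proof.
move=> r0; rewrite /Hnorm /Hbound.
rewrite (@eq_esum _ _ _ _ (fun k =>
    (root_bracket R k ^+ 3 * cabs (fourier_coef f k) ^+ 2)%:E)); last first.
  by move=> k _; rewrite root_bracket3.
set S := (\esum_ k _)%E => h.
have S0 : (0 <= S)%E.
  by apply: esum_ge0 => k _; rewrite lee_fin mulr_ge0 ?exprn_ge0 ?root_bracket_ge0 ?cabs_ge0.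
have Sfin : S \is a fin_num.
  rewrite ge0_fin_numE//; apply: (@lty_poweRy R _ 2^-1); first by rewrite invr_eq0 pnatr_eq0.
  by rewrite (le_lt_trans h)// ltry.
move: h; rewrite -(fineK Sfin) poweR_EFin !lee_fin powR12_sqrt ?fine_ge0// => h.
by rewrite -(sqr_sqrtr (fine_ge0 S0)) ler_pXn2r ?nnegrE ?sqrtr_ge0.
Qed.

Lemma HboundD a b (K L : R) : 0 <= K -> 0 <= L -> Hbound a K -> Hbound b L ->
  Hbound (fun k => a k + b k) (2 * (K + L)).
Proof.
move=> K0 L0 ha hb.
have w0 k := exprn_ge0 3 (root_bracket_ge0 R k).
apply: (@le_trans _ _ (\esum_ k (2%:E * (root_bracket R k ^+ 3 * cabs (a k) ^+ 2)%:E +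
    2%:E * (root_bracket R k ^+ 3 * cabs (b k) ^+ 2)%:E))%E).
  apply: le_esum => k _; rewrite -!EFinM -EFinD lee_fin.
  rewrite [2 * _]mulrCA [2 * (_ * cabs (b k) ^+ 2)]mulrCA -mulrDr ler_wpM2l//.
  have := cabsD (a k) (b k); have := cabs_ge0 (a k + b k).
  have := cabs_ge0 (a k); have := cabs_ge0 (b k).
  have := sqr_ge0 (cabs (a k) - cabs (b k)).
  move: (cabs (a k)) (cabs (b k)) (cabs (a k + b k)) => p q r; nra.
rewrite esumD; last 2 first.
- by move=> k _; rewrite -EFinM lee_fin mulr_ge0// mulr_ge0 ?w0 ?sqr_ge0.
- by move=> k _; rewrite -EFinM lee_fin mulr_ge0// mulr_ge0 ?w0 ?sqr_ge0.
rewrite !esumZl//; try by move=> k; rewrite lee_fin mulr_ge0 ?w0 ?sqr_ge0.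
apply: (@le_trans _ _ (2%:E * (K ^+ 2)%:E + 2%:E * (L ^+ 2)%:E)%E).
  by apply: leeD; apply: lee_wpmul2l.
rewrite -!EFinM -EFinD lee_fin; nra.
Qed.

End Evolution.

(** * Fourier coefficients of mild solutions *)

Section MildSolution.
Variable R : realType.
Local Notation C := R[i].
Local Notation Re := complex.Re.
Local Notation Im := complex.Im.
Local Notation mu := (@lebesgue_measure R).

Variables (b : bool) (T : R) (u0 : R -> C) (u : R -> R -> C).
Hypotheses (hT : 0 < T) (hu0 : inH (3%:R / 4%:R) u0).
Hypotheses (hu : continuous_in_H (3%:R / 4%:R) T u) (hmild : mild_solution b T u0 u).

Definition ucoef (t : R) : int -> C := fourier_coef (u t).

Lemma inH_Hbound (f : R -> C) : inH (3%:R / 4%:R) f -> exists2 K : R, 0 <= K &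
  Hbound (fourier_coef f) K.
Proof.
move=> [_ fin]; have h0 : (0 <= Hnorm (3%:R / 4%:R) f)%E by exact: poweR_ge0.
exists (fine (Hnorm (3%:R / 4%:R) f)); first exact: fine_ge0.
by apply: Hnorm_Hbound; [exact: fine_ge0|rewrite fineK// ge0_fin_numE].
Qed.

Lemma HboundW (a : int -> C) (K L : R) : 0 <= K -> K <= L -> Hbound a K -> Hbound a L.
Proof.
move=> K0 KL; rewrite /Hbound => h; apply: (le_trans h); rewrite lee_fin.
by rewrite ler_pXn2r ?nnegrE// (le_trans K0).
Qed.

Lemma inH_wiener (f : R -> C) : inH (3%:R / 4%:R) f -> wiener f (fourier_coef f).
Proof.
move=> hf; have [K K0 hK] := inH_Hbound hf; have [f2 _] := hf.
by split => //; exact: norm_l1_l1 (Hbound_norm_l1 K0 hK).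
Qed.

Lemma u_wiener t : t \in `[0, T] -> wiener (u t) (ucoef t).
Proof. by move=> /hu[ht _]; exact: inH_wiener. Qed.

Lemma ucoef_near t (e : R) : t \in `[0, T] -> 0 < e ->
  \forall r \near t, r \in `[0, T] ->
    Hbound (fun k => ucoef r k - ucoef t k) e.
Proof.
move=> tT e0; have [_ cv] := hu tT.
have wt := u_wiener tT.
have FW : Filter (within `[0, T]%classic (nbhs t)) by exact: within_filter.
have near_r := cvge0_le FW cv e0; rewrite near_withinE in near_r.
apply: filterS near_r => r h rT.
have := Hnorm_Hbound (ltW e0) (h rT).
rewrite /Hbound; apply: le_trans; apply: le_esum => k _.
rewrite fourier_coefB//; last exact: wiener_cintegrable wt.
exact: wiener_cintegrable (u_wiener rT).
Qed.

(** Continuity gives a bound near each time, and compactness of [0, T] makes it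
    uniform. *)
Lemma ucoef_bounded : exists2 K : R, 0 <= K &
  forall t, t \in `[0, T] -> Hbound (ucoef t) K.
Proof.
have cov := (@compact_near_coveringP R `[0, T]%classic).1 (@segment_compact R 0 T).
have loc t : `[0, T]%classic t ->
    \forall r \near t & n \near \oo, r \in `[0, T] -> Hbound (ucoef r) n%:R.
  move=> /= tT; have [K K0 hK] := inH_Hbound (hu tT).1.
  exists ([set r | r \in `[0, T] -> Hbound (fun k => ucoef r k - ucoef t k) 1],
          [set n | 2 * (1 + K) <= n%:R]).
    split => /=; first exact: ucoef_near.
    exact: nbhs_infty_ger.
  move=> [r n] /= [h1 h2] rT; apply: (@HboundW _ (2 * (1 + K))) => //.
    by rewrite mulr_ge0// addr_ge0.
  have := HboundD ler01 K0 (h1 rT) hK.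
  by under eq_fun do rewrite subrK.
have [N _ hN] := cov nat \oo (fun n r => r \in `[0, T] -> Hbound (ucoef r) n%:R) _ loc.
exists N%:R => // t tT; exact: (hN N (leqnn _) t tT tT).
Qed.

Lemma norm_le_pointwise (a : int -> C) (M : R) k : norm_le test_l1 a M -> cabs (a k) <= M.
Proof.
move=> /norm_l1P h; rewrite -lee_fin; apply: le_trans h.
exact: (le_esum_term (fun k => (cabs (a k))%:E)).
Qed.

Lemma cmeasurable_continuous (D : set R) (f : R -> C) : measurable D ->
  (forall t e, D t -> 0 < e -> \forall r \near t, D r -> cabs (f r - f t) <= e) ->
  cmeasurable D f.
Proof.
move=> mD cf; split; apply: subspace_continuous_measurable_fun => //;
  apply/subspace_continuousP => t Dt; apply/cvgrPdist_le => e e0;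
  rewrite near_withinE; have := cf t e Dt e0; apply: filterS => r h Dr;
  apply: le_trans (h Dr); rewrite distrC.
- by rewrite -ReB normr_Re.
- by rewrite -ImB normr_Im.
Qed.

Definition source (t : R) : int -> C := cub (@cst1 R) (ucoef t).

Lemma cmeasurable_source k : cmeasurable `[0, T] (fun t => source t k).
Proof.
have [K K0 hK] := ucoef_bounded.
have hM t : t \in `[0, T] -> norm_le test_l1 (ucoef t) (3 * K).
  by move=> tT; exact: Hbound_norm_l1 (hK _ tT).
apply: cmeasurable_continuous => // t e tT e0.
pose d := e / (3 * (3 * K) ^+ 2 + 1) / 3.
have c0 : 0 < 3 * (3 * K) ^+ 2 + 1 by rewrite ltr_wpDl// mulr_ge0// sqr_ge0.
have d0 : 0 < d by rewrite !divr_gt0.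
have := ucoef_near tT d0; apply: filterS => r h rT.
have M0 : 0 <= 3 * K by rewrite mulr_ge0.
have d3 : 0 <= 3 * d by rewrite mulr_ge0// ltW.
have := cub_lip test_class_l1 (@cabs_cst1 R) M0 d3 (hM r rT) (hM t tT)
  (Hbound_norm_l1 (ltW d0) (h rT)).
move=> /(norm_le_pointwise k) hle; apply: (le_trans hle).
have -> : 3 * d = e / (3 * (3 * K) ^+ 2 + 1) by rewrite /d mulrC divfK.
rewrite mulrA ler_pdivrMr// mulrC ler_wpM2l ?(ltW e0)//.
by rewrite lerDl.
Qed.

Lemma source_bounded : exists2 M : R, 0 <= M &
  forall t, t \in `[0, T] -> norm_le test_l1 (source t) M.
Proof.
have [K K0 hK] := ucoef_bounded; exists ((3 * K) ^+ 3); first by rewrite exprn_ge0 ?mulr_ge0.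
move=> t tT; apply: cub_bound; [exact: cabs_cst1|by rewrite mulr_ge0|].
exact: Hbound_norm_l1 (hK _ tT).
Qed.

Lemma cmeasurable_phase (D : set R) (c : R) k :
  cmeasurable D (fun t => phase (c - t) k).
Proof.
apply: (@cmeasurableS _ _ setT) => //.
have mc : measurable_fun setT (fun t : R => (c - t) * freq R k).
  by apply: measurable_funM => //; apply: measurable_funB.
split.
  apply: (@measurableT_comp _ _ _ _ _ _ (@cos R)) mc.
  by apply: continuous_measurable_fun; exact: continuous_cos.
apply: (@measurableT_comp _ _ _ _ _ _ (@sin R)) mc.
by apply: continuous_measurable_fun; exact: continuous_sin.
Qed.

Lemma cintegrable_source (D : set R) c k : measurable D -> D `<=` `[0, T]%classic ->
  cintegrable D (fun t => phase (c - t) k * source t k).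
Proof.
move=> mD DT; have [M M0 hM] := source_bounded.
apply: (@bounded_cintegrable _ D _ M) => //.
- apply: (@le_lt_trans _ _ (mu `[0, T]%classic)); first by apply: le_measure => //; apply/mem_set => //; exact: measurable_itv.
  by rewrite lebesgue_measure_itv/=; case: ifP => _; rewrite -?EFinD ltry.
- apply: cmeasurableM; first exact: cmeasurable_phase.
  by apply: (cmeasurableS _ DT) => //; exact: cmeasurable_source.
- move=> t /DT tT; rewrite cabsM cabs_phase mul1r.
  exact: norm_le_pointwise (hM _ tT).
Qed.

Definition coupling : C := (-1) ^+ b * 'i%C.

Lemma cabs_coupling : cabs coupling = 1.
Proof. by rewrite cabsM cabs_sign cabs_i mulr1. Qed.

(** Coefficients commute with the Bochner integral and do not see null sets. *)
Lemma ucoef_duhamel0 t k : t \in `[0, T] ->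
  ucoef t k = phase t k * fourier_coef u0 k -
    coupling * cintegral `[0, t] (fun xi => phase (t - xi) k * source xi k).
Proof.
move=> tT; have [G hG Gae] := hmild tT.
have sub xi : xi \in `[0, t] -> xi \in `[0, T].
  move: tT; rewrite !in_itv/= => /andP[_ tT] /andP[-> h]/=; exact: le_trans h tT.
have wF xi : xi \in `[0, t] ->
    wiener (half_wave_group (t - xi) (cubic (u xi))) (twist (t - xi) (source xi)).
  by move=> /sub/u_wiener wx; apply: wiener_half_wave; exact: wiener_cubic.
have coefF xi : xi \in `[0, t] ->
    fourier_coef (half_wave_group (t - xi) (cubic (u xi))) k =
    phase (t - xi) k * source xi k.
  by move=> /wF[_ _ ->].
have [M M0 hM] := source_bounded.
have DT : `[0, t]%classic `<=` `[0, T]%classic by move=> xi; exact: sub.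
have mp := cintegrable_cmeasurable (cintegrable_source t k (measurable_itv _) DT).
have L2G : inL2 G by case: hG.
have w0 := wiener_half_wave t (inH_wiener hu0).
have coefG : fourier_coef G k =
    cintegral `[0, t] (fun xi => phase (t - xi) k * source xi k).
  rewrite (fourier_coef_bochner (M := M) (k := k) hG).
  - by apply: eq_cintegral => xi; exact: coefF.
  - by move=> xi /wF/wiener_inL2.
  - split; [have [h _] := mp|have [_ h] := mp]; apply: eq_measurable_fun h => xi xiD;
      by rewrite coefF//; exact: set_mem.
  - move=> xi xit; rewrite coefF// cabsM cabs_phase mul1r.
    exact: norm_le_pointwise (hM _ (sub _ xit)).
have L2r : inL2 (fun x => half_wave_group t u0 x - coupling * G x).
  by apply: inL2B; [exact: wiener_inL2 w0|exact: inL2Z].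
have mT x : cmeasurable setT x -> cmeasurable (@period_cell R) x.
  by move=> h; apply: (@cmeasurableS _ _ setT) => //; exact: measurable_cell.
rewrite /ucoef (ae_eq_fourier_coef k _ _ Gae).
- rewrite fourier_coefB; last 2 first.
  + exact: wiener_cintegrable w0.
  + by apply: inL2_cintegrable; exact: inL2Z.
  rewrite -/coupling fourier_coefZ; last exact: inL2_cintegrable.
  by rewrite coefG; have [_ _ ->] := w0.
- by apply: inL2_cmeasurable; exact: wiener_inL2 (u_wiener tT).
- exact: inL2_cmeasurable.
Qed.

Lemma cintegral_split (f : R -> C) (s t : R) : 0 <= s -> s <= t ->
  cintegrable `[0, t] f ->
  cintegral `[0, t] f - cintegral `[0, s] f = cintegral `]s, t] f.
Proof.
move=> s0 st [fr fi]; apply: complex_eqP; rewrite ?ReB ?ImB /cintegral/=.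
  by rewrite Rintegral_itvB ?bnd_simp.
by rewrite Rintegral_itvB ?bnd_simp.
Qed.

(** The mild formulations at t and t + tau have the integral over [0, t] in common;
    subtracting it leaves a half-open interval. *)
Lemma ucoef_duhamel t tau k : 0 <= t -> 0 <= tau -> t + tau <= T ->
  ucoef (t + tau) k = phase tau k * (ucoef t k -
    coupling * cintegral `]t, t + tau] (fun xi => phase (t - xi) k * source xi k)).
Proof.
move=> t0 tau0 tT.
have t1 : t \in `[0, T] by rewrite in_itv/= t0/=; lra.
have t2 : t + tau \in `[0, T] by rewrite in_itv/= tT andbT addr_ge0.
have sub1 : `[0, t]%classic `<=` `[0, T]%classic.
  by move=> xi /=; rewrite !in_itv/= => /andP[-> h]/=; lra.
have sub2 : `[0, t + tau]%classic `<=` `[0, T]%classic.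
  by move=> xi /=; rewrite !in_itv/= => /andP[-> h]/=; lra.
have sub3 : `]t, t + tau]%classic `<=` `[0, T]%classic.
  by move=> xi /=; rewrite !in_itv/= => /andP[h h']; apply/andP; split; lra.
have pull (D : set R) : measurable D -> D `<=` `[0, T]%classic ->
    cintegral D (fun xi => phase (t + tau - xi) k * source xi k) =
    phase tau k * cintegral D (fun xi => phase (t - xi) k * source xi k).
  move=> mD DT; rewrite -cintegralZ//; last exact: cintegrable_source.
  by apply: eq_cintegral => xi _; rewrite mulrA -phaseD; congr (phase _ k * _); ring.
pose f xi := phase (t + tau - xi) k * source xi k.
have split_f : cintegral `[0, t + tau] f = cintegral `[0, t] f + cintegral `]t, t + tau] f.
  rewrite -cintegral_split ?lerDl//; first by rewrite [RHS]addrC subrK.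
  exact: cintegrable_source.
rewrite !ucoef_duhamel0// -/f split_f !pull//.
by rewrite [t + tau]addrC phaseD; ring.
Qed.

End MildSolution.

(** * The filter function *)

Section FilterFunction.
Variable R : realType.
Local Notation C := R[i].
Local Notation Re := complex.Re.
Local Notation Im := complex.Im.
Local Notation mu := (@lebesgue_measure R).

Definition phi_symbol (tau : R) (k : int) : C :=
  phi1 (- 2%:R * 'i%C * ((tau * `|k|%:~R)%:C)%C).

Lemma itvoc_measure (t tau : R) : 0 < tau -> fine (mu `]t, t + tau]%classic) = tau.
Proof.
move=> tau0; rewrite lebesgue_measure_itv/= lte_fin ltrDl tau0/=.
by rewrite addrC addKr.
Qed.

Lemma itvoc_finite (t s : R) : (mu `]t, s]%classic < +oo)%E.
Proof. by rewrite lebesgue_measure_itv/=; case: ifP => _; rewrite -?EFinD ltry. Qed.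

Lemma continuous_affine (t c : R) (g : R -> R) : continuous g ->
  continuous (fun x => g (c * (x - t))).
Proof.
move=> cg x; apply: (@continuous_comp _ _ _ (fun x => c * (x - t)) g); last exact: cg.
by apply: cvgM; [exact: cvg_cst|apply: cvgB; [exact: cvg_id|exact: cvg_cst]].
Qed.

(** This is the reason for the filter function: the scheme integrates the phase of
    the conjugate factor exactly over a step. *)
Lemma phi_symbol_mean (t tau : R) k : 0 < tau ->
  cintegral `]t, t + tau] (fun xi => phase (- (2 * (xi - t))) k) =
  (tau%:C)%C * phi_symbol tau k.
Proof.
move=> tau0; have ttau : t < t + tau by rewrite ltrDl.
set f := freq R k.
have -> : phi_symbol tau k = phi1 ('i%C * ((- (2 * f) * tau)%:C)%C).
  rewrite /phi_symbol -/(freq R k) -/f; congr phi1.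
  apply: complex_eqP; rewrite !(ReM, ImM, ReN, ImN) /=; ring.
have mfin (g : R -> R) : continuous g ->
    mu.-integrable `]t, t + tau] (EFin \o g).
  move=> cg; apply: (@integrableS _ _ _ mu `[t, t + tau]) => //.
    exact: subset_itv_oc_cc.
  apply: continuous_compact_integrable; first exact: segment_compact.
  exact: continuous_subspaceT.
have cRe : continuous (fun xi => cos (- (2 * f) * (xi - t))).
  by apply: continuous_affine; exact: continuous_cos.
have cIm : continuous (fun xi => sin (- (2 * f) * (xi - t))).
  by apply: continuous_affine; exact: continuous_sin.
have -> : cintegral `]t, t + tau] (fun xi => phase (- (2 * (xi - t))) k) =
  ((\int[mu]_(xi in `[t, t + tau]) cos (- (2 * f) * (xi - t))) +i*
   (\int[mu]_(xi in `[t, t + tau]) sin (- (2 * f) * (xi - t))))%C.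
  have e xi : - (2 * (xi - t)) * f = - (2 * f) * (xi - t) by ring.
  apply: complex_eqP; rewrite /cintegral/=.
    rewrite -Rintegral_itv_obnd_cbnd; last exact: mfin.
    by apply: eq_Rintegral => xi _; rewrite -e.
  rewrite -Rintegral_itv_obnd_cbnd; last exact: mfin.
  by apply: eq_Rintegral => xi _; rewrite -e.
set c := - (2 * f) in cRe cIm *.
have [c0|c0] := eqVneq c 0.
  rewrite c0 mul0r /phi1 mulr0 eqxx mulr1.
  have d1 (x : R) : is_derive x (1 : R) (fun x => x) (1 : R) by exact: is_derive_id.
  apply: complex_eqP => /=.
    under eq_Rintegral do rewrite mul0r cos0.
    rewrite (Rintegral_derive ttau _ d1); last exact: cst_continuous.
    by rewrite addrC addKr.
  by under eq_Rintegral do rewrite mul0r sin0; rewrite Rintegral_cst// mul0r.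
have dsin (x : R) : is_derive x (1 : R) (fun x => c^-1 * sin (c * (x - t)))
    (cos (c * (x - t))).
  apply: is_derive_eq.
  rewrite /GRing.scale/=; by field.
have dcos (x : R) : is_derive x (1 : R) (fun x => - (c^-1 * cos (c * (x - t))))
    (sin (c * (x - t))).
  apply: is_derive_eq.
  rewrite /GRing.scale/=; by field.
rewrite (Rintegral_derive ttau cRe dsin) (Rintegral_derive ttau cIm dcos).
have ct : ((c * tau)%:C)%C != 0 :> C.
  by rewrite eq_complex/= mulf_eq0 (negbTE c0) gt_eqF.
have z0 : 'i%C * ((c * tau)%:C)%C != 0 :> C.
  by rewrite mulf_neq0// eq_complex/= oner_eq0 andbF.
rewrite /phi1 (negbTE z0) cexp_i.
have iV : ('i%C * ((c * tau)%:C)%C)^-1 = - 'i%C * (((c * tau)^-1)%:C)%C :> C.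
  apply: (mulfI z0); rewrite mulfV//.
  have -> : 'i%C * ((c * tau)%:C)%C * (- 'i%C * (((c * tau)^-1)%:C)%C) =
     - ('i%C ^+ 2) * (((c * tau) * (c * tau)^-1)%:C)%C :> C by rewrite rmorphM; ring.
  by rewrite sqr_i opprK mul1r mulfV ?rmorph1// mulf_neq0// gt_eqF.
rewrite iV; have -> : t + tau - t = tau by rewrite addrC addKr.
have tn : tau != 0 by rewrite gt_eqF.
apply: complex_eqP; rewrite !(ReM, ImM, ReB, ImB, ReN, ImN) /= subrr mulr0 ?sin0 ?cos0.
  by field; rewrite c0 tn.
by field; rewrite c0 tn.
Qed.

Lemma cabs_phi_symbol (tau : R) k : 0 < tau -> cabs (phi_symbol tau k) <= 1.
Proof.
move=> tau0; rewrite -(ler_pM2l tau0) mulr1.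
have -> : tau * cabs (phi_symbol tau k) =
    cabs (cintegral `]0, 0 + tau] (fun xi => phase (- (2 * (xi - 0))) k)).
  by rewrite phi_symbol_mean// cabsM cabs_real ger0_norm// ltW.
rewrite -{2}(itvoc_measure 0 tau0) -[leRHS]mul1r.
apply: cabs_cintegral_le => //; first exact: itvoc_finite.
  apply: (@bounded_cintegrable _ _ _ 1) => //; first exact: itvoc_finite.
    have := @cmeasurableM R `]0, 0 + tau]%classic _ _
      (cmeasurable_phase _ 0 k) (cmeasurable_phase _ 0 k).
    congr cmeasurable; apply/funext => xi; rewrite -phaseD; congr (phase _ k); ring.
  by move=> xi _; rewrite cabs_phase.
by move=> xi _; rewrite cabs_phase.
Qed.

End FilterFunction.

(** * Local and global error *)

Section ErrorAnalysis.
Variable R : realType.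
Local Notation C := R[i].
Local Notation mu := (@lebesgue_measure R).

Section TimeIntegrals.
Variables (D : set R) (mD : measurable D) (Dfin : (mu D < +oo)%E).

Lemma conv_bound (a b : int -> C) (M B : R) k : 0 <= B -> norm_le test_l1 a M ->
  (forall m, cabs (b m) <= B) -> cabs (conv a b k) <= M * B.
Proof.
move=> B0 /norm_l1P ha hb; rewrite -lee_fin; apply: (le_trans (cabs_csum _)).
apply: (@le_trans _ _ (\esum_ j ((cabs (a j))%:E * B%:E))%E).
  by apply: le_esum => j _; rewrite -EFinM lee_fin cabsM ler_wpM2l ?cabs_ge0.
rewrite esumZr ?lee_fin//; last by move=> j; rewrite lee_fin cabs_ge0.
by rewrite EFinM lee_wpmul2r ?lee_fin.
Qed.

Lemma conv_cintegral (a : int -> C) (b : R -> int -> C) (B : R) k : 0 <= B -> l1 a ->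
  (forall m, cmeasurable D (b ^~ m)) ->
  (forall xi m, D xi -> cabs (b xi m) <= B) ->
  cmeasurable D (fun xi => conv a (b xi) k) /\
  cintegral D (fun xi => conv a (b xi) k) =
    conv a (fun m => cintegral D (b ^~ m)) k.
Proof.
move=> B0 la mb bB.
have dom j xi : D xi -> cabs (a j * b xi (k - j)) <= cabs ((B%:C)%C * a j).
  move=> Dxi; rewrite !cabsM cabs_real ger0_norm// mulrC ler_wpM2r ?cabs_ge0//.
  exact: bB.
have mj j : cmeasurable D (fun xi => a j * b xi (k - j)) by exact: cmeasurableZ.
have lB : l1 (fun j => (B%:C)%C * a j) by exact: l1Z.
split.
  apply: (@cmeasurable_csum _ D (fun j xi => a j * b xi (k - j))) => //.
  by move=> xi Dxi; apply: l1_le lB => j; exact: dom.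
rewrite (@cintegral_csum _ D mD (fun j xi => a j * b xi (k - j))
  (fun j => (B%:C)%C * a j))//.
congr csum; apply/funext => j; rewrite cintegralZ//.
by apply: (@bounded_cintegrable _ D _ B) => // xi; exact: bB.
Qed.

Lemma cub_cintegral (a : int -> C) (p : R -> int -> C) k : l1 a ->
  (forall m, cmeasurable D (p ^~ m)) -> (forall xi m, cabs (p xi m) <= 1) ->
  cintegrable D (fun xi => cub (p xi) a k) /\
  cintegral D (fun xi => cub (p xi) a k) =
    conv a (conv a (fun m => cintegral D (p ^~ m) * conj_refl a m)) k.
Proof.
move=> la mp p1; have [M M0 hM] := l1_norm la.
have lJ := l1_conj_refl la.
have Jb m : cabs (conj_refl a m) <= M.
  by rewrite /conj_refl cabsJ; exact: norm_le_pointwise hM.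
have cE xi : cub (p xi) a k = conv a (conv a (fun m => p xi m * conj_refl a m)) k.
  by rewrite cub_conv.
have pm m : cmeasurable D (fun xi => p xi m * conj_refl a m).
  by apply: cmeasurableM => //; exact: cmeasurable_cst.
have pB xi m : cabs (p xi m * conj_refl a m) <= M.
  by rewrite cabsM (le_trans _ (Jb m))// ler_piMl ?cabs_ge0.
have in1 m := conv_cintegral m M0 la pm (fun xi m _ => pB xi m).
have MM0 : 0 <= M * M by rewrite mulr_ge0.
have in2 : forall xi m, D xi -> cabs (conv a (fun m => p xi m * conj_refl a m) m) <= M * M.
  by move=> xi m _; exact: conv_bound.
have [mout iout] := conv_cintegral k MM0 la (fun m => (in1 m).1) in2.
split.
  apply: (@bounded_cintegrable _ D _ (M * (M * M))) => //.
    by rewrite (_ : (fun xi => _) = fun xi => conv a (conv a (fun m => p xi m * conj_refl a m)) k)//;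
      apply/funext.
  by move=> xi Dxi; rewrite cE; apply: conv_bound => // m; exact: in2 Dxi.
rewrite (eq_cintegral (g := fun xi => conv a (conv a (fun m => p xi m * conj_refl a m)) k))//.
rewrite iout; congr (conv a _ k); apply/funext => m; rewrite (in1 m).2.
congr (conv a _ m); apply/funext => j; rewrite mulrC -cintegralZ//.
  by apply: eq_cintegral => xi _; rewrite mulrC.
by apply: (@bounded_cintegrable _ D _ 1).
Qed.

End TimeIntegrals.

(** One step of the scheme, on Fourier coefficients. *)
Definition step (z : C) (tau : R) (a : int -> C) (k : int) : C :=
  phase tau k * (a k - z * (tau%:C)%C * cub (phi_symbol tau) a k).

Section Stability.
Variables (z : C) (hz : cabs z = 1) (tau : R) (tau0 : 0 < tau).

Let p1 k : cabs (phi_symbol tau k) <= 1. Proof. exact: cabs_phi_symbol. Qed.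

Lemma cabs_ztau : cabs (z * (tau%:C)%C) = tau.
Proof. by rewrite cabsM hz mul1r cabs_real ger0_norm// ltW. Qed.

Lemma step_lip H (tH : test_class H) (a b : int -> C) (M d : R) : 0 <= M -> 0 <= d ->
  norm_le test_l1 a M -> norm_le test_l1 b M -> norm_le H (fun k => a k - b k) d ->
  norm_le H (fun k => step z tau a k - step z tau b k) ((1 + 3 * M ^+ 2 * tau) * d).
Proof.
move=> M0 d0 ha hb hab.
have hc := norm_leZ tH (z * (tau%:C)%C) (cub_lip tH p1 M0 d0 ha hb hab).
rewrite cabs_ztau in hc.
have -> : (1 + 3 * M ^+ 2 * tau) * d = d + tau * (3 * M ^+ 2 * d) by ring.
apply: (norm_leD_dom tH _ hab hc) => k.
have -> : step z tau a k - step z tau b k = phase tau k * ((a k - b k) -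
    z * (tau%:C)%C * (cub (phi_symbol tau) a k - cub (phi_symbol tau) b k)).
  by rewrite /step; move: (cub _ a k) (cub _ b k) => q r; ring.
rewrite cabsM cabs_phase mul1r; exact: cabsB.
Qed.

Lemma step_bound (a : int -> C) M : 0 <= M -> norm_le test_l1 a M ->
  norm_le test_l1 (step z tau a) (M + tau * M ^+ 3).
Proof.
move=> M0 ha; have tH := @test_class_l1 R.
have hc := norm_leZ tH (z * (tau%:C)%C) (cub_bound p1 M0 ha).
rewrite cabs_ztau in hc.
by apply: (norm_leD_dom tH _ ha hc) => k; rewrite /step cabsM cabs_phase mul1r; exact: cabsB.
Qed.

End Stability.

Section Convergence.
Variables (z : C) (T K : R) (al : R -> int -> C).
Hypotheses (hz : cabs z = 1) (T0 : 0 < T) (K0 : 0 <= K).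
Hypothesis alK : forall t, t \in `[0, T] -> Hbound (al t) K.
Hypothesis al_source : forall c k (D : set R), measurable D -> D `<=` `[0, T]%classic ->
  cintegrable D (fun t => phase (c - t) k * cub (@cst1 R) (al t) k).
Hypothesis al_duhamel : forall t tau k, 0 <= t -> 0 <= tau -> t + tau <= T ->
  al (t + tau) k = phase tau k * (al t k - z *
    cintegral `]t, t + tau] (fun xi => phase (t - xi) k * cub (@cst1 R) (al xi) k)).

Let M : R := 3 * K.
Let M0 : 0 <= M. Proof. by rewrite mulr_ge0. Qed.
Let alM t : t \in `[0, T] -> norm_le test_l1 (al t) M.
Proof. by move=> tT; exact: Hbound_norm_l1 (alK tT). Qed.

Let sub_itv t s : 0 <= t -> s <= T -> `]t, s]%classic `<=` `[0, T]%classic.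
Proof.
by move=> t0 sT xi /=; rewrite !in_itv/= => /andP[h1 h2]; apply/andP; split; lra.
Qed.

(** By Duhamel's formula the difference is the integral of a source that is bounded
    in l^1. *)
Lemma free_flow_error t s : 0 <= t -> 0 < s -> t + s <= T ->
  norm_le test_l1 (fun k => al (t + s) k - twist s (al t) k) (M ^+ 3 * s).
Proof.
move=> t0 s0 tT; have tH := @test_class_l1 R.
pose E xi k := phase (t - xi) k * cub (@cst1 R) (al xi) k.
have hI : norm_le test_l1 (fun k => cintegral `]t, t + s] (E ^~ k)) (M ^+ 3 * s).
  rewrite -{2}(itvoc_measure t s0).
  apply: norm_le_cintegral => //; first exact: itvoc_finite.
    by move=> k; apply: al_source => //; exact: sub_itv.
  move=> xi /(sub_itv t0 tT) xiT; apply: norm_le_twist => //.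
  exact: (cub_bound (@cabs_cst1 R) M0 (alM xiT)).
apply: norm_le_dom hI => // k; rewrite al_duhamel ?(ltW s0)// /twist mulrBr addrAC subrr.
by rewrite add0r cabsN !cabsM cabs_phase hz !mul1r.
Qed.

(** Solution and scheme differ by the integral of the difference between the
    nonlinearity and its approximation with a frozen phase.  Passing to the free
    flow first splits it into a Lipschitz increment and the phase defect X. *)
Lemma local_error H (tH : test_class H) (t tau X : R) : 0 <= t -> 0 < tau -> t + tau <= T ->
  (forall s, 0 < s -> s <= tau -> norm_le H (phase_defect s (al t)) X) ->
  norm_le H (fun k => al (t + tau) k - step z tau (al t) k)
    ((3 * M ^+ 5 * tau + X) * tau).
Proof.
move=> t0 tau0 tT hX; have tH1 := @test_class_l1 R.
have tt : t \in `[0, T] by rewrite in_itv/= t0/=; lra.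
have at1 := alM tt; have la := norm_l1_l1 at1.
pose D := `]t, t + tau]%classic; have mD : measurable D := measurable_itv _.
have Dfin : (mu D < +oo)%E := itvoc_finite _ _.
have DT : D `<=` `[0, T]%classic by exact: sub_itv.
pose p (xi : R) : int -> C := phase (- (2 * (xi - t))).
have mp m : cmeasurable D (p ^~ m).
  have := @cmeasurableM R D _ _ (cmeasurable_phase _ t m) (cmeasurable_phase _ t m).
  by congr cmeasurable; apply/funext => xi; rewrite -phaseD; congr (phase _ m); ring.
have p1 xi m : cabs (p xi m) <= 1 by exact: cabs_phase_le1.
have cubI k := cub_cintegral mD Dfin k la mp p1.
have cubE k : cintegral D (fun xi => cub (p xi) (al t) k) =
    (tau%:C)%C * cub (phi_symbol tau) (al t) k.
  have q1 m : cabs (phi_symbol tau m) <= 1 by exact: cabs_phi_symbol.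
  have lq := l1_bounded q1 (l1_conj_refl la).
  rewrite (cubI k).2 cub_conv//.
  rewrite /conv -csumZ.
    congr csum; apply/funext => j; rewrite mulrCA; congr (_ * _).
    rewrite -csumZ; last exact: (conv_l1 (k - j) la lq).
    congr csum; apply/funext => l; rewrite phi_symbol_mean//; ring.
  exact: (conv_l1 k la (l1_conv la lq)).
pose E xi k := phase (t - xi) k * cub (@cst1 R) (al xi) k - cub (p xi) (al t) k.
have iE k : cintegrable D (E ^~ k).
  by apply: cintegrableB => //; [exact: al_source|exact: (cubI k).1].
have hE xi : D xi -> norm_le H (E xi) (3 * M ^+ 5 * tau + X).
  move=> Dxi; have xiT := DT _ Dxi; move: Dxi; rewrite /D/= in_itv/= => /andP[x1 x2].
  set s := xi - t; have s0 : 0 < s by rewrite subr_gt0.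
  have stau : s <= tau by rewrite lerBlDl.
  have xE : xi = t + s by rewrite /s addrC subrK.
  have tsT : t + s <= T by rewrite -xE; move: xiT; rewrite /= in_itv/= => /andP[].
  have ff := free_flow_error t0 s0 tsT; rewrite -xE in ff.
  have lip := cub_lip tH (@cabs_cst1 R) M0 (mulr_ge0 (exprn_ge0 3 M0) (ltW s0))
    (alM xiT) (norm_le_twist tH1 s at1) (norm_le_l1 tH ff).
  have lip' : norm_le H (fun k => cub (@cst1 R) (al xi) k - cub (@cst1 R) (twist s (al t)) k)
      (3 * M ^+ 5 * tau).
    apply: norm_le_mono lip.
    have -> : 3 * M ^+ 2 * (M ^+ 3 * s) = 3 * M ^+ 5 * s by ring.
    by rewrite ler_wpM2l// mulr_ge0// exprn_ge0.
  apply: (norm_leD_dom tH _ lip' (hX s s0 stau)) => k.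
  have -> : E xi k = phase (- s) k *
      (cub (@cst1 R) (al xi) k - cub (@cst1 R) (twist s (al t)) k) + phase_defect s (al t) k.
    rewrite /E /phase_defect /p /twist -/s; have -> : t - xi = - s by rewrite /s opprB.
    by ring.
  by rewrite (le_trans (cabsD _ _))// lerD2r cabsM cabs_phase mul1r.
have hI := norm_le_cintegral mD tH Dfin iE hE.
rewrite /D itvoc_measure// in hI; apply: norm_le_dom hI => // k.
rewrite al_duhamel ?(ltW tau0)// /step -mulrBr cabsM cabs_phase mul1r.
rewrite cintegralB//; [|exact: al_source|exact: (cubI k).1].
rewrite cubE; set I1 := cintegral _ _; set q := cub _ _ _.
have -> : al t k - z * I1 - (al t k - z * (tau%:C)%C * q) = - (z * (I1 - (tau%:C)%C * q)).
  by ring.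
by rewrite cabsN cabsM hz mul1r.
Qed.

Let C2 : R := 3 * M ^+ 5 + 24 * K ^+ 2 * M.
Let C20 : 0 <= C2.
Proof. by rewrite addr_ge0// !mulr_ge0// exprn_ge0. Qed.

Lemma local_error_l2 t tau : 0 <= t -> 0 < tau -> t + tau <= T ->
  norm_le test_l2 (fun k => al (t + tau) k - step z tau (al t) k) (C2 * tau * tau).
Proof.
move=> t0 tau0 tT; have tt : t \in `[0, T] by rewrite in_itv/= t0/=; lra.
have -> : C2 * tau * tau = (3 * M ^+ 5 * tau + 24 * K ^+ 2 * M * tau) * tau.
  by rewrite /C2; ring.
apply: local_error => //; first exact: test_class_l2.
move=> s s0 st; apply: norm_le_mono (phase_defect_l2 (ltW s0) K0 M0 (alK tt) (alM tt)).
by rewrite ler_wpM2l// !mulr_ge0// exprn_ge0.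
Qed.

(** H^(3/4) leaves no half derivatives to spare in l^1, hence no rate; smallness
    relative to tau is what the bound on the iterates requires. *)
Lemma local_error_l1 (d : R) : 0 < d -> exists2 tau0, 0 < tau0 &
  forall t tau, 0 <= t -> 0 < tau -> tau <= tau0 -> t + tau <= T ->
  norm_le test_l1 (fun k => al (t + tau) k - step z tau (al t) k) (d * tau).
Proof.
move=> d0; pose c := 6 * M ^+ 2 * K; have c0 : 0 <= c by rewrite !mulr_ge0// exprn_ge0.
pose e := d / 2 / (c + 1); have e0 : 0 < e by rewrite !divr_gt0// ltr_wpDl.
have e2 : 0 < e ^+ 2 by rewrite exprn_gt0.
have w0 k : (0 <= (inv_weight R k)%:E)%E by rewrite lee_fin inv_weight_ge0.
have [N hN] := esum_tail w0 (le_lt_trans (inv_weight_summable R) (ltry _)) e2.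
pose c' := 3 * M ^+ 5 + 3 * N%:R * M ^+ 3.
have c'0 : 0 <= c' by rewrite addr_ge0// ?mulr_ge0// exprn_ge0.
exists (d / 2 / (c' + 1)); first by rewrite !divr_gt0// ltr_wpDl.
move=> t tau t0 tau0 tauN tT; have tt : t \in `[0, T] by rewrite in_itv/= t0/=; lra.
have loc := local_error test_class_l1 t0 tau0 tT
  (X := 3 * tau * N%:R * M ^+ 3 + 6 * M ^+ 2 * (e * K)).
apply: norm_le_mono (loc _); last first.
  move=> s s0 st; apply: norm_le_mono
    (phase_defect_l1 (N := N) (ltW s0) K0 M0 (ltW e0) (alK tt) (alM tt) _).
    by rewrite lerD2r ler_wpM2r ?exprn_ge0// ler_wpM2r// ler_wpM2l.
  by apply: le_trans hN; apply: le_esum => k _; case: ifP.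
rewrite ler_wpM2r ?(ltW tau0)//.
have h1 : c' * tau <= d / 2.
  have : (c' + 1) * tau <= d / 2 by rewrite mulrC -ler_pdivlMr// ltr_wpDl.
  by apply: le_trans; rewrite ler_wpM2r ?(ltW tau0)// lerDl.
have h2 : c * e <= d / 2.
  have -> : d / 2 = e * (c + 1) by rewrite /e divfK// gt_eqF// ltr_wpDl.
  by rewrite mulrC ler_wpM2l ?(ltW e0)// lerDl.
have -> : 3 * M ^+ 5 * tau + (3 * tau * N%:R * M ^+ 3 + 6 * M ^+ 2 * (e * K)) =
  c' * tau + c * e by rewrite /c' /c; ring.
lra.
Qed.

Let L : R := 3 * (M + 1) ^+ 2.
Let L0 : 0 <= L. Proof. by rewrite mulr_ge0// sqr_ge0. Qed.
Let M1 : 0 <= M + 1. Proof. by rewrite addr_ge0. Qed.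

Let approx tau n := iter n (step z tau) (al 0).

Let growth n tau : 0 < tau -> n%:R * tau <= T -> (1 + L * tau) ^+ n <= expR (L * T).
Proof.
move=> tau0 nT; have Lt : 0 <= L * tau by rewrite mulr_ge0// ltW.
apply: (@le_trans _ _ (expR (L * tau) ^+ n)).
  by apply: lerXn2r; rewrite ?nnegrE ?addr_ge0 ?expR_ge0// expR_ge1Dx.
rewrite -expRM_natl ler_expR mulrCA ler_wpM2l//.
Qed.

(* The discrete Gronwall inequality, as long as the iterates are bounded by M + 1. *)
Let global_error H (tH : test_class H) tau d n : 0 < tau -> 0 <= d -> n%:R * tau <= T ->
  (forall t, 0 <= t -> t + tau <= T ->
     norm_le H (fun k => al (t + tau) k - step z tau (al t) k) (d * tau)) ->
  (forall j, (j < n)%N -> norm_le test_l1 (approx tau j) (M + 1)) ->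
  norm_le H (fun k => al (n%:R * tau) k - approx tau n k)
    (n%:R * tau * d * (1 + L * tau) ^+ n).
Proof.
move=> tau0 d0 nT hloc; have Lt : 0 <= L * tau by rewrite mulr_ge0// ltW.
elim: n nT => [|n IH] nT hj.
  rewrite !mul0r; apply: (norm_le_dom tH _ (@norm_le0 R H)) => k.
  by rewrite /approx/= subrr.
have nT' : n%:R * tau + tau <= T by move: nT; rewrite -natr1 mulrDl mul1r.
have n0 : 0 <= n%:R * tau by rewrite mulr_ge0// ltW.
have ntT : n%:R * tau <= T by lra.
have IHn := IH ntT (fun j jn => hj j (ltnW jn)).
have nin : n%:R * tau \in `[0, T] by rewrite in_itv/= n0.
have aM : norm_le test_l1 (al (n%:R * tau)) (M + 1).
  by apply: norm_le_mono (alM nin); rewrite lerDl.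
set Q := (1 + L * tau) ^+ n in IHn *.
have Q0 : 0 <= Q by rewrite exprn_ge0// addr_ge0.
have D0 : 0 <= n%:R * tau * d * Q by rewrite !mulr_ge0 ?(ltW tau0).
have st := step_lip hz tau0 tH M1 D0 aM (hj n (ltnSn n)) IHn.
have Q1 : 1 <= Q * (1 + L * tau) by rewrite -exprSr exprn_ege1// lerDl.
have bound : d * tau + (1 + L * tau) * (n%:R * tau * d * Q) <=
    n.+1%:R * tau * d * (1 + L * tau) ^+ n.+1.
  rewrite exprSr -/Q -natr1.
  have -> : (n%:R + 1) * tau * d * (Q * (1 + L * tau)) =
    d * tau * (Q * (1 + L * tau)) + (1 + L * tau) * (n%:R * tau * d * Q) by ring.
  by rewrite lerD2r ler_peMr// mulr_ge0// ltW.
apply: (norm_le_mono bound); apply: (norm_leD_dom tH _ (hloc _ n0 nT') st) => k.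
rewrite /approx iterS -/(approx tau n) -natr1 mulrDl mul1r; exact: cabs_sumB.
Qed.

(* The l^1 error stays below 1, so the iterates stay bounded: this is the
   induction that makes the Lipschitz constant L available. *)
Let approx_bounded : exists2 tau0, 0 < tau0 & forall tau n, 0 < tau -> tau <= tau0 ->
  n%:R * tau <= T -> norm_le test_l1 (approx tau n) (M + 1).
Proof.
pose d := (T * expR (L * T))^-1.
have d0 : 0 < d by rewrite invr_gt0 mulr_gt0// expR_gt0.
have [tau0 tau00 hloc] := local_error_l1 d0.
exists tau0 => // tau n tau1 tau2; elim/ltn_ind: n => n IH nT.
have nin : n%:R * tau \in `[0, T] by rewrite in_itv/= nT mulr_ge0// ltW.
have hj j : (j < n)%N -> norm_le test_l1 (approx tau j) (M + 1).
  move=> jn; apply: IH => //; apply: le_trans nT.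
  by rewrite ler_wpM2r ?(ltW tau1)// ler_nat ltnW.
have ge := global_error test_class_l1 tau1 (ltW d0) nT
  (fun t t0 tT => hloc t tau t0 tau1 tau2 tT) hj.
have le1 : n%:R * tau * d * (1 + L * tau) ^+ n <= 1.
  apply: (@le_trans _ _ (T * d * expR (L * T))).
    apply: ler_pM => //; rewrite ?mulr_ge0 ?(ltW tau1) ?(ltW d0)//.
    - by rewrite exprn_ge0// addr_ge0// mulr_ge0// ltW.
    - by rewrite ler_wpM2r// ltW.
    - exact: growth.
  by rewrite mulrAC /d mulfV// gt_eqF// mulr_gt0// expR_gt0.
have := norm_leB test_class_l1 (alM nin) (norm_le_mono le1 ge).
by under eq_fun do rewrite opprB addrCA subrr addr0.
Qed.

(** Steps above the threshold tau0 are at most T / tau0 in number, so that iterating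
    the growth bound of a single step finitely often is enough for them. *)
Theorem approx_error : exists2 A, 0 <= A & forall tau n, 0 < tau -> n%:R * tau <= T ->
  norm_le test_l2 (fun k => al (n%:R * tau) k - approx tau n k) (A * tau).
Proof.
have [tau0 tau00 hb] := approx_bounded.
(* The growth of the l^1 norm in one step of length at most T. *)
pose g (x : R) := x + T * x ^+ 3.
have g0 x : 0 <= x -> x <= g x by move=> x0; rewrite lerDl mulr_ge0 ?exprn_ge0// ltW.
have giter m : 0 <= iter m g M by elim: m => //= m h; exact: le_trans h (g0 _ h).
have gmono m m' : (m <= m')%N -> iter m g M <= iter m' g M.
  by move=> /subnK <-; elim: (m' - m)%N => //= p h; exact: le_trans h (g0 _ (giter _)).
have crude tau n : 0 < tau -> tau <= T -> norm_le test_l1 (approx tau n) (iter n g M).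
  move=> tau1 tauT; elim: n => [|n IH]; first by apply: alM; rewrite in_itv/= lexx ltW.
  apply: norm_le_mono (step_bound hz tau1 (giter n) IH).
  by rewrite lerD2l ler_wpM2r ?exprn_ge0.
pose N := Num.bound (T / tau0); pose B := M + iter N g M.
have B0 : 0 <= B by rewrite addr_ge0.
have A1 : 0 <= T * C2 * expR (L * T) by rewrite !mulr_ge0 ?expR_ge0// ltW.
exists (T * C2 * expR (L * T) + B / tau0); first by rewrite addr_ge0// divr_ge0// ltW.
move=> tau n tau1 nT; have tl2 := @test_class_l2 R.
have nin : n%:R * tau \in `[0, T] by rewrite in_itv/= nT mulr_ge0// ltW.
have [small|big] := leP tau tau0.
  have C2t : 0 <= C2 * tau by rewrite mulr_ge0// ltW.
  have hj j : (j < n)%N -> norm_le test_l1 (approx tau j) (M + 1).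
    move=> jn; apply: hb => //; apply: le_trans nT.
    by rewrite ler_wpM2r ?(ltW tau1)// ler_nat ltnW.
  have ge := global_error tl2 tau1 C2t nT (fun t t0 tT => local_error_l2 t0 tau1 tT) hj.
  apply: norm_le_mono ge; rewrite [leRHS]mulrDl; apply: ler_wpDr.
    by rewrite mulr_ge0 ?divr_ge0// ltW.
  have -> : T * C2 * expR (L * T) * tau = T * (C2 * tau) * expR (L * T) by ring.
  apply: ler_pM => //; rewrite ?mulr_ge0 ?(ltW tau1)//.
  - by rewrite exprn_ge0// addr_ge0// mulr_ge0// ltW.
  - by rewrite ler_wpM2r.
  - exact: growth.
case: n nT nin => [|n] nT nin.
  apply: norm_le_mono (norm_le_dom tl2 _ (@norm_le0 R test_l2)) => //.
    by rewrite mulr_ge0 ?(ltW tau1)// addr_ge0// divr_ge0// ltW.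
  by move=> k; rewrite mul0r /approx/= subrr.
have tauT : tau <= T.
  by apply: le_trans nT; rewrite ler_peMl ?(ltW tau1)// ler1n.
have nN : (n.+1 <= N)%N.
  rewrite -(ler_nat R); apply: (@le_trans _ _ (T / tau0)).
    rewrite ler_pdivlMr//; apply: le_trans nT.
    by rewrite ler_wpM2l// ltW.
  by apply: ltW; apply: archi_boundP; rewrite divr_ge0// ltW.
have h1 := norm_leB test_class_l1 (alM nin) (crude tau n.+1 tau1 tauT).
apply: (norm_le_mono _ (norm_le_l1 tl2 h1)).
apply: (@le_trans _ _ B); first by rewrite lerD2l gmono.
rewrite mulrDl; apply: ler_wpDl; first by rewrite mulr_ge0// ltW.
by rewrite mulrAC ler_pdivlMr// ler_wpM2l// ltW.
Qed.

End Convergence.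

End ErrorAnalysis.

(** * Conclusion *)

Section Scheme.
Variable R : realType.
Local Notation C := R[i].

Lemma wiener_scheme_step b (tau : R) (v : R -> C) a : 0 < tau -> wiener v a ->
  wiener (scheme_step b tau v) (step (coupling R b) tau a).
Proof.
move=> tau0 wv; have p1 k : cabs (phi_symbol tau k) <= 1 by exact: cabs_phi_symbol.
have ww := wiener_coef_bounded p1 (wiener_conj wv).
have wc := wienerZ (coupling R b * (tau%:C)%C) (wiener_mul wv (wiener_mul wv ww)).
have wh := wiener_half_wave tau (wienerB wv wc).
have -> : step (coupling R b) tau a = twist tau (fun k => a k - coupling R b * (tau%:C)%C *
    conv a (conv a (fun m => phi_symbol tau m * conj_refl a m)) k).
  by apply/funext => k; rewrite /step (cub_conv p1 (wiener_l1 wv)).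
have -> : scheme_step b tau v = half_wave_group tau (fun x => v x -
    coupling R b * (tau%:C)%C * (v x * (v x *
      fourier_mult (phi_symbol tau) (fun y => ((v y)^*)%C) x))).
  rewrite /scheme_step; congr (half_wave_group tau _); apply/funext => x.
  have -> : phi1_mult tau = fourier_mult (phi_symbol tau) by [].
  by rewrite /coupling expr2 !mulrA.
exact: wh.
Qed.

Lemma wiener_scheme b (tau : R) (u0 : R -> C) a n : 0 < tau -> wiener u0 a ->
  wiener (scheme b tau u0 n) (iter n (step (coupling R b) tau) a).
Proof. by move=> tau0 w0; elim: n => //= n; exact: wiener_scheme_step. Qed.

End Scheme.

Unset Implicit Arguments.
Set Strict Implicit.

Theorem corollary23 (R : realType) (b : bool) (u0 : R -> R[i])
    (hu0 : inH (3%:R / 4%:R) u0) (T : R) (hT : 0 < T) (u : R -> R -> R[i])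
    (hu : continuous_in_H (3%:R / 4%:R) T u)
    (hmild : mild_solution b T u0 u) :
  exists2 C_T : R, 0 < C_T &
    forall (tau : R) (n : nat), 0 < tau -> n%:R * tau <= T ->
      (L2norm (fun x : R => u (n%:R * tau) x - scheme b tau u0 n x)%R
        <= (C_T * tau)%:E)%E.
Proof.
have [K K0 hK] := ucoef_bounded hu.
have al0 : ucoef u 0 = fourier_coef u0.
  apply/funext => k; have t0 : 0 \in `[0, T] by rewrite in_itv/= lexx ltW.
  rewrite (ucoef_duhamel0 hu0 hu hmild)// phase0 mul1r.
  have -> : cintegral `[0, 0] (fun xi => phase (0 - xi) k * source u xi k) = 0.
    by apply: complex_eqP; rewrite /cintegral/= set_itv1 Rintegral_set1.
  by rewrite mulr0 subr0.
have [A A0 hA] := approx_error (cabs_coupling R b) hT K0 hK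
  (fun c k D => @cintegrable_source R T u hu D c k)
  (fun t tau k => @ucoef_duhamel R b T u0 u hu0 hu hmild t tau k).
have c0 : 0 < Num.sqrt (2 * pi) :> R by rewrite sqrtr_gt0 mulr_gt0// pi_gt0.
exists (Num.sqrt (2 * pi) * (A + 1)); first by rewrite mulr_gt0// ltr_wpDl.
move=> tau n tau0 nT.
have nin : n%:R * tau \in `[0, T] by rewrite in_itv/= nT mulr_ge0// ltW.
have wn := wiener_scheme b n tau0 (inH_wiener hu0); rewrite -al0 in wn.
have wd := wienerB (u_wiener hu nin) wn.
apply: le_trans (parseval wd (mulr_ge0 A0 (ltW tau0)) (hA tau n tau0 nT)) _.
by rewrite lee_fin -mulrA ler_pM2l// ler_wpM2r ?(ltW tau0)// lerDl.
Qed.
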